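(* Let $Q$ be a Pitot quadrilateral with consecutive vertices $b_1,b_2,b_3,b_4$. Then there exists a parameter $p=p(b_1,b_2,b_3,b_4)\in(0,\pi)$ such that the step function $F:[0,2\pi)\to\mathbb{C}$ given by $$F(\theta)=\begin{cases} b_0=b_4, & \theta\in[0,p),\\ b_1, & \theta\in[p,\pi),\\ b_2, & \theta\in[\pi,\pi+p),\\ b_3, & \theta\in[\pi+p,2\pi),\end{cases}$$ has the Poisson extension $f=P[F]$ to the unit disk $\mathbb{D}$, $$f(z)=h(z)+\overline{g(z)},\qquad z\in\mathbb{D},$$ that is a sense-preserving harmonic mapping with the following properties: (i) The dilatation $\omega=g'/h'$ satisfies $\omega(z)=\phi(z)^2$, where $\phi$ is a Möbius automorphism of $\mathbb{D}$, $$\phi(z)=X\,\frac{z-z_\circ}{1-z\,\overline{z_\circ}},$$ with $|X|=1$ and $|z_\circ|<1$ being explicitly given in the hyperbolic coordinates with respect to the hyperbola containing the points $b_2$ and $b_4$ and with the foci at the points $b_1$ and $b_3$. (ii) The function $f$ is a harmonic diffeomorphism of the unit disk onto $Q$.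
   Context: $\mathbb{D}=\{z\in\mathbb{C}:|z|<1\}$, and $\mathbb{R}^2$ is identified with $\mathbb{C}$. A quadrilateral $Q=Q(b_1,b_2,b_3,b_4)$ has its vertices ordered counterclockwise; as the target of $f$ it denotes the domain bounded by its sides. It is a Pitot quadrilateral (convex or concave) if $|b_1-b_2|+|b_3-b_4|=|b_2-b_3|+|b_4-b_1|$. The Poisson extension of $F$ is $P[F](z)=\frac1{2\pi}\int_0^{2\pi}\frac{1-|z|^2}{|e^{i\theta}-z|^2}F(\theta)\,d\theta$; in the decomposition $f=h+\overline{g}$ the functions $h,g$ are analytic in $\mathbb{D}$ and $g(0)=0$. Hyperbolic coordinates: by the Pitot condition, $b_2$ and $b_4$ lie on the same branch of a hyperbola with foci $b_1,b_3$. After the similarity sending $b_1\mapsto-1$, $b_3\mapsto1$, they are described by real parameters $m,s,t$ through $$\frac{2b_2-b_1-b_3}{b_3-b_1}=\sin m\cosh t+i\cos m\sinh t,\qquad \frac{2b_4-b_1-b_3}{b_3-b_1}=\sin m\cosh s+i\cos m\sinh s.$$ *)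

(* Defs.v *)
From Stdlib Require Import Reals.
From Coquelicot Require Import Coquelicot.
Open Scope R_scope.

Definition disk (z : C) : Prop := Cmod z < 1.

Definition cis (x : R) : C := (cos x, sin x).

(** ** Quadrilaterals *)

Definition segment (a b z : C) : Prop :=
  exists t : R, 0 <= t <= 1 /\ z = (RtoC (1 - t) * a + RtoC t * b)%C.

(* Opposite sides are disjoint (so the four vertices are distinct) and
   adjacent sides share only their common vertex. *)
Definition simple_quadrilateral (b1 b2 b3 b4 : C) : Prop :=
  (forall z, ~ (segment b1 b2 z /\ segment b3 b4 z)) /\
  (forall z, ~ (segment b2 b3 z /\ segment b4 b1 z)) /\
  (forall z, segment b1 b2 z -> segment b2 b3 z -> z = b2) /\
  (forall z, segment b2 b3 z -> segment b3 b4 z -> z = b3) /\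
  (forall z, segment b3 b4 z -> segment b4 b1 z -> z = b4) /\
  (forall z, segment b4 b1 z -> segment b1 b2 z -> z = b1).

(* Shoelace formula: [Im (Cconj a * b)] is the cross product of [a] and [b]. *)
Definition signed_area (b1 b2 b3 b4 : C) : R :=
  (Im (Cconj b1 * b2) + Im (Cconj b2 * b3)
   + Im (Cconj b3 * b4) + Im (Cconj b4 * b1)) / 2.

Definition quadrilateral (b1 b2 b3 b4 : C) : Prop :=
  simple_quadrilateral b1 b2 b3 b4 /\ 0 < signed_area b1 b2 b3 b4.

Definition pitot_quadrilateral (b1 b2 b3 b4 : C) : Prop :=
  quadrilateral b1 b2 b3 b4 /\
  Cmod (b1 - b2) + Cmod (b3 - b4) = Cmod (b2 - b3) + Cmod (b4 - b1).

Definition on_sides (b1 b2 b3 b4 z : C) : Prop :=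
  segment b1 b2 z \/ segment b2 b3 z \/ segment b3 b4 z \/ segment b4 b1 z.

(* The domain bounded by the sides: the points off the sides whose path
   component in the complement of the sides is bounded. *)
Definition quad_domain (b1 b2 b3 b4 z : C) : Prop :=
  ~ on_sides b1 b2 b3 b4 z /\
  exists M : R, forall gamma : R -> C,
    (forall t, 0 <= t <= 1 -> continuous gamma t) ->
    gamma 0 = z ->
    (forall t, 0 <= t <= 1 -> ~ on_sides b1 b2 b3 b4 (gamma t)) ->
    Cmod (gamma 1) <= M.

(** ** Step function and Poisson extension *)

(* Only the values on [0, 2 PI) matter. *)
Definition step_function (b1 b2 b3 b4 : C) (p theta : R) : C :=
  if Rlt_dec theta p then b4
  else if Rlt_dec theta PI then b1
  else if Rlt_dec theta (PI + p) then b2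
  else b3.

Definition poisson (F : R -> C) (z : C) : C :=
  (RtoC (/ (2 * PI)) *
   RInt (V := C_R_CompleteNormedModule)
     (fun theta =>
        RtoC ((1 - Cmod z ^ 2) / Cmod (cis theta - z) ^ 2) * F theta)%C
     0 (2 * PI))%C.

(** ** Real differential calculus in the plane *)

Definition dx (u : C -> R) (z : C) : R := Derive (fun x => u (x, Im z)) (Re z).
Definition dy (u : C -> R) (z : C) : R := Derive (fun y => u (Re z, y)) (Im z).

Definition has_partials (u : C -> R) (z : C) : Prop :=
  ex_derive (fun x => u (x, Im z)) (Re z) /\
  ex_derive (fun y => u (Re z, y)) (Im z).

Fixpoint class_C (n : nat) (U : C -> Prop) (u : C -> R) : Prop :=
  (forall z, U z -> continuous u z) /\
  match n with
  | O => True
  | S k => (forall z, U z -> has_partials u z) /\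
           class_C k U (dx u) /\ class_C k U (dy u)
  end.

Definition re_part (f : C -> C) (z : C) : R := Re (f z).
Definition im_part (f : C -> C) (z : C) : R := Im (f z).

Definition smooth_on (U : C -> Prop) (f : C -> C) : Prop :=
  forall n, class_C n U (re_part f) /\ class_C n U (im_part f).

Definition real_harmonic_on (U : C -> Prop) (u : C -> R) : Prop :=
  class_C 2 U u /\ forall z, U z -> dx (dx u) z + dy (dy u) z = 0.

Definition harmonic_on (U : C -> Prop) (f : C -> C) : Prop :=
  real_harmonic_on U (re_part f) /\ real_harmonic_on U (im_part f).

Definition jacobian (f : C -> C) (z : C) : R :=
  dx (re_part f) z * dy (im_part f) z - dy (re_part f) z * dx (im_part f) z.

Definition sense_preserving_on (U : C -> Prop) (f : C -> C) : Prop :=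
  forall z, U z -> 0 < jacobian f z.

Definition diffeomorphism (U V : C -> Prop) (f : C -> C) : Prop :=
  smooth_on U f /\
  (forall z, U z -> V (f z)) /\
  exists k : C -> C,
    smooth_on V k /\
    (forall w, V w -> U (k w)) /\
    (forall z, U z -> k (f z) = z) /\
    (forall w, V w -> f (k w) = w).

Definition analytic_on (U : C -> Prop) (h : C -> C) : Prop :=
  forall z, U z -> @ex_derive C_AbsRing C_NormedModule h z.

(** ** Dilatation in hyperbolic coordinates *)

(* For [- PI / 2 < m < PI / 2] the curve
   [t |-> sin m cosh t + i cos m sinh t] is a whole branch of a hyperbola with
   foci [-1] and [1] (the imaginary axis when [m = 0]), traversed upwards. *)
Definition hyperbola_point (m t : R) : C :=
  (sin m * cosh t, cos m * sinh t).

Definition hyperbolic_coordinates (b1 b2 b3 b4 : C) (m s t : R) : Prop :=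
  - (PI / 2) < m < PI / 2 /\
  ((2 * b2 - b1 - b3) / (b3 - b1))%C = hyperbola_point m t /\
  ((2 * b4 - b1 - b3) / (b3 - b1))%C = hyperbola_point m s.

(* Put [d = (s - t) / 2] and [mu = m + i (s + t) / 2].  When [b1 = -1] and
   [b3 = 1], the numerator of [h'] has discriminant zero exactly when
   [tan (p / 2) = 1 / sinh d], that is
   [exp (i p / 2) = (sinh d + i) / cosh d], and then
     [z0 = - i exp (i p / 2) tan (conj mu / 2)],
     [X  = i exp (- i p / 2) cos (conj mu / 2) / cos (mu / 2)],
   which are the closed forms below.  [X] is determined only up to sign.  The
   similarity [w |-> (b3 - b1) / 2 * w + (b1 + b3) / 2] leaves [z0] unchanged
   and multiplies [X] by the unimodular factor [conj (b3 - b1) / |b3 - b1|]. *)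
Definition dilatation_zero (m s t : R) : C :=
  let d := (s - t) / 2 in
  let sigma := (s + t) / 2 in
  ((1, - sinh d)%R * (sin m, - sinh sigma)%R
   / RtoC (cosh d * (cos m + cosh sigma)))%C.

Definition dilatation_factor (b1 b3 : C) (m s t : R) : C :=
  let d := (s - t) / 2 in
  let sigma := (s + t) / 2 in
  ((1, sinh d)%R * (1 + cos m * cosh sigma, sin m * sinh sigma)%R
   / RtoC (cosh d * (cos m + cosh sigma))
   * (Cconj (b3 - b1) / RtoC (Cmod (b3 - b1))))%C.

Definition mobius (X z0 z : C) : C := (X * ((z - z0) / (1 - z * Cconj z0)))%C.

(* Main.v *)
(** Differentiating [P[F] = h + conj g] gives [h'] and [g'] as sums of four
    simple poles.  The Pitot condition puts [b2] and [b4] on one branch of a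
    hyperbola with foci [b1], [b3]; with [tan (p / 2) = 1 / sinh ((s - t) / 2)] the
    quadratic numerators of both have discriminant zero, so that [g' / h'] is the
    square of a Moebius automorphism of the disk; hence [|g'| < |h'|] and the
    Jacobian is positive.

    For bijectivity, use a diagonal separating the two other vertices (a reflex
    vertex lies on such a diagonal), and let [u], [v] be the components of [f]
    along it and across it.  Then [v] is a combination, with coefficients of
    opposite signs, of the harmonic measures of two opposite arcs, so it is
    strictly monotone along the hypercycles joining the midpoints of these arcs.
    Its level sets are therefore graphs over the transverse coordinate; along
    each of them [u] is monotone, because the Jacobian is positive, and runs
    between the two sides of the quadrilateral at that level.  The inverse is
    continuous by monotonicity and smooth by the chain rule.  A horizontal ray
    leads from any point outside to infinity without meeting the sides, which
    identifies the image with the domain bounded by the sides. *)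
Require Import Defs.
From Stdlib Require Import Reals Ranalysis5 Lra ClassicalEpsilon.
From Coquelicot Require Import Coquelicot.
Open Scope R_scope.

(** The boundary function jumps, so [f] has no continuous extension to the circle, and the target
    may be concave: an argument that compares boundary curves is not at hand. The coordinates
    [P = 2 exp (- i p / 2) z / (1 - |z|^2)] push the circle to infinity. The disk becomes the whole
    plane, the hypercycles become the lines [Im P = y], and every harmonic measure becomes an arc
    cotangent of a linear form in [P] and [T = sqrt (1 + |P|^2)]. The behaviour at the jumps turns
    into estimates for large [|Im P|] that are uniform in [Re P]; no boundary value of [f] is ever
    taken. A point of the target is hit by solving two scalar monotone equations, one for [Re P] on
    each horizontal line and one for [Im P] along a level curve, so the intermediate value theorem
    replaces degree theory. All of this rests on closed forms: [1 - z exp (- i theta)] has positive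
    real part on the disk, hence its argument is an [atan] without a cut, and the Poisson integral
    of a step function is a finite sum of such arguments. *)

(** * Real differentiability in the plane *)

Lemma locally_horizontal (z : C) (P : C -> Prop) :
  locally z P -> locally (Re z) (fun x => P (x, Im z)).
Proof.
  intros [d Hd]. exists d. intros x Hx. apply Hd. split; simpl.
  - exact Hx.
  - apply ball_center.
Qed.

Lemma locally_vertical (z : C) (P : C -> Prop) :
  locally z P -> locally (Im z) (fun y => P (Re z, y)).
Proof.
  intros [d Hd]. exists d. intros y Hy. apply Hd. split; simpl.
  - apply ball_center.
  - exact Hy.
Qed.

(** Total differentiability: the existence of the partial derivatives behind [dx] and [dy] does not
    by itself give a chain rule. *)
Definition has_gradient (u : C -> R) (z : C) (a b : R) : Prop :=
  differentiable_pt_lim (fun x y => u (x, y)) (Re z) (Im z) a b.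

Lemma has_gradient_dx u z a b :
  has_gradient u z a b -> is_derive (fun x => u (x, Im z)) (Re z) a.
Proof.
  intros H. apply is_derive_Reals.
  replace a with (a * 1 + b * 0) by ring.
  apply (derivable_pt_lim_comp_2d (fun x y => u (x, y)) (fun x => x) (fun _ => Im z)).
  - exact H.
  - apply derivable_pt_lim_id.
  - apply derivable_pt_lim_const.
Qed.

Lemma has_gradient_dy u z a b :
  has_gradient u z a b -> is_derive (fun y => u (Re z, y)) (Im z) b.
Proof.
  intros H. apply is_derive_Reals.
  replace b with (a * 0 + b * 1) by ring.
  apply (derivable_pt_lim_comp_2d (fun x y => u (x, y)) (fun _ => Re z) (fun y => y)).
  - exact H.
  - apply derivable_pt_lim_const.
  - apply derivable_pt_lim_id.
Qed.

Lemma has_gradient_unique u z a b a' b' :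
  has_gradient u z a b -> has_gradient u z a' b' -> a = a' /\ b = b'.
Proof.
  intros H H'.
  apply differentiable_pt_lim_unique in H as [<- <-].
  apply differentiable_pt_lim_unique in H' as [<- <-]. auto.
Qed.

Lemma has_gradient_filterdiff u (z : C) a b :
  has_gradient u z a b <->
  filterdiff (u : R * R -> R) (locally (z : R * R)) (fun h : R * R => fst h * a + snd h * b).
Proof.
  destruct z as [x y]. unfold has_gradient. rewrite <- filterdiff_differentiable_pt_lim. simpl.
  split; apply filterdiff_ext; intros [? ?]; reflexivity.
Qed.

Lemma has_gradient_continuous u (z : C) a b :
  has_gradient u z a b -> continuous u z.
Proof.
  intros H. apply has_gradient_filterdiff in H.
  apply (filterdiff_continuous (K := R_AbsRing) (U := prod_NormedModule _ R_NormedModule R_NormedModule) (V := R_NormedModule) u z).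
  eexists. exact H.
Qed.

Lemma has_gradient_comp u k1 k2 (z : C) a b a1 b1 a2 b2 :
  has_gradient u (k1 z, k2 z) a b ->
  has_gradient k1 z a1 b1 -> has_gradient k2 z a2 b2 ->
  has_gradient (fun w => u (k1 w, k2 w)) z (a * a1 + b * a2) (a * b1 + b * b2).
Proof.
  destruct z as [x y]. unfold has_gradient; simpl. intros H H1 H2.
  apply (differentiable_pt_lim_comp (fun x y => u (x, y)) (fun x y => k1 (x, y)) (fun x y => k2 (x, y)));
    assumption.
Qed.

Lemma has_gradient_ext u v (z : C) a b :
  locally z (fun w => u w = v w) -> has_gradient u z a b -> has_gradient v z a b.
Proof.
  intros E. unfold has_gradient. apply differentiable_pt_lim_ext.
  apply locally_2d_locally. destruct z. revert E. apply filter_imp. intros [? ?]; auto.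
Qed.

Lemma continuous_real_mult (T : UniformSpace) (u v : T -> R) (z : T) :
  continuous u z -> continuous v z -> continuous (fun w => u w * v w) z.
Proof. apply (continuous_mult (K := R_AbsRing)). Qed.

Lemma continuous_real_plus (T : UniformSpace) (u v : T -> R) (z : T) :
  continuous u z -> continuous v z -> continuous (fun w => u w + v w) z.
Proof. apply (continuous_plus (V := R_NormedModule)). Qed.

Lemma continuous_real_comp (T : UniformSpace) (u : T -> R) (phi : R -> R) (z : T) :
  continuous u z -> continuous phi (u z) -> continuous (fun w => phi (u w)) z.
Proof. apply continuous_comp. Qed.

Lemma ex_derive_continuous_real (phi : R -> R) (x : R) : ex_derive phi x -> continuous phi x.
Proof. apply (ex_derive_continuous (V := R_NormedModule)). Qed.

Lemma continuous_real_inv (T : UniformSpace) (u : T -> R) (z : T) :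
  continuous u z -> u z <> 0 -> continuous (fun w => / u w) z.
Proof.
  intros H H0. apply continuous_real_comp; [exact H|].
  apply ex_derive_continuous_real. auto_derive. exact H0.
Qed.

Lemma continuous_pair (T : UniformSpace) (u v : T -> R) (z : T) :
  continuous u z -> continuous v z -> continuous (fun w => (u w, v w) : C) z.
Proof.
  intros Hu Hv P [d Hd].
  assert (Lu : locally z (fun w => ball (u z) d (u w))) by apply (Hu _ (locally_ball _ d)).
  assert (Lv : locally z (fun w => ball (v z) d (v w))) by apply (Hv _ (locally_ball _ d)).
  generalize (filter_and _ _ Lu Lv). unfold filtermap. apply filter_imp. intros w [A B]. apply Hd. split; assumption.
Qed.

Lemma continuous_Re (z : C) : continuous Re z.
Proof. apply continuous_fst. Qed.

Lemma continuous_Im (z : C) : continuous Im z.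
Proof. apply continuous_snd. Qed.

(** * Closure properties of the classes [class_C] *)

Lemma class_C_continuous n U u z : class_C n U u -> U z -> continuous u z.
Proof. destruct n; intros [H _]; auto. Qed.

Lemma class_C_le n U u : class_C (S n) U u -> class_C n U u.
Proof.
  revert u. induction n as [|n IH]; intros u [H1 [H2 [H3 H4]]]; split; auto.
Qed.

Lemma is_derive_dx u z : has_partials u z -> is_derive (fun x => u (x, Im z)) (Re z) (dx u z).
Proof. intros [H _]. apply Derive_correct, H. Qed.

Lemma is_derive_dy u z : has_partials u z -> is_derive (fun y => u (Re z, y)) (Im z) (dy u z).
Proof. intros [_ H]. apply Derive_correct, H. Qed.

Section OpenSet.

Variable U : C -> Prop.
Hypothesis U_open : open U.

Lemma dx_ext u v z : (forall w, U w -> u w = v w) -> U z -> dx u z = dx v z.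
Proof.
  intros E Uz. apply Derive_ext_loc.
  generalize (locally_horizontal _ _ (U_open z Uz)). apply filter_imp. auto.
Qed.

Lemma dy_ext u v z : (forall w, U w -> u w = v w) -> U z -> dy u z = dy v z.
Proof.
  intros E Uz. apply Derive_ext_loc.
  generalize (locally_vertical _ _ (U_open z Uz)). apply filter_imp. auto.
Qed.

Lemma class_C_ext n u v :
  (forall z, U z -> u z = v z) -> class_C n U u -> class_C n U v.
Proof.
  assert (K : forall u v : C -> R, (forall z, U z -> u z = v z) ->
            (forall z, U z -> continuous u z) -> forall z, U z -> continuous v z).
  { intros u' v' E H z Uz. apply continuous_ext_loc with (g := u').
    - generalize (U_open z Uz). apply filter_imp. intros w Uw. auto.
    - auto. }
  revert u v. induction n as [|n IH]; intros u v E H.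
  - destruct H as [H _]. split; [|exact I]. eapply K; eauto.
  - destruct H as [H1 [H2 [H3 H4]]]. split; [eapply K; eauto|]. split; [|split].
    + intros z Uz. destruct (H2 z Uz) as [A B]. split.
      * revert A. apply ex_derive_ext_loc.
        generalize (locally_horizontal _ _ (U_open z Uz)). apply filter_imp. auto.
      * revert B. apply ex_derive_ext_loc.
        generalize (locally_vertical _ _ (U_open z Uz)). apply filter_imp. auto.
    + apply (IH (dx u)); [|exact H3]. intros z Uz. apply dx_ext; auto.
    + apply (IH (dy u)); [|exact H4]. intros z Uz. apply dy_ext; auto.
Qed.

(** [class_C] recurses through [dx u] and [dy u], which are values of [Derive]. Because [U] is open,
    closed forms of the partials on [U] may stand in for them. *)
Lemma class_C_S n u a b :
  (forall z, U z -> continuous u z) ->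
  (forall z, U z -> is_derive (fun x => u (x, Im z)) (Re z) (a z)) ->
  (forall z, U z -> is_derive (fun y => u (Re z, y)) (Im z) (b z)) ->
  class_C n U a -> class_C n U b -> class_C (S n) U u.
Proof.
  intros Hu Ha Hb Ca Cb. split; [exact Hu|]. split; [|split].
  - intros z Uz. split; eexists; [apply Ha|apply Hb]; exact Uz.
  - apply (class_C_ext n a); [|exact Ca]. intros z Uz. symmetry.
    apply is_derive_unique. auto.
  - apply (class_C_ext n b); [|exact Cb]. intros z Uz. symmetry.
    apply is_derive_unique. auto.
Qed.

Lemma class_C_const n c : class_C n U (fun _ => c).
Proof.
  revert c. induction n as [|n IH]; intros c.
  - split; [|exact I]. intros. apply continuous_const.
  - apply (class_C_S n _ (fun _ => 0) (fun _ => 0)); auto.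
    + intros. apply continuous_const.
    + intros. apply (is_derive_const (V := R_NormedModule)).
    + intros. apply (is_derive_const (V := R_NormedModule)).
Qed.

Lemma class_C_Re n : class_C n U Re.
Proof.
  destruct n as [|n].
  - split; [|exact I]. intros. apply continuous_Re.
  - apply (class_C_S n _ (fun _ => 1) (fun _ => 0)); auto using class_C_const.
    + intros. apply continuous_Re.
    + intros. apply (is_derive_id (K := R_AbsRing)).
    + intros. apply (is_derive_const (V := R_NormedModule) (Re z) (Im z)).
Qed.

Lemma class_C_Im n : class_C n U Im.
Proof.
  destruct n as [|n].
  - split; [|exact I]. intros. apply continuous_Im.
  - apply (class_C_S n _ (fun _ => 0) (fun _ => 1)); auto using class_C_const.
    + intros. apply continuous_Im.
    + intros. apply (is_derive_const (V := R_NormedModule) (Im z) (Re z)).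
    + intros. apply (is_derive_id (K := R_AbsRing)).
Qed.

Lemma class_C_plus n u v :
  class_C n U u -> class_C n U v -> class_C n U (fun z => u z + v z).
Proof.
  revert u v. induction n as [|n IH]; intros u v Hu Hv.
  - split; [|exact I]. intros. apply continuous_real_plus; [apply Hu|apply Hv]; auto.
  - pose proof Hu as [Hu1 [Hu2 [Hu3 Hu4]]]. pose proof Hv as [Hv1 [Hv2 [Hv3 Hv4]]].
    apply (class_C_S n _ (fun z => dx u z + dx v z) (fun z => dy u z + dy v z)); auto.
    + intros. apply continuous_real_plus; auto.
    + intros z Uz. apply (is_derive_plus (V := R_NormedModule)); apply is_derive_dx; auto.
    + intros z Uz. apply (is_derive_plus (V := R_NormedModule)); apply is_derive_dy; auto.
Qed.

Lemma class_C_mult n u v :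
  class_C n U u -> class_C n U v -> class_C n U (fun z => u z * v z).
Proof.
  revert u v. induction n as [|n IH]; intros u v Hu Hv.
  - split; [|exact I]. intros. apply continuous_real_mult; [apply Hu|apply Hv]; auto.
  - pose proof Hu as [Hu1 [Hu2 [Hu3 Hu4]]]. pose proof Hv as [Hv1 [Hv2 [Hv3 Hv4]]].
    pose proof (class_C_le _ _ _ Hu). pose proof (class_C_le _ _ _ Hv).
    apply (class_C_S n _ (fun z => dx u z * v z + u z * dx v z)
                         (fun z => dy u z * v z + u z * dy v z));
      auto using class_C_plus.
    + intros. apply continuous_real_mult; auto.
    + intros [x y] Uz.
      apply (is_derive_mult (K := R_AbsRing) (fun x => u (x, y)) (fun x => v (x, y)));
        [apply (is_derive_dx u (x, y))|apply (is_derive_dx v (x, y))|intros; apply Rmult_comm]; auto.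
    + intros [x y] Uz.
      apply (is_derive_mult (K := R_AbsRing) (fun y => u (x, y)) (fun y => v (x, y)));
        [apply (is_derive_dy u (x, y))|apply (is_derive_dy v (x, y))|intros; apply Rmult_comm]; auto.
Qed.

Lemma class_C_opp n u : class_C n U u -> class_C n U (fun z => - u z).
Proof.
  intros H. apply (class_C_ext n (fun z => -1 * u z)); [intros; ring|].
  apply class_C_mult; [apply class_C_const|exact H].
Qed.

Lemma class_C_minus n u v :
  class_C n U u -> class_C n U v -> class_C n U (fun z => u z - v z).
Proof. intros. apply class_C_plus; [|apply class_C_opp]; assumption. Qed.

(** The derivative of [/ u] is written as a product that contains [/ u] twice, so the induction
    hypothesis on [/ u] itself supplies its regularity. *)
Lemma class_C_inv n u :
  (forall z, U z -> u z <> 0) -> class_C n U u -> class_C n U (fun z => / u z).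
Proof.
  intros H0. induction n as [|n IH]; intros Hu.
  - split; [|exact I]. intros. apply continuous_real_inv; [apply Hu|]; auto.
  - pose proof Hu as [Hu1 [Hu2 [Hu3 Hu4]]]. pose proof (IH (class_C_le _ _ _ Hu)).
    apply (class_C_S n _ (fun z => - dx u z * (/ u z * / u z))
                         (fun z => - dy u z * (/ u z * / u z)));
      auto using class_C_mult, class_C_opp.
    + intros. apply continuous_real_inv; auto.
    + intros [x y] Uz.
      replace (- dx u (x, y) * (/ u (x, y) * / u (x, y))) with (- dx u (x, y) / u (x, y) ^ 2)
        by (field; auto).
      apply (is_derive_inv (fun x => u (x, y))); [apply (is_derive_dx u (x, y))|]; auto.
    + intros [x y] Uz.
      replace (- dy u (x, y) * (/ u (x, y) * / u (x, y))) with (- dy u (x, y) / u (x, y) ^ 2)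
        by (field; auto).
      apply (is_derive_inv (fun y => u (x, y))); [apply (is_derive_dy u (x, y))|]; auto.
Qed.

Lemma class_C_div n u v :
  (forall z, U z -> v z <> 0) ->
  class_C n U u -> class_C n U v -> class_C n U (fun z => u z / v z).
Proof. intros. apply class_C_mult; [|apply class_C_inv]; assumption. Qed.

Lemma class_C_gradient u z :
  class_C 1 U u -> U z -> has_gradient u z (dx u z) (dy u z).
Proof.
  intros [H1 [H2 [H3 H4]]] Uz. apply has_gradient_filterdiff.
  destruct z as [x y].
  apply filterdiff_ext with (f := fun w : R * R => (fun x y => u (x, y)) (fst w) (snd w)).
  { intros [? ?]; reflexivity. }
  apply (is_derive_filterdiff (fun x y => u (x, y)) x y (fun x y => dx u (x, y))).
  - generalize (U_open _ Uz). apply filter_imp. intros [a b] Hab. simpl.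
    apply (is_derive_dx u (a, b)), H2, Hab.
  - apply (is_derive_dy u (x, y)), H2, Uz.
  - apply continuous_ext with (f := dx u); [intros [? ?]; reflexivity|].
    apply (class_C_continuous 0 U); auto.
Qed.

End OpenSet.

Lemma class_C_comp n U W u k1 k2 :
  open U -> open W ->
  (forall w, W w -> U (k1 w, k2 w)) ->
  class_C n U u -> class_C n W k1 -> class_C n W k2 ->
  class_C n W (fun w => u (k1 w, k2 w)).
Proof.
  intros HU HW Hk. revert u. induction n as [|n IH]; intros u Cu C1 C2.
  - split; [|exact I]. intros z Wz.
    apply (continuous_comp (fun w => (k1 w, k2 w) : C) u).
    + apply continuous_pair; [apply C1|apply C2]; exact Wz.
    + apply Cu. auto.
  - pose proof Cu as [Hu1 [Hu2 [Hu3 Hu4]]].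
    pose proof C1 as [_ [_ [C13 C14]]]. pose proof C2 as [_ [_ [C23 C24]]].
    pose proof (class_C_le _ _ _ C1) as D1. pose proof (class_C_le _ _ _ C2) as D2.
    assert (G : forall z, W z -> has_gradient (fun w => u (k1 w, k2 w)) z
               (dx u (k1 z, k2 z) * dx k1 z + dy u (k1 z, k2 z) * dx k2 z)
               (dx u (k1 z, k2 z) * dy k1 z + dy u (k1 z, k2 z) * dy k2 z)).
    { assert (L : forall U u, class_C (S n) U u -> class_C 1 U u).
      { clear. intros U u [H1 [H2 [H3 H4]]]. split; auto. split; auto.
        split; (split; [|exact I]); intros; eapply class_C_continuous; eauto. }
      intros z Wz. apply has_gradient_comp.
      - apply (class_C_gradient U); auto.
      - apply (class_C_gradient W); auto.
      - apply (class_C_gradient W); auto. }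
    apply (class_C_S W HW n _
      (fun z => dx u (k1 z, k2 z) * dx k1 z + dy u (k1 z, k2 z) * dx k2 z)
      (fun z => dx u (k1 z, k2 z) * dy k1 z + dy u (k1 z, k2 z) * dy k2 z)).
    + intros z Wz. eapply has_gradient_continuous, G, Wz.
    + intros z Wz. exact (has_gradient_dx _ z _ _ (G z Wz)).
    + intros z Wz. exact (has_gradient_dy _ z _ _ (G z Wz)).
    + apply (class_C_plus W HW); apply (class_C_mult W HW); auto.
    + apply (class_C_plus W HW); apply (class_C_mult W HW); auto.
Qed.

(** * Differentiability and smoothness of inverse maps *)

Lemma has_gradient_locally u (z : C) a b :
  has_gradient u z a b <->
  forall eps : posreal, locally z (fun w : C =>
    Rabs (u w - u z - (a * (Re w - Re z) + b * (Im w - Im z)))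
      <= eps * Rmax (Rabs (Re w - Re z)) (Rabs (Im w - Im z))).
Proof.
  destruct z as [x y]. unfold has_gradient, differentiable_pt_lim. simpl.
  split; intros H eps; specialize (H eps); apply locally_2d_locally in H || apply locally_2d_locally;
    revert H; apply filter_imp; intros [p q]; simpl; auto.
Qed.

Lemma Rabs_Rmax_lin (p q x y e : R) :
  Rabs x <= e -> Rabs y <= e -> Rabs (p * x + q * y) <= (Rabs p + Rabs q) * e.
Proof.
  intros Hx Hy. eapply Rle_trans; [apply Rabs_triang|]. rewrite !Rabs_mult.
  pose proof (Rabs_pos p). pose proof (Rabs_pos q). nra.
Qed.

(** With the inverse already continuous, first-order remainders of [(u, v)] at [(k1 w, k2 w)] are
    small compared with the increment of [(k1, k2)]. Applying the inverse matrix bounds this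
    increment by a multiple of that of [w], plus a small multiple of itself that can be absorbed.
    With [Im] for both [v] and [k2] the lemma acts as an implicit function theorem. *)
Lemma has_gradient_inverse u v k1 k2 (w0 : C) a b c d :
  has_gradient u (k1 w0, k2 w0) a b -> has_gradient v (k1 w0, k2 w0) c d ->
  a * d - b * c <> 0 ->
  continuous k1 w0 -> continuous k2 w0 ->
  locally w0 (fun w => u (k1 w, k2 w) = Re w /\ v (k1 w, k2 w) = Im w) ->
  has_gradient k1 w0 (d / (a * d - b * c)) (- b / (a * d - b * c)) /\
  has_gradient k2 w0 (- c / (a * d - b * c)) (a / (a * d - b * c)).
Proof.
  intros Hu Hv Hdet C1 C2 Hinv.
  set (D := a * d - b * c) in *.
  set (z0 := (k1 w0, k2 w0) : C) in *.
  (* A bound in the sup norm for the inverse matrix; the summand 1 ensures [1 <= M]. *)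
  set (M := (Rabs a + Rabs b + Rabs c + Rabs d) / Rabs D + 1).
  assert (HD : 0 < Rabs D) by (apply Rabs_pos_lt; exact Hdet).
  assert (HM : 1 <= M).
  { unfold M. pose proof (Rabs_pos a); pose proof (Rabs_pos b); pose proof (Rabs_pos c);
    pose proof (Rabs_pos d).
    assert (0 <= (Rabs a + Rabs b + Rabs c + Rabs d) / Rabs D)
      by (apply Rmult_le_pos; [lra|apply Rlt_le, Rinv_0_lt_compat; lra]). lra. }
  assert (Hb : forall p q x y e, Rabs p + Rabs q <= Rabs a + Rabs b + Rabs c + Rabs d ->
            0 <= e -> Rabs x <= e -> Rabs y <= e -> Rabs ((p * x + q * y) / D) <= M * e).
  { intros p q x y e Hpq He Hx Hy. unfold Rdiv. rewrite Rabs_mult, Rabs_inv.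
    apply Rle_trans with ((Rabs p + Rabs q) * e * / Rabs D).
    - apply Rmult_le_compat_r; [apply Rlt_le, Rinv_0_lt_compat, HD|]. apply Rabs_Rmax_lin; auto.
    - unfold M, Rdiv.
      assert (0 < / Rabs D) by (apply Rinv_0_lt_compat, HD).
      assert (0 <= (Rabs a + Rabs b + Rabs c + Rabs d - (Rabs p + Rabs q)) * (e * / Rabs D)).
      { apply Rmult_le_pos; [lra|]. apply Rmult_le_pos; lra. }
      nra. }
  assert (Main : forall eps : posreal, locally w0 (fun w : C =>
     Rabs (k1 w - k1 w0 - (d / D * (Re w - Re w0) + - b / D * (Im w - Im w0)))
      <= eps * Rmax (Rabs (Re w - Re w0)) (Rabs (Im w - Im w0)) /\
     Rabs (k2 w - k2 w0 - (- c / D * (Re w - Re w0) + a / D * (Im w - Im w0)))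
      <= eps * Rmax (Rabs (Re w - Re w0)) (Rabs (Im w - Im w0)))).
  { intros eps.
    (* The first bound makes [M * e] at most one half, which permits the absorption; the second
       keeps the final error factor [2 * M * M * e] below [eps]. *)
    set (e := Rmin (/ (2 * M)) (eps / (2 * M * M))).
    assert (He : 0 < e).
    { apply Rmin_glb_lt; [apply Rinv_0_lt_compat; lra|].
      apply Rdiv_lt_0_compat; [apply cond_pos|nra]. }
    assert (He1 : M * e <= / 2).
    { apply Rle_trans with (M * / (2 * M)).
      - apply Rmult_le_compat_l; [lra|apply Rmin_l].
      - right. field. lra. }
    assert (He2 : 2 * M * M * e <= eps).
    { apply Rle_trans with (2 * M * M * (eps / (2 * M * M))).
      - apply Rmult_le_compat_l; [nra|apply Rmin_r].
      - right. field. lra. }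
    rewrite has_gradient_locally in Hu, Hv.
    specialize (Hu (mkposreal e He)). specialize (Hv (mkposreal e He)). simpl in Hu, Hv.
    assert (Ck : continuous (fun w => (k1 w, k2 w) : C) w0) by (apply continuous_pair; assumption).
    pose proof (Ck _ Hu) as Lu. pose proof (Ck _ Hv) as Lv. unfold filtermap in Lu, Lv.
    generalize (filter_and _ _ (filter_and _ _ Lu Lv) Hinv).
    apply locally_singleton in Hinv. destruct Hinv as [I1 I2]. fold z0 in I1, I2.
    apply filter_imp.
    intros w [[Eu Ev] [Iu Iv]]. rewrite Iu, I1 in Eu. rewrite Iv, I2 in Ev.
    unfold z0 in Eu, Ev. simpl in Eu, Ev.
    set (X := k1 w - k1 w0) in *. set (Y := k2 w - k2 w0) in *.
    set (P := Re w - Re w0) in *. set (Q := Im w - Im w0) in *.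
    set (m := Rmax (Rabs X) (Rabs Y)) in *. set (n := Rmax (Rabs P) (Rabs Q)).
    assert (Hm : 0 <= m) by (apply Rle_trans with (Rabs X); [apply Rabs_pos|apply Rmax_l]).
    assert (Hn : 0 <= n) by (apply Rle_trans with (Rabs P); [apply Rabs_pos|apply Rmax_l]).
    set (r := P - (a * X + b * Y)) in *. set (s := Q - (c * X + d * Y)) in *.
    assert (HP : Rabs P <= n) by apply Rmax_l. assert (HQ : Rabs Q <= n) by apply Rmax_r.
    assert (EX : X - (d / D * P + - b / D * Q) = ((- d) * r + b * s) / D).
    { unfold r, s. fold D in Hdet. unfold D in *. field. exact Hdet. }
    assert (EY : Y - (- c / D * P + a / D * Q) = (c * r + (- a) * s) / D).
    { unfold r, s. unfold D in *. field. exact Hdet. }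
    pose proof (Rabs_pos a); pose proof (Rabs_pos b); pose proof (Rabs_pos c);
    pose proof (Rabs_pos d).
    assert (0 <= e * m) by (apply Rmult_le_pos; lra).
    assert (BX : Rabs (X - (d / D * P + - b / D * Q)) <= M * (e * m)).
    { rewrite EX. apply Hb; auto. rewrite Rabs_Ropp. lra. }
    assert (BY : Rabs (Y - (- c / D * P + a / D * Q)) <= M * (e * m)).
    { rewrite EY. apply Hb; auto. rewrite Rabs_Ropp. lra. }
    assert (LX : Rabs (d / D * P + - b / D * Q) <= M * n).
    { replace (d / D * P + - b / D * Q) with ((d * P + (- b) * Q) / D) by (field; exact Hdet).
      apply Hb; auto. rewrite Rabs_Ropp. lra. }
    assert (LY : Rabs (- c / D * P + a / D * Q) <= M * n).
    { replace (- c / D * P + a / D * Q) with (((- c) * P + a * Q) / D) by (field; exact Hdet).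
      apply Hb; auto. rewrite Rabs_Ropp. lra. }
    assert (Bm : m <= 2 * M * n).
    { assert (m <= M * n + M * (e * m)).
      { apply Rmax_lub.
        - replace X with ((d / D * P + - b / D * Q) + (X - (d / D * P + - b / D * Q))) by ring.
          eapply Rle_trans; [apply Rabs_triang|]. lra.
        - replace Y with ((- c / D * P + a / D * Q) + (Y - (- c / D * P + a / D * Q))) by ring.
          eapply Rle_trans; [apply Rabs_triang|]. lra. }
      assert (M * e * m <= / 2 * m) by (apply Rmult_le_compat_r; lra). lra. }
    assert (M * (e * m) <= eps * n).
    { apply Rle_trans with (M * e * (2 * M * n)).
      - rewrite <- Rmult_assoc. apply Rmult_le_compat_l; [nra|exact Bm].
      - replace (M * e * (2 * M * n)) with (2 * M * M * e * n) by ring.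
        apply Rmult_le_compat_r; lra. }
    split; lra. }
  split; apply has_gradient_locally; intros eps; generalize (Main eps);
    apply filter_imp; intros w [A B]; assumption.
Qed.

(** Bootstrapping: the partials of [k1] and [k2] are quotients of partials of [u] and [v] evaluated
    at [(k1, k2)], so class [n] for [k1] and [k2] yields class [n + 1]. *)
Lemma class_C_inverse U W u v k1 k2 :
  open U -> open W ->
  (forall n, class_C n U u) -> (forall n, class_C n U v) ->
  (forall z, U z -> dx u z * dy v z - dy u z * dx v z <> 0) ->
  (forall w, W w -> U (k1 w, k2 w)) ->
  (forall w, W w -> u (k1 w, k2 w) = Re w /\ v (k1 w, k2 w) = Im w) ->
  (forall w, W w -> continuous k1 w) -> (forall w, W w -> continuous k2 w) ->
  forall n, class_C n W k1 /\ class_C n W k2.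
Proof.
  intros HU HW Cu Cv HJ Hk Hinv C1 C2.
  set (J := fun z => dx u z * dy v z - dy u z * dx v z).
  assert (G : forall w, W w ->
    has_gradient k1 w (dy v (k1 w, k2 w) / J (k1 w, k2 w)) (- dy u (k1 w, k2 w) / J (k1 w, k2 w)) /\
    has_gradient k2 w (- dx v (k1 w, k2 w) / J (k1 w, k2 w)) (dx u (k1 w, k2 w) / J (k1 w, k2 w))).
  { intros w Ww. apply has_gradient_inverse with (u := u) (v := v).
    - apply (class_C_gradient U); auto.
    - apply (class_C_gradient U); auto.
    - apply HJ. auto.
    - auto.
    - auto.
    - generalize (HW w Ww). apply filter_imp. auto. }
  assert (Cq : forall n a, class_C n U a -> class_C n W k1 -> class_C n W k2 ->
            class_C n W (fun w => a (k1 w, k2 w) / J (k1 w, k2 w))).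
  { intros n a Ca D1 D2.
    apply (class_C_comp n U W (fun z => a z / J z)); auto.
    apply (class_C_div U HU); auto.
    destruct (Cu (S n)) as [_ [_ [? ?]]]. destruct (Cv (S n)) as [_ [_ [? ?]]].
    apply (class_C_minus U HU); apply (class_C_mult U HU); assumption. }
  induction n as [|n [IH1 IH2]].
  - split; (split; [assumption|exact I]).
  - destruct (Cu (S n)) as [_ [_ [? ?]]]. destruct (Cv (S n)) as [_ [_ [? ?]]].
    split.
    + apply (class_C_S W HW n k1 _ _ C1
        (fun w Ww => has_gradient_dx _ w _ _ (proj1 (G w Ww)))
        (fun w Ww => has_gradient_dy _ w _ _ (proj1 (G w Ww)))).
      * apply (Cq n (dy v)); assumption.
      * apply (Cq n (fun z => - dy u z)); auto using class_C_opp.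
    + apply (class_C_S W HW n k2 _ _ C2
        (fun w Ww => has_gradient_dx _ w _ _ (proj2 (G w Ww)))
        (fun w Ww => has_gradient_dy _ w _ _ (proj2 (G w Ww)))).
      * apply (Cq n (fun z => - dx v z)); auto using class_C_opp.
      * apply (Cq n (dx u)); assumption.
Qed.

(** * The unit disk as an open set *)

Lemma Cmod_sqr (z : C) : Cmod z ^ 2 = Re z ^ 2 + Im z ^ 2.
Proof. unfold Cmod. apply pow2_sqrt. apply Rplus_le_le_0_compat; apply pow2_ge_0. Qed.

Lemma disk_iff (z : C) : disk z <-> Re z ^ 2 + Im z ^ 2 < 1.
Proof.
  unfold disk. rewrite <- Cmod_sqr. pose proof (Cmod_ge_0 z). split; intros; nra.
Qed.

Lemma continuous_norm_sqr (z : C) : continuous (fun w : C => Re w ^ 2 + Im w ^ 2) z.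
Proof.
  apply continuous_real_plus; apply (continuous_real_comp _ _ (fun x => x ^ 2));
    (apply continuous_Re || apply continuous_Im || (apply ex_derive_continuous_real; auto_derive; trivial)).
Qed.

Lemma open_positive (u : C -> R) : (forall z, continuous u z) -> open (fun z => 0 < u z).
Proof. intros Hu. apply (open_comp u (fun x => 0 < x)); [intros; apply Hu|apply open_gt]. Qed.

Lemma open_disk : open disk.
Proof.
  apply open_ext with (D := fun z : C => 0 < 1 - (Re z ^ 2 + Im z ^ 2)).
  - intros z. rewrite disk_iff. split; intros; lra.
  - apply open_positive. intros z. apply (continuous_minus (V := R_NormedModule)).
    + apply continuous_const.
    + apply continuous_norm_sqr.
Qed.

(** * The argument of [1 - z exp (- i theta)] and the Poisson integral *)

Definition dist_sqr (theta : R) (z : C) : R := (Re z - cos theta) ^ 2 + (Im z - sin theta) ^ 2.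

Definition pole_re (theta : R) (z : C) : R := 1 - (Re z * cos theta + Im z * sin theta).

Definition pole_im (theta : R) (z : C) : R := Re z * sin theta - Im z * cos theta.

(** [pole_re] and [pole_im] are the two parts of [1 - z exp (- i theta)]. The first is positive on
    the disk, so [atan] of the quotient is the principal argument, smooth throughout. *)
Definition pole_arg (theta : R) (z : C) : R := atan (pole_im theta z / pole_re theta z).

Lemma sin2_cos2_pow theta : sin theta ^ 2 + cos theta ^ 2 = 1.
Proof. rewrite <- !Rsqr_pow2. apply sin2_cos2. Qed.

Lemma pole_re_pos theta z : disk z -> 0 < pole_re theta z.
Proof.
  rewrite disk_iff. unfold pole_re. intros H. pose proof (sin2_cos2_pow theta).
  pose proof (pow2_ge_0 (Re z - cos theta)). pose proof (pow2_ge_0 (Im z - sin theta)). nra.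
Qed.

Lemma dist_sqr_pole theta z : dist_sqr theta z = pole_re theta z ^ 2 + pole_im theta z ^ 2.
Proof.
  unfold dist_sqr, pole_re, pole_im. pose proof (sin2_cos2_pow theta) as E.
  replace (cos theta ^ 2) with (1 - sin theta ^ 2) by lra.
  ring_simplify. replace (cos theta ^ 2) with (1 - sin theta ^ 2) by lra. ring.
Qed.

Lemma dist_sqr_pos theta z : disk z -> 0 < dist_sqr theta z.
Proof.
  intros H. rewrite dist_sqr_pole. pose proof (pole_re_pos theta z H).
  pose proof (pow2_ge_0 (pole_im theta z)). nra.
Qed.

Lemma is_derive_atan_quotient (p q : R -> R) (t p' q' : R) :
  is_derive p t p' -> is_derive q t q' -> 0 < q t ->
  is_derive (fun s => atan (p s / q s)) t ((p' * q t - p t * q') / (q t ^ 2 + p t ^ 2)).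
Proof.
  intros Hp Hq H0.
  evar_last.
  - apply (is_derive_comp (K := R_AbsRing) (V := R_NormedModule) atan (fun s => p s / q s)).
    + apply is_derive_atan.
    + apply is_derive_div; [exact Hp|exact Hq|lra].
  - unfold scal; simpl; unfold mult; simpl. unfold Rsqr. pose proof (pow2_ge_0 (p t)).
    field. split; nra.
Qed.

(** With [q = z exp (- i theta)] the Poisson kernel is [Re (1 + 2 q / (1 - q))], and
    [Re (q / (1 - q))] is the [theta]-derivative of the argument of [1 - q]. This gives the kernel
    an elementary primitive. *)
Lemma is_derive_pole_arg_theta theta z :
  disk z ->
  is_derive (fun t => t + 2 * pole_arg t z) theta ((1 - (Re z ^ 2 + Im z ^ 2)) / dist_sqr theta z).
Proof.
  intros H. pose proof (dist_sqr_pos theta z H) as HN.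
  evar_last.
  - apply (is_derive_plus (V := R_NormedModule) (fun t => t)).
    + apply (is_derive_id (K := R_AbsRing)).
    + apply is_derive_scal.
      apply (is_derive_atan_quotient (fun t => pole_im t z) (fun t => pole_re t z)
               theta (Re z * cos theta + Im z * sin theta) (pole_im theta z)).
      * unfold pole_im. auto_derive; [trivial|ring].
      * unfold pole_re, pole_im. auto_derive; [trivial|ring].
      * apply pole_re_pos, H.
  - change (1 + 2 * (((Re z * cos theta + Im z * sin theta) * pole_re theta z - pole_im theta z * pole_im theta z) / (pole_re theta z ^ 2 + pole_im theta z ^ 2)) = (1 - (Re z ^ 2 + Im z ^ 2)) / dist_sqr theta z).
    pose proof (sin2_cos2_pow theta) as E.
    rewrite <- (dist_sqr_pole theta z).
    apply (Rmult_eq_reg_r (dist_sqr theta z)); [|lra]. field_simplify; [|lra|lra].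
    unfold dist_sqr, pole_im, pole_re.
    set (c := cos theta) in *. set (s := sin theta) in *. 
    assert (Es : s ^ 2 = 1 - c ^ 2) by lra. ring_simplify. rewrite Es. ring.
Qed.

(** The complex derivative of [log (1 - z exp (- i theta))] is [1 / (z - exp (i theta))]: its
    imaginary part is the derivative of the argument along [x], its real part the one along [y]. *)
Lemma is_derive_pole_arg_x theta z :
  disk z ->
  is_derive (fun x => pole_arg theta (x, Im z)) (Re z) (- (Im z - sin theta) / dist_sqr theta z).
Proof.
  intros H. evar_last.
  - apply (is_derive_atan_quotient (fun x => pole_im theta (x, Im z)) (fun x => pole_re theta (x, Im z))
             (Re z) (sin theta) (- cos theta)).
    + unfold pole_im. simpl. auto_derive; [trivial|ring].
    + unfold pole_re. simpl. auto_derive; [trivial|ring].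
    + apply (pole_re_pos theta (Re z, Im z)). rewrite disk_iff in *. exact H.
  - change (fst z, Im z) with (Re z, Im z). rewrite (dist_sqr_pole theta z).
    f_equal. unfold pole_im, pole_re; simpl. pose proof (sin2_cos2_pow theta) as E.
    assert (Es : sin theta ^ 2 = 1 - cos theta ^ 2) by lra. ring_simplify. rewrite Es. ring.
Qed.

Lemma is_derive_pole_arg_y theta z :
  disk z ->
  is_derive (fun y => pole_arg theta (Re z, y)) (Im z) ((Re z - cos theta) / dist_sqr theta z).
Proof.
  intros H. evar_last.
  - apply (is_derive_atan_quotient (fun y => pole_im theta (Re z, y)) (fun y => pole_re theta (Re z, y))
             (Im z) (- cos theta) (- sin theta)).
    + unfold pole_im. simpl. auto_derive; [trivial|ring].
    + unfold pole_re. simpl. auto_derive; [trivial|ring].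
    + apply (pole_re_pos theta (Re z, Im z)). rewrite disk_iff in *. exact H.
  - rewrite (dist_sqr_pole theta z).
    unfold pole_im, pole_re; simpl. f_equal. pose proof (sin2_cos2_pow theta) as E.
    assert (Es : sin theta ^ 2 = 1 - cos theta ^ 2) by lra. ring_simplify. rewrite Es. ring.
Qed.

Lemma class_C_Re_minus U c n : open U -> class_C n U (fun z => Re z - c).
Proof.
  intros HU. apply (class_C_minus U HU); [apply class_C_Re|apply class_C_const]; exact HU.
Qed.

Lemma class_C_Im_minus U c n : open U -> class_C n U (fun z => Im z - c).
Proof.
  intros HU. apply (class_C_minus U HU); [apply class_C_Im|apply class_C_const]; exact HU.
Qed.

Lemma class_C_dist_sqr U theta n : open U -> class_C n U (dist_sqr theta).
Proof.
  intros HU.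
  apply (class_C_ext U HU n (fun z => (Re z - cos theta) * (Re z - cos theta) +
      (Im z - sin theta) * (Im z - sin theta))); [intros; unfold dist_sqr; ring|].
  apply (class_C_plus U HU); apply (class_C_mult U HU);
    auto using class_C_Re_minus, class_C_Im_minus.
Qed.

Lemma class_C_pole_arg theta n : class_C n disk (pole_arg theta).
Proof.
  pose proof open_disk as HD.
  assert (N0 : forall z, disk z -> dist_sqr theta z <> 0)
    by (intros z Hz; pose proof (dist_sqr_pos theta z Hz); lra).
  assert (C0 : forall z, disk z -> continuous (pole_arg theta) z).
  { intros z Hz. apply (continuous_real_comp _ (fun w => pole_im theta w / pole_re theta w) atan).
    - unfold pole_im, pole_re. pose proof (pole_re_pos theta z Hz) as P.
      apply (class_C_continuous 0 disk); [|exact Hz].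
      apply (class_C_div disk HD).
      + intros w Hw. pose proof (pole_re_pos theta w Hw) as Q. unfold pole_re in Q. lra.
      + apply (class_C_minus disk HD); apply (class_C_mult disk HD);
          auto using class_C_Re, class_C_Im, class_C_const.
      + apply (class_C_minus disk HD); [apply class_C_const; exact HD|].
        apply (class_C_plus disk HD); apply (class_C_mult disk HD);
          auto using class_C_Re, class_C_Im, class_C_const.
    - apply ex_derive_continuous_real. eexists. apply is_derive_atan. }
  destruct n as [|n]; [split; [exact C0|exact I]|].
  apply (class_C_S disk HD n _ _ _ C0 (is_derive_pole_arg_x theta) (is_derive_pole_arg_y theta));
    apply (class_C_div disk HD);
    auto using class_C_opp, class_C_dist_sqr, class_C_Re_minus, class_C_Im_minus.
Qed.

(** * Complex derivatives and the logarithms of the poles *)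

Lemma Cauchy_Riemann_is_derive (u v : C -> R) (z : C) (a b : R) :
  has_gradient u z a (- b) -> has_gradient v z b a ->
  is_derive (K := C_AbsRing) (V := C_NormedModule) (fun w => (u w, v w)) z (a, b).
Proof.
  intros Hu Hv. split.
  - apply is_linear_scal_l.
  - intros x Hx.
    apply (is_filter_lim_locally_unique (V := AbsRing_NormedModule C_AbsRing)) in Hx. subst x.
    intros eps. apply locally_C.
    rewrite has_gradient_locally in Hu, Hv.
    (* The half pays for the factor [sqrt 2 <= 2] between the modulus and the sup norm. *)
    assert (He : 0 < eps / 2) by (pose proof (cond_pos eps); lra).
    generalize (filter_and _ _ (Hu (mkposreal _ He)) (Hv (mkposreal _ He))).
    apply filter_imp. intros w [Eu Ev]. simpl in Eu, Ev.
    change (Cmod ((u w, v w) - (u z, v z) - (w - z) * (a, b))%C <= eps * Cmod (w - z)%C).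
    set (P := Re w - Re z) in *. set (Q := Im w - Im z) in *.
    assert (HPQ : Rmax (Rabs P) (Rabs Q) <= Cmod (w - z)) by (apply (Rmax_Cmod (w - z)%C)).
    pose proof (cond_pos eps). pose proof (Rabs_pos P). pose proof (Rmax_l (Rabs P) (Rabs Q)).
    eapply Rle_trans; [apply Cmod_2Rmax|].
    apply Rle_trans with (2 * (eps / 2 * Rmax (Rabs P) (Rabs Q))).
    + apply Rmult_le_compat.
      * apply sqrt_pos.
      * eapply Rle_trans; [|apply Rmax_l]. apply Rabs_pos.
      * apply Rle_trans with (sqrt (2 ^ 2)); [apply sqrt_le_1_alt; lra|rewrite sqrt_pow2; lra].
      * apply Rmax_lub.
        -- eapply Rle_trans; [|exact Eu]. right. f_equal. unfold P, Q, Re, Im. simpl. ring.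
        -- eapply Rle_trans; [|exact Ev]. right. f_equal. unfold P, Q, Re, Im. simpl. ring.
    + replace (2 * (eps / 2 * Rmax (Rabs P) (Rabs Q))) with (eps * Rmax (Rabs P) (Rabs Q)) by field.
      apply Rmult_le_compat_l; lra.
Qed.

(** The branch of [log (1 - z exp (- i theta))] that vanishes at 0; its real part uses [|1 - z exp
    (- i theta)| = |z - exp (i theta)|]. The normalization at 0 is what yields [g(0) = 0]. *)
Definition pole_log (theta : R) (z : C) : C := (ln (dist_sqr theta z) / 2, pole_arg theta z).

Lemma cis_conj_inv theta z :
  disk z -> (/ (z - cis theta))%C =
  ((Re z - cos theta) / dist_sqr theta z, - (Im z - sin theta) / dist_sqr theta z).
Proof.
  intros H. unfold Cinv, dist_sqr, cis, Re, Im. simpl. f_equal; f_equal; ring.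
Qed.

Lemma minus_cis_neq_0 theta z : disk z -> (z - cis theta)%C <> RtoC 0.
Proof.
  intros H E. pose proof (dist_sqr_pos theta z H) as P. unfold dist_sqr in P.
  injection E. unfold cis; simpl. unfold Re, Im in P. intros E2 E1.
  replace (fst z - cos theta) with 0 in P by lra.
  replace (snd z - sin theta) with 0 in P by lra. lra.
Qed.

Lemma has_gradient_pole_arg theta z :
  disk z -> has_gradient (pole_arg theta) z
    (- (Im z - sin theta) / dist_sqr theta z) ((Re z - cos theta) / dist_sqr theta z).
Proof.
  intros H.
  rewrite <- (is_derive_unique _ _ _ (is_derive_pole_arg_x theta z H)).
  rewrite <- (is_derive_unique _ _ _ (is_derive_pole_arg_y theta z H)).
  apply (class_C_gradient disk open_disk); [apply class_C_pole_arg|exact H].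
Qed.

Lemma is_derive_ln_dist_x theta z :
  disk z -> is_derive (fun x => ln (dist_sqr theta (x, Im z)) / 2) (Re z)
    ((Re z - cos theta) / dist_sqr theta z).
Proof.
  intros H. pose proof (dist_sqr_pos theta z H) as P. revert P. unfold dist_sqr. simpl. intros P.
  auto_derive; [exact P|field; lra].
Qed.

Lemma is_derive_ln_dist_y theta z :
  disk z -> is_derive (fun y => ln (dist_sqr theta (Re z, y)) / 2) (Im z)
    ((Im z - sin theta) / dist_sqr theta z).
Proof.
  intros H. pose proof (dist_sqr_pos theta z H) as P. revert P. unfold dist_sqr. simpl. intros P.
  auto_derive; [exact P|field; lra].
Qed.

Lemma has_gradient_ln_dist theta z :
  disk z -> has_gradient (fun w => ln (dist_sqr theta w) / 2) z
    ((Re z - cos theta) / dist_sqr theta z) ((Im z - sin theta) / dist_sqr theta z).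
Proof.
  intros H.
  rewrite <- (is_derive_unique _ _ _ (is_derive_ln_dist_x theta z H)).
  rewrite <- (is_derive_unique _ _ _ (is_derive_ln_dist_y theta z H)).
  pose proof open_disk as HD.
  assert (N0 : forall z, disk z -> dist_sqr theta z <> 0)
    by (intros w Hw; pose proof (dist_sqr_pos theta w Hw); lra).
  apply (class_C_gradient disk HD (fun w => ln (dist_sqr theta w) / 2) z); [|exact H].
  apply (class_C_S disk HD 0 _ (fun z => (Re z - cos theta) / dist_sqr theta z)
                               (fun z => (Im z - sin theta) / dist_sqr theta z)).
  - intros w Hw. apply (continuous_real_comp _ (dist_sqr theta) (fun x => ln x / 2)).
    + apply (class_C_continuous 0 disk); auto using class_C_dist_sqr.
    + apply ex_derive_continuous_real. auto_derive. apply dist_sqr_pos, Hw.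
  - apply is_derive_ln_dist_x.
  - apply is_derive_ln_dist_y.
  - apply (class_C_div disk HD); auto using class_C_dist_sqr, class_C_Re_minus.
  - apply (class_C_div disk HD); auto using class_C_dist_sqr, class_C_Im_minus.
Qed.

Lemma is_derive_pole_log theta z :
  disk z ->
  is_derive (K := C_AbsRing) (V := C_NormedModule) (pole_log theta) z (/ (z - cis theta))%C.
Proof.
  intros H. rewrite (cis_conj_inv theta z H).
  apply (Cauchy_Riemann_is_derive (fun w => ln (dist_sqr theta w) / 2) (pole_arg theta)).
  - replace (- (- (Im z - sin theta) / dist_sqr theta z)) with ((Im z - sin theta) / dist_sqr theta z)
      by (pose proof (dist_sqr_pos theta z H); field; lra).
    apply has_gradient_ln_dist, H.
  - apply has_gradient_pole_arg, H.
Qed.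

(** * Poisson integrals of step functions *)

Lemma is_RInt_poisson_const (z b : C) (F : R -> C) (x y : R) :
  disk z -> x <= y -> (forall theta, x < theta < y -> F theta = b) ->
  is_RInt (V := C_R_NormedModule)
    (fun theta => RtoC ((1 - Cmod z ^ 2) / Cmod (cis theta - z) ^ 2) * F theta)%C x y
    (RtoC (y + 2 * pole_arg y z - (x + 2 * pole_arg x z)) * b)%C.
Proof.
  intros Hz Hxy HF.
  apply is_RInt_ext with
    (f := fun t => (RtoC ((1 - (Re z ^ 2 + Im z ^ 2)) / dist_sqr t z) * b)%C).
  { intros t Ht. rewrite Rmin_left, Rmax_right in Ht by exact Hxy.
    rewrite HF by exact Ht. rewrite !Cmod_sqr. unfold dist_sqr, cis, Re, Im. simpl.
    f_equal. f_equal. f_equal. ring. }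
  assert (E : is_RInt (fun t => (1 - (Re z ^ 2 + Im z ^ 2)) / dist_sqr t z) x y
            (y + 2 * pole_arg y z - (x + 2 * pole_arg x z))).
  { apply (is_RInt_derive (V := R_CompleteNormedModule) (fun t => t + 2 * pole_arg t z)).
    - intros t _. apply is_derive_pole_arg_theta, Hz.
    - intros t _. apply ex_derive_continuous_real. unfold dist_sqr.
      auto_derive. pose proof (dist_sqr_pos t z Hz) as P. unfold dist_sqr in P. lra. }
  destruct b as [b1 b2].
  assert (M : forall c, is_RInt (fun t => (1 - (Re z ^ 2 + Im z ^ 2)) / dist_sqr t z * c) x y
            ((y + 2 * pole_arg y z - (x + 2 * pole_arg x z)) * c)).
  { intros c. rewrite Rmult_comm.
    apply is_RInt_ext with (f := fun t => scal c ((1 - (Re z ^ 2 + Im z ^ 2)) / dist_sqr t z)).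
    - intros t _. apply Rmult_comm.
    - apply (is_RInt_scal (V := R_NormedModule)). exact E. }
  unfold Cmult, RtoC. simpl.
  apply (is_RInt_fct_extend_pair (U := R_NormedModule) (V := R_NormedModule)); simpl.
  - rewrite Rmult_0_l, Rminus_0_r. apply is_RInt_ext with (2 := M b1). intros; simpl; ring.
  - rewrite Rmult_0_l, Rplus_0_r. apply is_RInt_ext with (2 := M b2). intros; simpl; ring.
Qed.

Lemma pole_arg_2PI z : pole_arg (2 * PI) z = pole_arg 0 z.
Proof. unfold pole_arg, pole_im, pole_re. rewrite cos_2PI, sin_2PI, cos_0, sin_0. reflexivity. Qed.

(** The harmonic measure, seen from [z], of the arc between the angles [x] and [y]: the primitive of
    the Poisson kernel taken between them and divided by [2 * PI]. *)
Definition arc_measure (x y : R) (z : C) : R :=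
  ((y - x) / 2 + pole_arg y z - pole_arg x z) / PI.

Lemma poisson_step_function b1 b2 b3 b4 p z :
  0 < p < PI -> disk z ->
  poisson (step_function b1 b2 b3 b4 p) z =
  (RtoC (arc_measure 0 p z) * b4 + RtoC (arc_measure p PI z) * b1 +
   RtoC (arc_measure PI (PI + p) z) * b2 + RtoC (arc_measure (PI + p) (2 * PI) z) * b3)%C.
Proof.
  intros Hp Hz. pose proof PI_RGT_0. unfold poisson, step_function.
  assert (J : forall x y b, x <= y ->
    (forall t, x < t < y -> step_function b1 b2 b3 b4 p t = b) ->
    is_RInt (V := C_R_NormedModule)
      (fun theta => RtoC ((1 - Cmod z ^ 2) / Cmod (cis theta - z) ^ 2) *
         step_function b1 b2 b3 b4 p theta)%C x y
      (RtoC (2 * PI * arc_measure x y z) * b)%C).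
  { intros x y b Hxy HF.
    replace (2 * PI * arc_measure x y z) with (y + 2 * pole_arg y z - (x + 2 * pole_arg x z))
      by (unfold arc_measure; field; lra).
    apply is_RInt_poisson_const; assumption. }
  assert (I1 := J 0 p b4 ltac:(lra)). assert (I2 := J p PI b1 ltac:(lra)).
  assert (I3 := J PI (PI + p) b2 ltac:(lra)). assert (I4 := J (PI + p) (2 * PI) b3 ltac:(lra)).
  unfold step_function in I1, I2, I3, I4.
  match type of I1 with ?P -> _ => assert (A1 : P) end.
  { intros t Ht. repeat destruct Rlt_dec; try lra; reflexivity. }
  match type of I2 with ?P -> _ => assert (A2 : P) end.
  { intros t Ht. repeat destruct Rlt_dec; try lra; reflexivity. }
  match type of I3 with ?P -> _ => assert (A3 : P) end.
  { intros t Ht. repeat destruct Rlt_dec; try lra; reflexivity. }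
  match type of I4 with ?P -> _ => assert (A4 : P) end.
  { intros t Ht. repeat destruct Rlt_dec; try lra; reflexivity. }
  specialize (I1 A1). specialize (I2 A2). specialize (I3 A3). specialize (I4 A4).
  pose proof (is_RInt_Chasles _ _ _ _ _ _ (is_RInt_Chasles _ _ _ _ _ _
    (is_RInt_Chasles _ _ _ _ _ _ I1 I2) I3) I4) as I.
  rewrite (is_RInt_unique (V := C_R_CompleteNormedModule) _ _ _ _ I).
  change (@plus _) with Cplus.
  rewrite !RtoC_mult, RtoC_inv, RtoC_mult by lra.
  assert (RtoC PI <> 0) by (intros E; apply RtoC_inj in E; lra).
  field. assumption.
Qed.

Lemma pole_arg_increasing z x y :
  disk z -> x < y -> x + 2 * pole_arg x z < y + 2 * pole_arg y z.
Proof.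
  intros Hz Hxy.
  destruct (MVT_gen (fun t => t + 2 * pole_arg t z) x y
    (fun t => (1 - (Re z ^ 2 + Im z ^ 2)) / dist_sqr t z)) as [c [Hc E]].
  - intros t _. apply is_derive_pole_arg_theta, Hz.
  - intros t _. apply derivable_continuous_pt. eexists. apply is_derive_Reals.
    apply is_derive_pole_arg_theta, Hz.
  - assert (0 < (1 - (Re z ^ 2 + Im z ^ 2)) / dist_sqr c z * (y - x)); [|lra].
    apply Rmult_lt_0_compat; [|lra]. pose proof Hz as H1. apply disk_iff in H1.
    apply Rdiv_lt_0_compat; [lra|apply dist_sqr_pos, Hz].
Qed.

Lemma cos_sin_pole_arg theta z :
  disk z -> exists r, 0 < r /\ pole_re theta z = r * cos (pole_arg theta z) /\
    pole_im theta z = r * sin (pole_arg theta z).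
Proof.
  intros Hz. pose proof (pole_re_pos theta z Hz) as P.
  exists (sqrt (dist_sqr theta z)). pose proof (dist_sqr_pos theta z Hz) as Q.
  split; [apply sqrt_lt_R0, Q|]. unfold pole_arg. rewrite cos_atan, sin_atan.
  assert (E : sqrt (1 + (pole_im theta z / pole_re theta z)²) =
              sqrt (dist_sqr theta z) / pole_re theta z).
  { rewrite <- (sqrt_pow2 (pole_re theta z)) at 2 by lra.
    rewrite <- sqrt_div_alt by nra. f_equal. rewrite dist_sqr_pole. unfold Rsqr. field. lra. }
  rewrite E. pose proof (sqrt_lt_R0 _ Q). split; field; lra.
Qed.

(** [PI * arc_measure x y z] is the argument in [(0, PI)] of
    [(1 - z exp (- i y)) * conj (1 - z exp (- i x)) * exp (i (y - x) / 2)]. *)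
Lemma arc_measure_atan x y z :
  disk z -> x < y < x + 2 * PI ->
  arc_measure x y z = / 2 - / PI *
    atan (((1 + (Re z ^ 2 + Im z ^ 2)) * cos ((y - x) / 2)
           - 2 * (Re z * cos ((x + y) / 2) + Im z * sin ((x + y) / 2)))
          / ((1 - (Re z ^ 2 + Im z ^ 2)) * sin ((y - x) / 2))).
Proof.
  intros Hz Hxy. pose proof PI_RGT_0 as HPI.
  set (T := (y - x) / 2 + pole_arg y z - pole_arg x z).
  (* The two strict inequalities say that the arc and its complement have positive measure. They
     place [PI / 2 - T] in the range where [atan] inverts [tan]. *)
  assert (HT : 0 < T < PI).
  { assert (pole_arg (x + 2 * PI) z = pole_arg x z) as E.
    { unfold pole_arg, pole_im, pole_re.
      replace (x + 2 * PI) with (x + 2 * INR 1 * PI) by (simpl; ring).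
      rewrite cos_period, sin_period. reflexivity. }
    pose proof (pole_arg_increasing z x y Hz ltac:(lra)).
    pose proof (pole_arg_increasing z y (x + 2 * PI) Hz ltac:(lra)). unfold T. lra. }
  destruct (cos_sin_pole_arg x z Hz) as [r [Hr [Cx Sx]]].
  destruct (cos_sin_pole_arg y z Hz) as [q [Hq [Cy Sy]]].
  assert (Hh : 0 < sin ((y - x) / 2)) by (apply sin_gt_0; lra).
  pose proof Hz as Hz1. apply disk_iff in Hz1.
  assert (HsT : 0 < sin T) by (apply sin_gt_0; lra).
  set (A := (1 + (Re z ^ 2 + Im z ^ 2)) * cos ((y - x) / 2)
           - 2 * (Re z * cos ((x + y) / 2) + Im z * sin ((x + y) / 2))).
  set (B := (1 - (Re z ^ 2 + Im z ^ 2)) * sin ((y - x) / 2)).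
  assert (EA : A = r * q * cos T /\ B = r * q * sin T).
  { unfold T. replace ((y - x) / 2 + pole_arg y z - pole_arg x z)
      with ((y - x) / 2 + (pole_arg y z - pole_arg x z)) by ring.
    rewrite cos_plus, sin_plus, cos_minus, sin_minus.
    assert (E1 : r * q * (cos (pole_arg y z) * cos (pole_arg x z) + sin (pole_arg y z) * sin (pole_arg x z))
      = pole_re y z * pole_re x z + pole_im y z * pole_im x z) by (rewrite Cx, Sx, Cy, Sy; ring).
    assert (E2 : r * q * (sin (pole_arg y z) * cos (pole_arg x z) - cos (pole_arg y z) * sin (pole_arg x z))
      = pole_im y z * pole_re x z - pole_re y z * pole_im x z) by (rewrite Cx, Sx, Cy, Sy; ring).
    set (P1 := cos (pole_arg y z) * cos (pole_arg x z) + sin (pole_arg y z) * sin (pole_arg x z)) in *.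
    set (P2 := sin (pole_arg y z) * cos (pole_arg x z) - cos (pole_arg y z) * sin (pole_arg x z)) in *.
    replace (r * q * (cos ((y - x) / 2) * P1 - sin ((y - x) / 2) * P2))
      with (cos ((y - x) / 2) * (r * q * P1) - sin ((y - x) / 2) * (r * q * P2)) by ring.
    replace (r * q * (sin ((y - x) / 2) * P1 + cos ((y - x) / 2) * P2))
      with (sin ((y - x) / 2) * (r * q * P1) + cos ((y - x) / 2) * (r * q * P2)) by ring.
    rewrite E1, E2. unfold A, B, pole_re, pole_im.
    replace (cos x) with (cos ((x + y) / 2 - (y - x) / 2)) by (f_equal; field).
    replace (sin x) with (sin ((x + y) / 2 - (y - x) / 2)) by (f_equal; field).
    replace (cos y) with (cos ((x + y) / 2 + (y - x) / 2)) by (f_equal; field).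
    replace (sin y) with (sin ((x + y) / 2 + (y - x) / 2)) by (f_equal; field).
    rewrite cos_plus, cos_minus, sin_plus, sin_minus.
    pose proof (sin2_cos2_pow ((x + y) / 2)) as F1. pose proof (sin2_cos2_pow ((y - x) / 2)) as F2.
    set (c := cos ((x + y) / 2)) in *. set (s := sin ((x + y) / 2)) in *.
    set (k := cos ((y - x) / 2)) in *. set (h := sin ((y - x) / 2)) in *.
    assert (G1 : s ^ 2 = 1 - c ^ 2) by lra. assert (G2 : h ^ 2 = 1 - k ^ 2) by lra.
    assert (G3 : h ^ 3 = h * (1 - k ^ 2)) by (rewrite <- G2; ring).
    assert (G4 : s ^ 4 = (1 - c ^ 2) ^ 2) by (rewrite <- G1; ring).
    split; ring_simplify; rewrite ?G4, ?G3, ?G2, ?G1; ring. }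
  destruct EA as [EA EB].
  assert (EAB : A / B = tan (PI / 2 - T)).
  { unfold tan. rewrite sin_shift, cos_shift, EA, EB. field. lra. }
  rewrite EAB, atan_tan by lra. unfold arc_measure. fold T. field. lra.
Qed.

(** * The splitting of [f] into [h] and the conjugate of [g], and harmonicity *)

Lemma is_C_derive_scal (f : C -> C) (z c l : C) :
  is_derive (K := C_AbsRing) (V := C_NormedModule) f z l ->
  is_derive (K := C_AbsRing) (V := C_NormedModule) (fun w => c * f w)%C z (c * l)%C.
Proof.
  intros H. unfold is_derive.
  apply (filterdiff_ext_lin (K := C_AbsRing) (U := AbsRing_NormedModule C_AbsRing) (V := C_NormedModule)
    _ (fun y => scal (c : C_AbsRing) (scal y l))).
  - apply (filterdiff_scal_r_fct (K := C_AbsRing) (U := AbsRing_NormedModule C_AbsRing) (V := C_NormedModule) c f); [|exact H].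
    intros; apply Cmult_comm.
  - intros y. change (c * (y * l) = y * (c * l))%C. ring.
Qed.

Lemma is_C_derive_plus (f g : C -> C) (z l m : C) :
  is_derive (K := C_AbsRing) (V := C_NormedModule) f z l ->
  is_derive (K := C_AbsRing) (V := C_NormedModule) g z m ->
  is_derive (K := C_AbsRing) (V := C_NormedModule) (fun w => f w + g w)%C z (l + m)%C.
Proof. apply (is_derive_plus (K := C_AbsRing) (V := C_NormedModule)). Qed.

(** Summation by parts turns a sum over the four arcs into one over the jump angles [0], [p], [PI],
    [PI + p]. The coefficient at a jump is the value before it minus the value after it. *)
Definition log_sum (j0 j1 j2 j3 : C) (p : R) (z : C) : C :=
  (j0 * pole_log 0 z + j1 * pole_log p z + j2 * pole_log PI z + j3 * pole_log (PI + p) z)%C.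

Definition pole_sum (j0 j1 j2 j3 : C) (p : R) (z : C) : C :=
  (j0 * / (z - cis 0) + j1 * / (z - cis p) + j2 * / (z - cis PI) + j3 * / (z - cis (PI + p)))%C.

Lemma is_C_derive_log_sum j0 j1 j2 j3 p z :
  disk z ->
  is_derive (K := C_AbsRing) (V := C_NormedModule) (log_sum j0 j1 j2 j3 p) z
    (pole_sum j0 j1 j2 j3 p z).
Proof.
  intros H. unfold log_sum, pole_sum.
  repeat apply is_C_derive_plus; apply is_C_derive_scal, is_derive_pole_log, H.
Qed.

Lemma pole_log_0 theta : pole_log theta (RtoC 0) = RtoC 0.
Proof.
  unfold pole_log, pole_arg, pole_im, pole_re, dist_sqr, RtoC. simpl. f_equal.
  - replace (_ + _) with 1; [rewrite ln_1; field|].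
    pose proof (sin2_cos2_pow theta). simpl in *. lra.
  - replace (_ / _) with 0 by (field; lra). apply atan_0.
Qed.

Lemma log_sum_0 j0 j1 j2 j3 p : log_sum j0 j1 j2 j3 p (RtoC 0) = RtoC 0.
Proof. unfold log_sum. rewrite !pole_log_0. ring. Qed.

(** The value of [f] at 0, that is the mean of the step function. *)
Definition poisson_centre (b1 b2 b3 b4 : C) (p : R) : C :=
  (RtoC (p / (2 * PI)) * (b4 + b2) + RtoC ((PI - p) / (2 * PI)) * (b1 + b3))%C.

(* [1 / (2 i PI)] *)
Definition inv_2iPI : C := (0, - / (2 * PI)).

(** Each argument equals [(L - conj L) / (2 i)] with [L] the logarithm of its pole; the terms in [L]
    form [h], those in [conj L] form the conjugate of [g]. Since [1 / (2 i PI)] is purely imaginary,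
    conjugation cancels the minus sign: [g] carries the same factor as [h], with conjugated
    jumps. *)
Definition holomorphic_part (b1 b2 b3 b4 : C) (p : R) (z : C) : C :=
  (poisson_centre b1 b2 b3 b4 p +
   inv_2iPI * log_sum (b3 - b4) (b4 - b1) (b1 - b2) (b2 - b3) p z)%C.

Definition antiholomorphic_part (b1 b2 b3 b4 : C) (p : R) (z : C) : C :=
  (inv_2iPI * log_sum (Cconj (b3 - b4)) (Cconj (b4 - b1)) (Cconj (b1 - b2)) (Cconj (b2 - b3)) p z)%C.

(** The shape shared by the real and the imaginary part of [f], so that regularity and harmonicity
    are proved once for both. *)
Definition jump_sum (c : R) (j0 j1 j2 j3 : R) (p : R) (z : C) : R :=
  c + (j0 * pole_arg 0 z + j1 * pole_arg p z + j2 * pole_arg PI z + j3 * pole_arg (PI + p) z) / PI.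

Lemma poisson_jump_sum b1 b2 b3 b4 p z :
  0 < p < PI -> disk z ->
  poisson (step_function b1 b2 b3 b4 p) z =
  (jump_sum (Re (poisson_centre b1 b2 b3 b4 p)) (Re (b3 - b4)) (Re (b4 - b1)) (Re (b1 - b2)) (Re (b2 - b3)) p z,
   jump_sum (Im (poisson_centre b1 b2 b3 b4 p)) (Im (b3 - b4)) (Im (b4 - b1)) (Im (b1 - b2)) (Im (b2 - b3)) p z).
Proof.
  intros Hp Hz. rewrite poisson_step_function by assumption. pose proof PI_RGT_0.
  unfold arc_measure, jump_sum, poisson_centre. rewrite pole_arg_2PI.
  destruct b1 as [x1 y1], b2 as [x2 y2], b3 as [x3 y3], b4 as [x4 y4].
  unfold Cmult, Cplus, Cminus, Copp, RtoC, Re, Im. simpl. f_equal; field; lra.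
Qed.

Lemma poisson_decomposition b1 b2 b3 b4 p z :
  0 < p < PI -> disk z ->
  poisson (step_function b1 b2 b3 b4 p) z =
  (holomorphic_part b1 b2 b3 b4 p z + Cconj (antiholomorphic_part b1 b2 b3 b4 p z))%C.
Proof.
  intros Hp Hz. rewrite poisson_jump_sum by assumption. pose proof PI_RGT_0.
  unfold jump_sum, holomorphic_part, antiholomorphic_part, log_sum, pole_log, inv_2iPI.
  generalize (poisson_centre b1 b2 b3 b4 p). intros [k1 k2].
  destruct b1 as [x1 y1], b2 as [x2 y2], b3 as [x3 y3], b4 as [x4 y4].
  unfold Cmult, Cplus, Cconj, Cminus, Copp, RtoC, Re, Im. simpl. f_equal; field; lra.
Qed.

Lemma is_C_derive_holomorphic_part b1 b2 b3 b4 p z :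
  disk z ->
  is_derive (K := C_AbsRing) (V := C_NormedModule) (holomorphic_part b1 b2 b3 b4 p) z
    (inv_2iPI * pole_sum (b3 - b4) (b4 - b1) (b1 - b2) (b2 - b3) p z)%C.
Proof.
  intros H. rewrite <- (Cplus_0_l (inv_2iPI * _)%C).
  apply is_C_derive_plus.
  - apply (is_derive_const (K := C_AbsRing) (V := C_NormedModule)).
  - apply is_C_derive_scal, is_C_derive_log_sum, H.
Qed.

Lemma is_C_derive_antiholomorphic_part b1 b2 b3 b4 p z :
  disk z ->
  is_derive (K := C_AbsRing) (V := C_NormedModule) (antiholomorphic_part b1 b2 b3 b4 p) z
    (inv_2iPI * pole_sum (Cconj (b3 - b4)) (Cconj (b4 - b1)) (Cconj (b1 - b2)) (Cconj (b2 - b3)) p z)%C.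
Proof. intros H. apply is_C_derive_scal, is_C_derive_log_sum, H. Qed.

Definition jump_dx (j0 j1 j2 j3 : R) (p : R) (z : C) : R :=
  (j0 * - (Im z - sin 0) / dist_sqr 0 z + j1 * - (Im z - sin p) / dist_sqr p z +
   j2 * - (Im z - sin PI) / dist_sqr PI z + j3 * - (Im z - sin (PI + p)) / dist_sqr (PI + p) z) / PI.

Definition jump_dy (j0 j1 j2 j3 : R) (p : R) (z : C) : R :=
  (j0 * (Re z - cos 0) / dist_sqr 0 z + j1 * (Re z - cos p) / dist_sqr p z +
   j2 * (Re z - cos PI) / dist_sqr PI z + j3 * (Re z - cos (PI + p)) / dist_sqr (PI + p) z) / PI.

Lemma class_C_jump_sum c j0 j1 j2 j3 p n : class_C n disk (jump_sum c j0 j1 j2 j3 p).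
Proof.
  pose proof open_disk as HD. pose proof PI_RGT_0.
  apply (class_C_plus disk HD); [apply class_C_const, HD|].
  apply (class_C_div disk HD); [intros; lra| |apply class_C_const, HD].
  repeat apply (class_C_plus disk HD); apply (class_C_mult disk HD);
    auto using class_C_const, class_C_pole_arg.
Qed.

Lemma is_derive_jump_sum_x c j0 j1 j2 j3 p z :
  disk z -> is_derive (fun x => jump_sum c j0 j1 j2 j3 p (x, Im z)) (Re z) (jump_dx j0 j1 j2 j3 p z).
Proof.
  intros Hz. unfold jump_sum. pose proof PI_RGT_0.
  pose proof (is_derive_pole_arg_x 0 z Hz) as D0. pose proof (is_derive_pole_arg_x p z Hz) as D1.
  pose proof (is_derive_pole_arg_x PI z Hz) as D2. pose proof (is_derive_pole_arg_x (PI + p) z Hz) as D3.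
  set (a0 := fun x => pole_arg 0 (x, Im z)) in *. set (a1 := fun x => pole_arg p (x, Im z)) in *.
  set (a2 := fun x => pole_arg PI (x, Im z)) in *. set (a3 := fun x => pole_arg (PI + p) (x, Im z)) in *.
  apply (is_derive_ext (fun x => c + (j0 * a0 x + j1 * a1 x + j2 * a2 x + j3 * a3 x) / PI));
    [reflexivity|].
  auto_derive; [repeat split; eexists; eassumption|].
  rewrite (is_derive_unique (fun x : R => a0 x) _ _ D0), (is_derive_unique (fun x : R => a1 x) _ _ D1),
    (is_derive_unique (fun x : R => a2 x) _ _ D2), (is_derive_unique (fun x : R => a3 x) _ _ D3).
  unfold jump_dx. pose proof (dist_sqr_pos 0 z Hz). pose proof (dist_sqr_pos p z Hz).
  pose proof (dist_sqr_pos PI z Hz). pose proof (dist_sqr_pos (PI + p) z Hz).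
  field. repeat split; lra.
Qed.

Lemma is_derive_jump_sum_y c j0 j1 j2 j3 p z :
  disk z -> is_derive (fun y => jump_sum c j0 j1 j2 j3 p (Re z, y)) (Im z) (jump_dy j0 j1 j2 j3 p z).
Proof.
  intros Hz. unfold jump_sum. pose proof PI_RGT_0.
  pose proof (is_derive_pole_arg_y 0 z Hz) as D0. pose proof (is_derive_pole_arg_y p z Hz) as D1.
  pose proof (is_derive_pole_arg_y PI z Hz) as D2. pose proof (is_derive_pole_arg_y (PI + p) z Hz) as D3.
  set (a0 := fun y => pole_arg 0 (Re z, y)) in *. set (a1 := fun y => pole_arg p (Re z, y)) in *.
  set (a2 := fun y => pole_arg PI (Re z, y)) in *. set (a3 := fun y => pole_arg (PI + p) (Re z, y)) in *.
  apply (is_derive_ext (fun x => c + (j0 * a0 x + j1 * a1 x + j2 * a2 x + j3 * a3 x) / PI));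
    [reflexivity|].
  auto_derive; [repeat split; eexists; eassumption|].
  rewrite (is_derive_unique (fun x : R => a0 x) _ _ D0), (is_derive_unique (fun x : R => a1 x) _ _ D1),
    (is_derive_unique (fun x : R => a2 x) _ _ D2), (is_derive_unique (fun x : R => a3 x) _ _ D3).
  unfold jump_dy. pose proof (dist_sqr_pos 0 z Hz). pose proof (dist_sqr_pos p z Hz).
  pose proof (dist_sqr_pos PI z Hz). pose proof (dist_sqr_pos (PI + p) z Hz).
  field. repeat split; lra.
Qed.

Lemma is_derive_sum4_div (a0 a1 a2 a3 : R -> R) (x l0 l1 l2 l3 c : R) :
  is_derive a0 x l0 -> is_derive a1 x l1 -> is_derive a2 x l2 -> is_derive a3 x l3 ->
  is_derive (fun t => (a0 t + a1 t + a2 t + a3 t) / c) x ((l0 + l1 + l2 + l3) / c).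
Proof.
  intros. unfold Rdiv. rewrite Rmult_comm.
  apply is_derive_ext with (f := fun t => / c * (a0 t + a1 t + a2 t + a3 t)); [intros; apply Rmult_comm|].
  apply is_derive_scal.
  repeat apply (is_derive_plus (V := R_NormedModule)); assumption.
Qed.

Lemma is_derive_dist_quotient_x j theta z :
  disk z -> is_derive (fun x => j * - (Im z - sin theta) / dist_sqr theta (x, Im z)) (Re z)
    (j * (2 * (Im z - sin theta) * (Re z - cos theta)) / dist_sqr theta z ^ 2).
Proof.
  intros Hz. pose proof (dist_sqr_pos theta z Hz) as P. unfold dist_sqr in *. simpl in *.
  auto_derive; [lra|]. field. lra.
Qed.

Lemma is_derive_dist_quotient_y j theta z :
  disk z -> is_derive (fun y => j * (Re z - cos theta) / dist_sqr theta (Re z, y)) (Im z)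
    (- (j * (2 * (Im z - sin theta) * (Re z - cos theta)) / dist_sqr theta z ^ 2)).
Proof.
  intros Hz. pose proof (dist_sqr_pos theta z Hz) as P. unfold dist_sqr in *. simpl in *.
  auto_derive; [lra|]. field. lra.
Qed.

(** The Laplacian vanishes pole by pole: the second derivatives of each argument in [x] and in [y]
    are opposite. *)
Lemma real_harmonic_jump_sum u c j0 j1 j2 j3 p :
  (forall z, disk z -> u z = jump_sum c j0 j1 j2 j3 p z) -> real_harmonic_on disk u.
Proof.
  intros Hu. pose proof open_disk as HD. split.
  - apply (class_C_ext disk HD 2 (jump_sum c j0 j1 j2 j3 p)); [intros; symmetry; auto|].
    apply class_C_jump_sum.
  - intros z Hz.
    assert (Ex : forall w, disk w -> dx u w = jump_dx j0 j1 j2 j3 p w).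
    { intros w Hw. rewrite (dx_ext disk HD u _ w Hu Hw).
      apply is_derive_unique, is_derive_jump_sum_x, Hw. }
    assert (Ey : forall w, disk w -> dy u w = jump_dy j0 j1 j2 j3 p w).
    { intros w Hw. rewrite (dy_ext disk HD u _ w Hu Hw).
      apply is_derive_unique, is_derive_jump_sum_y, Hw. }
    rewrite (dx_ext disk HD _ _ z Ex Hz), (dy_ext disk HD _ _ z Ey Hz).
    unfold dx, dy.
    pose proof (is_derive_unique _ _ _ (is_derive_sum4_div _ _ _ _ _ _ _ _ _ PI
      (is_derive_dist_quotient_x j0 0 z Hz) (is_derive_dist_quotient_x j1 p z Hz)
      (is_derive_dist_quotient_x j2 PI z Hz) (is_derive_dist_quotient_x j3 (PI + p) z Hz))) as Fx.
    pose proof (is_derive_unique _ _ _ (is_derive_sum4_div _ _ _ _ _ _ _ _ _ PI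
      (is_derive_dist_quotient_y j0 0 z Hz) (is_derive_dist_quotient_y j1 p z Hz)
      (is_derive_dist_quotient_y j2 PI z Hz) (is_derive_dist_quotient_y j3 (PI + p) z Hz))) as Fy.
    etransitivity; [apply f_equal2; [exact Fx|exact Fy]|].
    unfold Rdiv. ring.
Qed.

(** * The Jacobian and the dilatation *)

Lemma dx_jump_sum u c j0 j1 j2 j3 p z :
  (forall z, disk z -> u z = jump_sum c j0 j1 j2 j3 p z) -> disk z ->
  dx u z = jump_dx j0 j1 j2 j3 p z.
Proof.
  intros Hu Hz. rewrite (dx_ext disk open_disk u _ z Hu Hz).
  apply is_derive_unique, is_derive_jump_sum_x, Hz.
Qed.

Lemma dy_jump_sum u c j0 j1 j2 j3 p z :
  (forall z, disk z -> u z = jump_sum c j0 j1 j2 j3 p z) -> disk z ->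
  dy u z = jump_dy j0 j1 j2 j3 p z.
Proof.
  intros Hu Hz. rewrite (dy_ext disk open_disk u _ z Hu Hz).
  apply is_derive_unique, is_derive_jump_sum_y, Hz.
Qed.

Lemma re_part_poisson b1 b2 b3 b4 p z :
  0 < p < PI -> disk z -> re_part (poisson (step_function b1 b2 b3 b4 p)) z =
  jump_sum (Re (poisson_centre b1 b2 b3 b4 p)) (Re (b3 - b4)) (Re (b4 - b1)) (Re (b1 - b2)) (Re (b2 - b3)) p z.
Proof. intros Hp Hz. unfold re_part. rewrite poisson_jump_sum by assumption. reflexivity. Qed.

Lemma im_part_poisson b1 b2 b3 b4 p z :
  0 < p < PI -> disk z -> im_part (poisson (step_function b1 b2 b3 b4 p)) z =
  jump_sum (Im (poisson_centre b1 b2 b3 b4 p)) (Im (b3 - b4)) (Im (b4 - b1)) (Im (b1 - b2)) (Im (b2 - b3)) p z.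
Proof. intros Hp Hz. unfold im_part. rewrite poisson_jump_sum by assumption. reflexivity. Qed.

Lemma jacobian_poisson b1 b2 b3 b4 p z :
  0 < p < PI -> disk z ->
  jacobian (poisson (step_function b1 b2 b3 b4 p)) z =
  Cmod (inv_2iPI * pole_sum (b3 - b4) (b4 - b1) (b1 - b2) (b2 - b3) p z)%C ^ 2 -
  Cmod (inv_2iPI * pole_sum (Cconj (b3 - b4)) (Cconj (b4 - b1)) (Cconj (b1 - b2)) (Cconj (b2 - b3)) p z)%C ^ 2.
Proof.
  intros Hp Hz. unfold jacobian.
  rewrite (dx_jump_sum _ _ _ _ _ _ _ z (fun w Hw => re_part_poisson b1 b2 b3 b4 p w Hp Hw) Hz).
  rewrite (dx_jump_sum _ _ _ _ _ _ _ z (fun w Hw => im_part_poisson b1 b2 b3 b4 p w Hp Hw) Hz).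
  rewrite (dy_jump_sum _ _ _ _ _ _ _ z (fun w Hw => re_part_poisson b1 b2 b3 b4 p w Hp Hw) Hz).
  rewrite (dy_jump_sum _ _ _ _ _ _ _ z (fun w Hw => im_part_poisson b1 b2 b3 b4 p w Hp Hw) Hz).
  rewrite !Cmod_sqr. unfold pole_sum. rewrite !cis_conj_inv by exact Hz.
  unfold jump_dx, jump_dy, Rdiv. rewrite !Rmult_assoc.
  (* Each pole enters only through the two parts of [1 / (z - exp (i theta))]. Once these are
     variables, the formula [|h'|^2 - |g'|^2] is an algebraic identity. *)
  generalize ((Re z - cos 0) * / dist_sqr 0 z). generalize (- (Im z - sin 0) * / dist_sqr 0 z).
  generalize ((Re z - cos p) * / dist_sqr p z). generalize (- (Im z - sin p) * / dist_sqr p z).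
  generalize ((Re z - cos PI) * / dist_sqr PI z). generalize (- (Im z - sin PI) * / dist_sqr PI z).
  generalize ((Re z - cos (PI + p)) * / dist_sqr (PI + p) z).
  generalize (- (Im z - sin (PI + p)) * / dist_sqr (PI + p) z).
  intros. pose proof PI_RGT_0.
  destruct b1 as [x1 y1], b2 as [x2 y2], b3 as [x3 y3], b4 as [x4 y4].
  unfold inv_2iPI, Cconj, Cmult, Cplus, Cminus, Copp, Re, Im. simpl. field. lra.
Qed.

Lemma cis_0 : cis 0 = RtoC 1.
Proof. unfold cis. rewrite cos_0, sin_0. reflexivity. Qed.

Lemma cis_PI : cis PI = (- (1))%C.
Proof. unfold cis. rewrite cos_PI, sin_PI. unfold Copp. simpl. f_equal. ring. Qed.

Lemma cis_PI_plus p : cis (PI + p) = (- cis p)%C.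
Proof.
  unfold cis. rewrite (Rplus_comm PI p), neg_cos, neg_sin. reflexivity.
Qed.

(** The jumps are those of a quadrilateral with [b1 = -1], [b3 = 1], [b2 = E - H], [b4 = E + H],
    scaled by [e]. They add up to zero, so the cubic term of the numerator cancels and a quadratic
    remains. *)
Lemma pole_sum_common_denominator (e E H : C) p z :
  disk z ->
  let q := cis p in
  let D := ((z - 1) * (z + 1) * (z - q) * (z + q))%C in
  D <> RtoC 0 /\
  pole_sum (e * (1 - E - H)) (e * (1 + E + H)) (e * (- (1) - E + H)) (e * (- (1) + E - H)) p z =
  (2 * e * ((1 - H + q * (1 + H)) * z ^ 2 + E * (q ^ 2 - 1) * z - q ^ 2 * (1 - H) - q * (1 + H)) / D)%C.
Proof.
  intros Hz q D.
  pose proof (minus_cis_neq_0 0 z Hz) as N0. pose proof (minus_cis_neq_0 p z Hz) as N1.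
  pose proof (minus_cis_neq_0 PI z Hz) as N2. pose proof (minus_cis_neq_0 (PI + p) z Hz) as N3.
  unfold pole_sum. rewrite cis_0, cis_PI, cis_PI_plus in *. fold q in N1, N3 |- *.
  assert (M2 : (z + 1)%C <> RtoC 0) by (intros X; apply N2; rewrite <- X; ring).
  assert (M3 : (z + q)%C <> RtoC 0) by (intros X; apply N3; rewrite <- X; ring).
  split.
  - unfold D. repeat apply Cmult_neq_0; assumption.
  - unfold D. field. repeat split; try assumption.
    all: intros X; (apply N3 || apply N2); rewrite <- X; ring.
Qed.

(* To be used with [r = exp (i p / 2)], [k = cos (p / 2)], [A = sin mu],
   [B = cos mu], [E = A cosh d] and [H = i B sinh d], where [b2] and [b4] have
   normalized positions [sin (mu - i d) = E - H] and [sin (mu + i d) = E + H]. *)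
Lemma numerator_coefficients (r r' k A B E H : C) :
  (r * r' = 1)%C -> (r + r' = 2 * k)%C -> (H * (r - r') = - (2) * B * k)%C ->
  (E * (r - r') = 2 * Ci * A)%C ->
  (1 - H + r ^ 2 * (1 + H) = 2 * k * r * (1 - B))%C /\
  (E * ((r ^ 2) ^ 2 - 1) = 4 * Ci * k * r ^ 2 * A)%C /\
  ((r ^ 2) ^ 2 * (1 - H) + r ^ 2 * (1 + H) = 2 * k * r ^ 3 * (1 + B))%C.
Proof.
  intros E1 E2 E3 E4. split; [|split].
  - transitivity (r * (r + r' + H * (r - r')) + (1 - H) * (1 - r * r'))%C; [ring|].
    rewrite E1, E2, E3. ring.
  - transitivity (r ^ 2 * ((r + r') * (E * (r - r'))) + (r * r' + 1) * (r * r' - 1) * E)%C; [ring|].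
    rewrite E1, E2, E4. ring.
  - transitivity (r ^ 3 * (r + r' - H * (r - r')) + r ^ 2 * (1 + H) * (1 - r * r'))%C; [ring|].
    rewrite E1, E2, E3. ring.
Qed.

(** [A ^ 2 = (1 - B) * (1 + B)] says exactly that the discriminant vanishes. The double root is
    expressed through [1 + B], which is never zero here, whereas [1 - B] vanishes when [B = 1]. *)
Lemma quadratic_square_h (r r' A B z w : C) :
  (r * r' = 1)%C -> (A ^ 2 + B ^ 2 = 1)%C -> (1 + B)%C <> RtoC 0 -> (w = Ci * r' * A / (1 + B))%C ->
  (r * (1 - B) * z ^ 2 + 2 * Ci * r ^ 2 * A * z - r ^ 3 * (1 + B) =
   - r ^ 3 * (1 + B) * (1 - z * w) ^ 2)%C.
Proof.
  intros E1 E2 HB ->.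
  assert (HA : (A ^ 2 = (1 - B) * (1 + B))%C).
  { replace (A ^ 2)%C with (A ^ 2 + B ^ 2 - B ^ 2)%C by ring. rewrite E2. ring. }
  replace ((1 - z * (Ci * r' * A / (1 + B))) ^ 2)%C with
    (1 - 2 * Ci * r' * A * z / (1 + B) + (Ci * Ci) * r' ^ 2 * A ^ 2 * z ^ 2 / (1 + B) ^ 2)%C
    by (field; exact HB).
  rewrite HA. replace (Ci * Ci)%C with (- (1))%C by (unfold Ci, Cmult, Copp, RtoC; simpl; f_equal; ring).
  transitivity (r * (r * r') ^ 2 * (1 - B) * z ^ 2 + 2 * Ci * r ^ 2 * (r * r') * A * z - r ^ 3 * (1 + B))%C.
  - rewrite E1. ring.
  - field. exact HB.
Qed.

Lemma quadratic_square_g (r A B z w : C) :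
  (A ^ 2 + B ^ 2 = 1)%C -> (1 + B)%C <> RtoC 0 -> (w = - Ci * r * A / (1 + B))%C ->
  (r * (1 + B) * z ^ 2 + 2 * Ci * r ^ 2 * A * z - r ^ 3 * (1 - B) =
   r * (1 + B) * (z - w) ^ 2)%C.
Proof.
  intros E2 HB ->.
  assert (HA : (A ^ 2 = (1 - B) * (1 + B))%C).
  { replace (A ^ 2)%C with (A ^ 2 + B ^ 2 - B ^ 2)%C by ring. rewrite E2. ring. }
  replace ((z - - Ci * r * A / (1 + B)) ^ 2)%C with
    (z ^ 2 + 2 * Ci * r * A * z / (1 + B) + (Ci * Ci) * r ^ 2 * A ^ 2 / (1 + B) ^ 2)%C
    by (field; exact HB).
  rewrite HA. replace (Ci * Ci)%C with (- (1))%C by (unfold Ci, Cmult, Copp, RtoC; simpl; f_equal; ring).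
  field. exact HB.
Qed.

(** * Hyperbolic functions and the choice of [p] *)

Lemma cosh_sqr x : cosh x ^ 2 = 1 + sinh x ^ 2.
Proof.
  unfold cosh, sinh. assert (exp x * exp (- x) = 1) by (rewrite <- exp_plus, Rplus_opp_r; apply exp_0).
  nra.
Qed.

Lemma cosh_ge_1 x : 1 <= cosh x.
Proof.
  assert (0 < cosh x) by (unfold cosh; pose proof (exp_pos x); pose proof (exp_pos (- x)); lra).
  pose proof (cosh_sqr x). pose proof (pow2_ge_0 (sinh x)). nra.
Qed.

Lemma sinh_pos x : 0 < x -> 0 < sinh x.
Proof.
  intros H. unfold sinh. assert (exp (- x) < exp x) by (apply exp_increasing; lra). lra.
Qed.

Lemma cosh_plus x y : cosh (x + y) = cosh x * cosh y + sinh x * sinh y.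
Proof. unfold cosh, sinh. rewrite Ropp_plus_distr, !exp_plus. field. Qed.

Lemma sinh_plus x y : sinh (x + y) = sinh x * cosh y + cosh x * sinh y.
Proof. unfold cosh, sinh. rewrite Ropp_plus_distr, !exp_plus. field. Qed.

Lemma cosh_opp x : cosh (- x) = cosh x.
Proof. unfold cosh. rewrite Ropp_involutive. lra. Qed.

Lemma sinh_opp x : sinh (- x) = - sinh x.
Proof. unfold sinh. rewrite Ropp_involutive. lra. Qed.

(** With [c = cos (p / 2)] and [s = sin (p / 2)], the discriminant of the numerator in
    [pole_sum_common_denominator] is [16 exp (2 i p) (c^2 (1 - s^2 E^2) + s^2 H^2)]. For
    [E = sin mu cosh d] and [H = i cos mu sinh d] it vanishes for every [mu] once [s cosh d = 1]. As
    [c] and [s] are real, the discriminant belonging to [conj E] and [conj H] vanishes as well. *)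
Definition step_parameter (d : R) : R := 2 * atan (/ sinh d).

Lemma step_parameter_bounds d : 0 < d -> 0 < step_parameter d < PI.
Proof.
  intros Hd. pose proof (sinh_pos d Hd). unfold step_parameter.
  pose proof (atan_bound (/ sinh d)).
  assert (0 < atan (/ sinh d)); [|lra].
  rewrite <- atan_0. apply atan_increasing, Rinv_0_lt_compat. assumption.
Qed.

Lemma cos_sin_half_step_parameter d :
  0 < d -> cos (step_parameter d / 2) = sinh d / cosh d /\ sin (step_parameter d / 2) = / cosh d.
Proof.
  intros Hd. pose proof (sinh_pos d Hd) as HS. pose proof (cosh_ge_1 d).
  replace (step_parameter d / 2) with (atan (/ sinh d)) by (unfold step_parameter; field).
  rewrite cos_atan, sin_atan.
  replace (sqrt (1 + (/ sinh d)²)) with (cosh d / sinh d).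
  - split; field; lra.
  - symmetry. rewrite <- (sqrt_pow2 (cosh d / sinh d)).
    + f_equal. unfold Rsqr. replace ((cosh d / sinh d) ^ 2) with (cosh d ^ 2 / sinh d ^ 2) by (field; lra).
      rewrite cosh_sqr. field. lra.
    + apply Rlt_le, Rdiv_lt_0_compat; lra.
Qed.

Lemma C1_neq_0 : RtoC 1 <> RtoC 0.
Proof. intros E. apply RtoC_inj in E. lra. Qed.

Lemma Cdiv_eq_cross (x y u v : C) :
  y <> RtoC 0 -> v <> RtoC 0 -> (x * v = u * y)%C -> (x / y = u / v)%C.
Proof.
  intros Hy Hv E. replace (x / y)%C with (x * v / (y * v))%C by (field; auto).
  rewrite E. field. auto.
Qed.

(** * Closed forms for the zero and the unimodular factor of the dilatation *)

Section Dilatation.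

Variables (m sigma d : R).
Hypothesis Hm : - (PI / 2) < m < PI / 2.
Hypothesis Hd : 0 < d.

(* [sin (m + i sigma)] and [cos (m + i sigma)] *)
Let A : C := (sin m * cosh sigma, cos m * sinh sigma).
Let B : C := (cos m * cosh sigma, - (sin m * sinh sigma)).
Let r : C := (sinh d / cosh d, / cosh d).
Let r' : C := (sinh d / cosh d, - / cosh d).
Let k : C := RtoC (sinh d / cosh d).
Let w : C := ((1, - sinh d)%R * (sin m, - sinh sigma)%R
   / RtoC (cosh d * (cos m + cosh sigma)))%C.

Let cosm_pos : 0 < cos m.
Proof. apply cos_gt_0; lra. Qed.

Let sin_sqr : sin m ^ 2 = 1 - cos m ^ 2.
Proof. pose proof (sin2_cos2_pow m). lra. Qed.

Lemma AB_sqr : (A ^ 2 + B ^ 2 = 1)%C.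
Proof.
  pose proof (cosh_sqr sigma) as E. unfold A, B. unfold Cpow, Cmult, Cplus, RtoC. simpl.
  f_equal; [|ring]. ring_simplify. rewrite sin_sqr, E. ring.
Qed.

Lemma B_plus_1_neq_0 : (1 + B)%C <> RtoC 0.
Proof.
  intros E. injection E. unfold B. simpl. intros _ E1. pose proof (cosh_ge_1 sigma). nra.
Qed.

Lemma B_conj_plus_1_neq_0 : (1 + Cconj B)%C <> RtoC 0.
Proof.
  intros E. injection E. unfold B. simpl. intros _ E1. pose proof (cosh_ge_1 sigma). nra.
Qed.

Lemma r_r' : (r * r' = 1)%C.
Proof.
  pose proof (cosh_ge_1 d). pose proof (cosh_sqr d) as E. unfold r, r', Cmult, RtoC; simpl.
  f_equal; [|ring]. field_simplify; [|lra]. rewrite E. field. rewrite <- E. nra.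
Qed.

(** The half-angle formula for [tan (conj mu / 2)], once as sine over one plus cosine and once with
    a real denominator. *)
Lemma A_over_B : (Cconj A / (1 + Cconj B) = (sin m, - sinh sigma)%R / RtoC (cos m + cosh sigma))%C.
Proof.
  pose proof (cosh_ge_1 sigma). pose proof cosm_pos. pose proof sin_sqr as Es.
  pose proof (cosh_sqr sigma) as Ec. apply Cdiv_eq_cross.
  - apply B_conj_plus_1_neq_0.
  - intros E. apply RtoC_inj in E. lra.
  - unfold A, B, Cconj, Cmult, Cplus, RtoC; simpl. f_equal; ring_simplify; rewrite ?Es, ?Ec; ring.
Qed.

(** Both [|1 + cos mu|] and [cos m + cosh sigma] equal [2 |cos (mu / 2)|^2]. *)
Lemma B_norm : ((1 + B) * (1 + Cconj B) = RtoC (cos m + cosh sigma) ^ 2)%C.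
Proof.
  pose proof sin_sqr as Es. pose proof (cosh_sqr sigma) as Ec.
  unfold B, Cconj, Cpow, Cmult, Cplus, RtoC; simpl. f_equal; [|ring].
  ring_simplify; rewrite ?Es, ?Ec; ring_simplify. rewrite ?Es, ?Ec; ring.
Qed.

Lemma dilatation_zero_r : w = (- Ci * r * Cconj A / (1 + Cconj B))%C.
Proof.
  pose proof (cosh_ge_1 d). pose proof (cosh_ge_1 sigma). pose proof cosm_pos.
  replace (- Ci * r * Cconj A / (1 + Cconj B))%C with
    (- Ci * r * (Cconj A / (1 + Cconj B)))%C by (unfold Cdiv; ring).
  rewrite A_over_B. unfold w. rewrite RtoC_mult.
  replace (1, - sinh d) with (- Ci * r * RtoC (cosh d))%C.
  - field. split; intros E; apply RtoC_inj in E; lra.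
  - unfold Ci, r, Copp, Cmult, RtoC; simpl. f_equal; field; lra.
Qed.

Lemma dilatation_zero_conj : Cconj w = (Ci * r' * A / (1 + B))%C.
Proof.
  rewrite dilatation_zero_r, Cdiv_conj by apply B_conj_plus_1_neq_0.
  rewrite !Cmult_conj, Cplus_conj, !Cconj_conj. f_equal.
  - f_equal. f_equal; unfold Ci, r, r', Cconj, Copp; simpl; f_equal; ring.
  - f_equal. unfold Cconj, RtoC. simpl. f_equal. ring.
Qed.

(** The factor [1 - i sinh d] has modulus [cosh d], so [|w| = |tan (mu / 2)|], whose square is
    [(cosh sigma - cos m) / (cosh sigma + cos m)]. This is below 1 because [cos m > 0]. *)
Lemma dilatation_zero_in_disk : Cmod w < 1.
Proof.
  pose proof (cosh_ge_1 d). pose proof (cosh_ge_1 sigma). pose proof cosm_pos.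
  assert (Cmod w ^ 2 < 1); [|pose proof (Cmod_ge_0 w); nra].
  unfold w. rewrite Cmod_div by (intros E; apply RtoC_inj in E; nra).
  rewrite Cmod_mult, Cmod_R, Rabs_pos_eq by nra.
  replace ((Cmod (1, - sinh d) * Cmod (sin m, - sinh sigma) / (cosh d * (cos m + cosh sigma))) ^ 2)
    with (Cmod (1, - sinh d) ^ 2 * Cmod (sin m, - sinh sigma) ^ 2 / (cosh d ^ 2 * (cos m + cosh sigma) ^ 2))
    by (field; nra).
  rewrite !Cmod_sqr. unfold Re, Im; simpl fst; simpl snd.
  replace (1 ^ 2 + (- sinh d) ^ 2) with (cosh d ^ 2) by (rewrite cosh_sqr; ring).
  replace (sin m ^ 2 + (- sinh sigma) ^ 2) with ((cosh sigma - cos m) * (cosh sigma + cos m))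
    by (pose proof sin_sqr; pose proof (cosh_sqr sigma); nra).
  replace (_ / _) with ((cosh sigma - cos m) / (cosh sigma + cos m)) by (field; nra).
  apply (Rmult_lt_reg_r (cosh sigma + cos m)); [lra|]. field_simplify; lra.
Qed.

Variable e : C.
Hypothesis He : e <> RtoC 0.
Let X : C := ((1, sinh d)%R * (1 + cos m * cosh sigma, sin m * sinh sigma)%R
   / RtoC (cosh d * (cos m + cosh sigma)) * (Cconj e / RtoC (Cmod e)))%C.

(** By [B_norm] the denominator is [|1 + conj B|]. Thus [X] is a product of [i], of
    [exp (- i p / 2)] and of two numbers divided by their moduli. *)
Lemma dilatation_factor_r :
  X = (Ci * r' * (1 + Cconj B) / RtoC (cos m + cosh sigma) * (Cconj e / RtoC (Cmod e)))%C.
Proof.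
  pose proof (cosh_ge_1 d). pose proof (cosh_ge_1 sigma). pose proof cosm_pos.
  unfold X. f_equal. rewrite RtoC_mult.
  replace (1, sinh d) with (Ci * r' * RtoC (cosh d))%C.
  - replace (1 + cos m * cosh sigma, sin m * sinh sigma) with (1 + Cconj B)%C.
    + field. split; intros E; apply RtoC_inj in E; lra.
    + unfold B, Cconj, Cplus, RtoC; simpl. f_equal; ring.
  - unfold Ci, r', Cmult, RtoC; simpl. f_equal; field; lra.
Qed.

Lemma unit_sqr : ((Cconj e / RtoC (Cmod e)) ^ 2 = Cconj e / e)%C.
Proof.
  pose proof (proj1 (Cmod_gt_0 e) He) as P.
  assert (E : (RtoC (Cmod e) ^ 2 = e * Cconj e)%C).
  { rewrite <- RtoC_pow, Cmod_sqr. destruct e as [x y].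
    unfold Cconj, Cmult, RtoC, Re, Im; simpl. f_equal; ring. }
  replace ((Cconj e / RtoC (Cmod e)) ^ 2)%C with (Cconj e ^ 2 / RtoC (Cmod e) ^ 2)%C
    by (field; intros F; apply RtoC_inj in F; lra).
  rewrite E. field. split; [exact He|]. intros F. apply He.
  rewrite <- (Cconj_conj e), F. unfold Cconj, RtoC. simpl. f_equal. ring.
Qed.

Lemma dilatation_factor_sqr :
  (X ^ 2 = - r' ^ 2 * (1 + Cconj B) / (1 + B) * (Cconj e / e))%C.
Proof.
  pose proof (cosh_ge_1 sigma). pose proof cosm_pos.
  rewrite dilatation_factor_r.
  transitivity ((Ci * Ci) * r' ^ 2 * (1 + Cconj B) ^ 2 / RtoC (cos m + cosh sigma) ^ 2 *
    (Cconj e / RtoC (Cmod e)) ^ 2)%C.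
  - unfold Cdiv. assert (RtoC (cos m + cosh sigma) <> 0%R) by (intros E; apply RtoC_inj in E; lra).
    field. split; [|assumption].
    intros F; apply RtoC_inj in F. pose proof (proj1 (Cmod_gt_0 e) He). lra.
  - rewrite unit_sqr, <- B_norm.
    replace (Ci * Ci)%C with (- (1))%C by (unfold Ci, Cmult, Copp, RtoC; simpl; f_equal; ring).
    field.
    repeat split; (exact He || apply B_conj_plus_1_neq_0 || apply B_plus_1_neq_0).
Qed.

Lemma dilatation_factor_unimodular : Cmod X = 1.
Proof.
  pose proof (cosh_ge_1 d). pose proof (cosh_ge_1 sigma). pose proof cosm_pos.
  pose proof (proj1 (Cmod_gt_0 e) He).
  assert (Cmod X ^ 2 = 1); [|pose proof (Cmod_ge_0 X); nra].
  unfold X. rewrite Cmod_mult, !Cmod_div, Cmod_mult, Cmod_conj, !Cmod_R.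
  - rewrite !Rabs_pos_eq by nra.
    replace (_ ^ 2) with (Cmod (1, sinh d) ^ 2 * Cmod (1 + cos m * cosh sigma, sin m * sinh sigma) ^ 2
      / (cosh d ^ 2 * (cos m + cosh sigma) ^ 2)) by (field; nra).
    rewrite !Cmod_sqr. unfold Re, Im; simpl fst; simpl snd.
    replace (1 ^ 2 + sinh d ^ 2) with (cosh d ^ 2) by (rewrite cosh_sqr; ring).
    replace (_ + (sin m * sinh sigma) ^ 2) with ((cos m + cosh sigma) ^ 2).
    + field. nra.
    + pose proof sin_sqr as Es. pose proof (cosh_sqr sigma) as Ec.
      ring_simplify; rewrite ?Es, ?Ec; ring_simplify. rewrite ?Es, ?Ec; ring.
  - intros E; apply RtoC_inj in E; lra.
  - intros E; apply RtoC_inj in E; nra.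
Qed.

Let E : C := (A * RtoC (cosh d))%C.
Let H : C := (Ci * B * RtoC (sinh d))%C.

Lemma cis_step_parameter : cis (step_parameter d) = (r ^ 2)%C.
Proof.
  destruct (cos_sin_half_step_parameter d Hd) as [Ec Es].
  unfold cis. replace (step_parameter d) with (2 * (step_parameter d / 2)) by field.
  rewrite cos_2a, sin_2a, Ec, Es. unfold r, Cpow, Cmult, RtoC; simpl. f_equal; ring.
Qed.

(** Passing from [h'] to [g'] conjugates [E] and [H]. Since [H = i B sinh d], this replaces [A], [B]
    by [conj A], [- conj B], and the sign exchanges the roles of [1 - B] and [1 + B]. Hence the
    double roots of the two numerators are mirror images in the unit circle, which is the pattern of
    a Blaschke factor. *)
Lemma pole_sum_h z :
  disk z ->
  exists D : C, D <> RtoC 0 /\ forall f : C,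
  pole_sum (f * (1 - E - H)) (f * (1 + E + H)) (f * (- (1) - E + H)) (f * (- (1) + E - H))
    (step_parameter d) z =
  (4 * f * k * (- r ^ 3 * (1 + B) * (1 - z * Cconj w) ^ 2) / D)%C /\
  pole_sum (f * (1 - Cconj E - Cconj H)) (f * (1 + Cconj E + Cconj H))
    (f * (- (1) - Cconj E + Cconj H)) (f * (- (1) + Cconj E - Cconj H)) (step_parameter d) z =
  (4 * f * k * (r * (1 + Cconj B) * (z - w) ^ 2) / D)%C.
Proof.
  intros Hz. pose proof (cosh_ge_1 d) as HC.
  assert (E2 : (r + r' = 2 * k)%C).
  { unfold r, r', k, Cplus, Cmult, RtoC; simpl. f_equal; field; lra. }
  assert (E3 : (H * (r - r') = - (2) * B * k)%C).
  { unfold H, r, r', k, B, Ci, Cminus, Copp, Cplus, Cmult, RtoC; simpl. f_equal; field; lra. }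
  assert (E4 : (E * (r - r') = 2 * Ci * A)%C).
  { unfold E, r, r', A, Ci, Cminus, Copp, Cplus, Cmult, RtoC; simpl. f_equal; field; lra. }
  assert (E3' : (Cconj H * (r - r') = - (2) * - Cconj B * k)%C).
  { unfold H, r, r', k, B, Ci, Cconj, Cminus, Copp, Cplus, Cmult, RtoC; simpl. f_equal; field; lra. }
  assert (E4' : (Cconj E * (r - r') = 2 * Ci * Cconj A)%C).
  { unfold E, r, r', A, Ci, Cconj, Cminus, Copp, Cplus, Cmult, RtoC; simpl. f_equal; field; lra. }
  assert (AB' : (Cconj A ^ 2 + Cconj B ^ 2 = 1)%C).
  { transitivity (Cconj (A ^ 2 + B ^ 2)%C).
    - rewrite Cplus_conj, <- !Cpow_conj. reflexivity.
    - rewrite AB_sqr. unfold Cconj, RtoC; simpl. f_equal; ring. }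
  destruct (pole_sum_common_denominator 1 E H (step_parameter d) z Hz) as [HD _].
  (* The denominator does not involve the scale of the jumps, so it can be fixed before [f]; [h']
     and [g'] are evaluated with [f] and with [conj f]. *)
  eexists. split; [exact HD|]. intros f.
  destruct (pole_sum_common_denominator f E H (step_parameter d) z Hz) as [_ ->].
  destruct (pole_sum_common_denominator f (Cconj E) (Cconj H) (step_parameter d) z Hz) as [_ ->].
  rewrite cis_step_parameter in *.
  destruct (numerator_coefficients r r' k A B E H r_r' E2 E3 E4) as [F1 [F2 F3]].
  destruct (numerator_coefficients r r' k (Cconj A) (- Cconj B) (Cconj E) (Cconj H) r_r' E2 E3' E4')
    as [G1 [G2 G3]].
  rewrite F1, F2, G1, G2. split; f_equal.
  - rewrite <- (quadratic_square_h r r' A B z (Cconj w) r_r' AB_sqr B_plus_1_neq_0 dilatation_zero_conj).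
    transitivity (2 * f * (2 * k * r * (1 - B) * z ^ 2 + 4 * Ci * k * r ^ 2 * A * z -
      ((r ^ 2) ^ 2 * (1 - H) + r ^ 2 * (1 + H))))%C; [ring|]. rewrite F3. ring.
  - rewrite <- (quadratic_square_g r (Cconj A) (Cconj B) z w AB' B_conj_plus_1_neq_0 dilatation_zero_r).
    transitivity (2 * f * (2 * k * r * (1 - - Cconj B) * z ^ 2 + 4 * Ci * k * r ^ 2 * Cconj A * z -
      ((r ^ 2) ^ 2 * (1 - Cconj H) + r ^ 2 * (1 + Cconj H))))%C; [ring|]. rewrite G3. ring.
Qed.

Lemma hyperbola_point_minus : hyperbola_point m (sigma - d) = (E - H)%C.
Proof.
  unfold hyperbola_point, Rminus. rewrite cosh_plus, sinh_plus, cosh_opp, sinh_opp.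
  unfold E, H, A, B, Ci, Cminus, Cplus, Copp, Cmult, RtoC; simpl. f_equal; ring.
Qed.

Lemma hyperbola_point_plus : hyperbola_point m (sigma + d) = (E + H)%C.
Proof.
  unfold hyperbola_point. rewrite cosh_plus, sinh_plus.
  unfold E, H, A, B, Ci, Cminus, Cplus, Copp, Cmult, RtoC; simpl. f_equal; ring.
Qed.

(** The denominator and [4 k] cancel in the quotient; what is left beside the squared Blaschke
    factor is [X ^ 2]. Only the direction of [f] survives, so [e] may be any complex number with the
    same value of [conj e / e]. *)
Lemma dilatation_of_jumps f z (j0 j1 j2 j3 : C) :
  disk z -> f <> RtoC 0 -> (Cconj e / e = Cconj f / f)%C ->
  j0 = (f * (1 - E - H))%C -> j1 = (f * (1 + E + H))%C ->
  j2 = (f * (- (1) - E + H))%C -> j3 = (f * (- (1) + E - H))%C ->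
  pole_sum j0 j1 j2 j3 (step_parameter d) z <> RtoC 0 /\
  (pole_sum (Cconj j0) (Cconj j1) (Cconj j2) (Cconj j3) (step_parameter d) z /
   pole_sum j0 j1 j2 j3 (step_parameter d) z = mobius X w z ^ 2)%C.
Proof.
  intros Hz Hf Ef -> -> -> ->.
  destruct (pole_sum_h z Hz) as [D [HD F]].
  assert (H1 : Cconj (RtoC 1) = RtoC 1) by (unfold Cconj, RtoC; simpl; f_equal; ring).
  rewrite !Cmult_conj. unfold Cminus. rewrite !Cplus_conj, !Copp_conj, !H1.
  fold (Cminus 1 E). fold (Cminus (1 - E) H). fold (Cminus (- (1)) E). fold (Cminus (- (1) + E) H).
  fold (Cminus 1 (Cconj E)). fold (Cminus (1 - Cconj E) (Cconj H)).
  fold (Cminus (- (1)) (Cconj E)). fold (Cminus (- (1) + Cconj E) (Cconj H)).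
  destruct (F f) as [-> _]. destruct (F (Cconj f)) as [_ ->].
  assert (Hr : r <> RtoC 0).
  { intros E0. pose proof r_r' as R. rewrite E0, Cmult_0_l in R. apply RtoC_inj in R. lra. }
  assert (Hk : k <> RtoC 0).
  { intros E0. apply RtoC_inj in E0. pose proof (sinh_pos d Hd). pose proof (cosh_ge_1 d).
    assert (0 < sinh d / cosh d) by (apply Rdiv_lt_0_compat; lra). lra. }
  assert (Hw : (1 - z * Cconj w)%C <> RtoC 0).
  { intros E0. assert (E1 : (z * Cconj w)%C = RtoC 1).
    { transitivity (1 - (1 - z * Cconj w))%C; [ring|]. rewrite E0. ring. }
    apply (f_equal Cmod) in E1. rewrite Cmod_mult, Cmod_conj, Cmod_1 in E1.
    pose proof dilatation_zero_in_disk. unfold disk in Hz.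
    pose proof (Cmod_ge_0 z). pose proof (Cmod_ge_0 w). nra. }
  assert (Hr4 : (r ^ 3)%C <> RtoC 0) by (simpl; repeat apply Cmult_neq_0; auto; apply C1_neq_0).
  pose proof B_plus_1_neq_0. pose proof B_conj_plus_1_neq_0.
  assert (H4 : RtoC 4 <> RtoC 0) by (intros E0; apply RtoC_inj in E0; lra).
  split.
  - assert (HD' : (/ D)%C <> RtoC 0).
    { intros E0. apply C1_neq_0. rewrite <- (Cinv_r D HD), E0. ring. }
    assert (Hr3 : (- r ^ 3)%C <> RtoC 0).
    { intros E0. apply Hr4. transitivity (- - r ^ 3)%C; [ring|]. rewrite E0. ring. }
    unfold Cdiv. simpl (_ ^ 2)%C. repeat apply Cmult_neq_0; auto; apply C1_neq_0.
  - unfold mobius. 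
    transitivity (X ^ 2 * ((z - w) / (1 - z * Cconj w)) ^ 2)%C; [|ring].
    rewrite dilatation_factor_sqr, Ef.
    replace (r' ^ 2)%C with (/ r ^ 2)%C.
    + field. repeat split; auto.
    + transitivity (/ r ^ 2 * (r * r') ^ 2)%C; [rewrite r_r'; ring|field; exact Hr].
Qed.

End Dilatation.

(** * Quadrilaterals *)

Lemma segment_left a b : segment a b a.
Proof. exists 0. split; [lra|]. rewrite Rminus_0_r. ring. Qed.

Lemma segment_right a b : segment a b b.
Proof. exists 1. split; [lra|]. replace (1 - 1) with 0 by ring. ring. Qed.

Lemma segment_swap a b z : segment a b z -> segment b a z.
Proof.
  intros [t [Ht ->]]. exists (1 - t). split; [lra|].
  replace (1 - (1 - t)) with t by ring. ring.
Qed.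

Lemma simple_quadrilateral_diagonal b1 b2 b3 b4 :
  simple_quadrilateral b1 b2 b3 b4 -> b1 <> b3.
Proof.
  intros [H1 _] E. apply (H1 b1). split; [apply segment_left|rewrite E; apply segment_left].
Qed.

(** Twice the signed area of the triangle [a b c]. *)
Definition cross (a b c : C) : R := Im (Cconj (b - a) * (c - a))%C.

(** Each pair of hypotheses puts the ends of one segment on opposite sides of the line through the
    other. One inequality of each pair is weak, which covers collinear triples and matches a case
    split on [0 < x] against [x <= 0]. *)
Lemma segments_cross a b c d :
  cross a b c <= 0 < cross a b d -> cross b c d <= 0 < cross a c d ->
  exists z, segment a b z /\ segment c d z.
Proof.
  intros [P4 P3] [P1 P2].
  assert (S : cross b c d + cross a b d = cross a c d + cross a b c)
    by (unfold cross, Cconj, Cminus, Copp, Cplus, Cmult, Im; simpl; ring).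
  assert (HN : cross a c d - cross b c d <> 0) by lra.
  exists (RtoC (1 - cross a c d / (cross a c d - cross b c d)) * a +
          RtoC (cross a c d / (cross a c d - cross b c d)) * b)%C.
  split.
  - eexists. split; [|reflexivity]. split.
    + apply Rmult_le_pos; [lra|]. apply Rlt_le, Rinv_0_lt_compat. lra.
    + apply (Rmult_le_reg_r (cross a c d - cross b c d)); [lra|]. field_simplify; lra.
  - exists (- cross a b c / (cross a c d - cross b c d)). split.
    + split.
      * apply Rmult_le_pos; [lra|]. apply Rlt_le, Rinv_0_lt_compat. lra.
      * apply (Rmult_le_reg_r (cross a c d - cross b c d)); [lra|]. field_simplify; lra.
    (* The affine dependence of four points of the plane, whose coefficients are the signed areas of
       the triangles omitting one point. Dividing by the common sum of weights gives the
       intersection point. *)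
    + assert (L : (RtoC (- cross b c d) * a + RtoC (cross a c d) * b =
                  RtoC (cross a b d) * c + RtoC (- cross a b c) * d)%C).
      { unfold cross, Cconj, Cminus, Copp, Cplus, Cmult, Im, RtoC; simpl. f_equal; ring. }
      assert (HN' : RtoC (cross a c d - cross b c d) <> RtoC 0)
        by (intros E; apply RtoC_inj in E; lra).
      transitivity ((RtoC (- cross b c d) * a + RtoC (cross a c d) * b)
                    / RtoC (cross a c d - cross b c d))%C.
      * replace (1 - cross a c d / (cross a c d - cross b c d))
          with (- cross b c d / (cross a c d - cross b c d)) by (field; lra).
        rewrite !RtoC_div by lra. field. exact HN'.
      * rewrite L.
        replace (1 - - cross a b c / (cross a c d - cross b c d))
          with (cross a b d / (cross a c d - cross b c d))
          by (replace (cross a b d) with (cross a c d + cross a b c - cross b c d) by lra; field; lra).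
        rewrite !RtoC_div by lra. field. exact HN'.
Qed.

(** Both triangles cut off by the diagonal [b1 b3] are positively oriented. The angles at [b1] and
    [b3] may still be reflex. *)
Definition separating_diagonal (b1 b2 b3 b4 : C) : Prop :=
  0 < cross b1 b2 b3 /\ 0 < cross b1 b3 b4.

Lemma cross_rotate a b c : cross b c a = cross a b c.
Proof. unfold cross, Cconj, Cminus, Copp, Cplus, Cmult, Im; simpl. ring. Qed.

(* If no diagonal separates the other two vertices, two opposite sides cross. *)
Lemma quadrilateral_separating_diagonal b1 b2 b3 b4 :
  quadrilateral b1 b2 b3 b4 ->
  separating_diagonal b1 b2 b3 b4 \/ separating_diagonal b2 b3 b4 b1.
Proof.
  intros [[H1 [H2 _]] HA].
  assert (S1 : 2 * signed_area b1 b2 b3 b4 = cross b1 b2 b3 + cross b1 b3 b4).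
  { unfold signed_area, cross, Cconj, Cminus, Copp, Cplus, Cmult, Im; simpl. field. }
  assert (S2 : 2 * signed_area b1 b2 b3 b4 = cross b2 b3 b4 + cross b1 b2 b4).
  { unfold signed_area, cross, Cconj, Cminus, Copp, Cplus, Cmult, Im; simpl. field. }
  unfold separating_diagonal.
  pose proof (cross_rotate b2 b4 b1) as R1. pose proof (cross_rotate b4 b1 b2) as R2.
  pose proof (cross_rotate b1 b3 b4) as R3. pose proof (cross_rotate b4 b1 b3) as R4.
  pose proof (cross_rotate b1 b2 b3) as R5. pose proof (cross_rotate b3 b1 b2) as R6.
  pose proof (cross_rotate b2 b3 b4) as R7. pose proof (cross_rotate b4 b2 b3) as R8.
  pose proof (cross_rotate b1 b2 b4) as R9.
  (* Both splittings of the area have a positive sum, so a diagonal that fails has exactly one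
     nonpositive triangle. Two failing diagonals leave four sign patterns. *)
  destruct (Rlt_le_dec 0 (cross b1 b2 b3)) as [P4|P4];
  destruct (Rlt_le_dec 0 (cross b1 b3 b4)) as [P2|P2];
  destruct (Rlt_le_dec 0 (cross b2 b3 b4)) as [P1|P1];
  destruct (Rlt_le_dec 0 (cross b1 b2 b4)) as [P3|P3];
  try (left; lra); try (right; lra); try lra; exfalso.
  - destruct (segments_cross b3 b4 b1 b2) as [z [A B]]; [lra|lra|]. apply (H1 z). auto.
  - destruct (segments_cross b2 b3 b4 b1) as [z [A B]]; [lra|lra|]. apply (H2 z). auto.
  - destruct (segments_cross b4 b1 b2 b3) as [z [A B]]; [lra|lra|]. apply (H2 z). auto.
  - destruct (segments_cross b1 b2 b3 b4) as [z [A B]]; [lra|lra|]. apply (H1 z). auto.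
Qed.

(** * Hyperbolic coordinates *)

(** Elliptic coordinates: at [w = sin (m + i t)] the distances to the foci -1 and 1 are
    [cosh t + sin m] and [cosh t - sin m]. Half the difference gives [m], half the sum must be
    [cosh t], and [Im w] fixes the sign of [t]. *)
Lemma hyperbola_point_exists (w : C) :
  let x := (Cmod (w + 1)%C - Cmod (w - 1)%C) / 2 in
  -1 < x < 1 -> exists t, w = hyperbola_point (asin x) t.
Proof.
  intros x Hx.
  set (r1 := Cmod (w + 1)) in *. set (r2 := Cmod (w - 1)) in *.
  pose proof (Cmod_ge_0 (w + 1)) as P1. pose proof (Cmod_ge_0 (w - 1)) as P2.
  fold r1 in P1. fold r2 in P2.
  assert (E1 : r1 ^ 2 = (Re w + 1) ^ 2 + Im w ^ 2).
  { unfold r1. rewrite Cmod_sqr. unfold Re, Im, Cplus, RtoC; simpl. ring. }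
  assert (E2 : r2 ^ 2 = (Re w - 1) ^ 2 + Im w ^ 2).
  { unfold r2. rewrite Cmod_sqr. unfold Re, Im, Cminus, Copp, Cplus, RtoC; simpl. ring. }
  set (k := (r1 + r2) / 2).
  assert (Ek : k * x = Re w) by (unfold k, x; nra).
  assert (Ey : (k ^ 2 - 1) * (1 - x ^ 2) = Im w ^ 2).
  { replace ((k ^ 2 - 1) * (1 - x ^ 2)) with (k ^ 2 + x ^ 2 - 1 - (k * x) ^ 2) by ring.
    rewrite Ek. unfold k, x. nra. }
  assert (Hc : 0 < 1 - x ^ 2) by nra.
  assert (Ecos : cos (asin x) = sqrt (1 - x ^ 2)).
  { rewrite cos_asin by lra. f_equal. unfold Rsqr. ring. }
  assert (Esin : sin (asin x) = x) by (apply sin_asin; lra).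
  pose proof (sqrt_lt_R0 _ Hc) as Hs.
  pose proof (pow2_sqrt (1 - x ^ 2) (Rlt_le _ _ Hc)) as Es.
  exists (arcsinh (Im w / sqrt (1 - x ^ 2))).
  assert (Ech : cosh (arcsinh (Im w / sqrt (1 - x ^ 2))) = k).
  { apply Rsqr_inj.
    - pose proof (cosh_ge_1 (arcsinh (Im w / sqrt (1 - x ^ 2)))). lra.
    - unfold k. lra.
    - rewrite !Rsqr_pow2, cosh_sqr, sinh_arcsinh.
      replace ((Im w / sqrt (1 - x ^ 2)) ^ 2) with (Im w ^ 2 / sqrt (1 - x ^ 2) ^ 2) by (field; lra).
      rewrite Es, <- Ey. field. lra. }
  unfold hyperbola_point. rewrite Ech, sinh_arcsinh, Ecos, Esin, Rmult_comm, Ek.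
  replace (sqrt (1 - x ^ 2) * (Im w / sqrt (1 - x ^ 2))) with (Im w) by (field; lra).
  apply surjective_pairing.
Qed.

(** The foci are at distance 2, and equality in the triangle inequality occurs only on the real axis
    outside the open focal segment. *)
Lemma Cmod_difference_strict (w : C) :
  (Im w = 0 -> -1 < Re w < 1) -> -1 < (Cmod (w + 1)%C - Cmod (w - 1)%C) / 2 < 1.
Proof.
  intros H.
  set (r1 := Cmod (w + 1)) in *. set (r2 := Cmod (w - 1)) in *.
  pose proof (Cmod_ge_0 (w + 1)) as P1. pose proof (Cmod_ge_0 (w - 1)) as P2.
  fold r1 in P1. fold r2 in P2.
  assert (E1 : r1 ^ 2 = (Re w + 1) ^ 2 + Im w ^ 2).
  { unfold r1. rewrite Cmod_sqr. unfold Re, Im, Cplus, RtoC; simpl. ring. }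
  assert (E2 : r2 ^ 2 = (Re w - 1) ^ 2 + Im w ^ 2).
  { unfold r2. rewrite Cmod_sqr. unfold Re, Im, Cminus, Copp, Cplus, RtoC; simpl. ring. }
  assert (Key : r1 < r2 + 2 /\ r2 < r1 + 2); [|lra].
  destruct (Req_dec (Im w) 0) as [E|E].
  - specialize (H E). rewrite E in E1, E2.
    assert (r1 = Re w + 1) by (apply Rsqr_inj; [lra|lra|unfold Rsqr; nra]).
    assert (r2 = 1 - Re w) by (apply Rsqr_inj; [lra|lra|unfold Rsqr; nra]). lra.
  - assert (0 < Im w ^ 2) by (apply pow2_gt_0; exact E).
    assert (- r2 < Re w - 1 < r2) by (split; nra).
    assert (- r1 < Re w + 1 < r1) by (split; nra). split; nra.
Qed.

(** Rearranged, the Pitot condition says that [b2] and [b4] have the same difference of distances to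
    [b1] and [b3], hence the same [m]. *)
Lemma pitot_hyperbolic_coordinates b1 b2 b3 b4 :
  pitot_quadrilateral b1 b2 b3 b4 ->
  exists m s t, hyperbolic_coordinates b1 b2 b3 b4 m s t /\ t < s.
Proof.
  intros [[[H1 [H2 [H3 [H4 [H5 H6]]]]] HA] HP].
  assert (N : b1 <> b3) by (apply (simple_quadrilateral_diagonal b1 b2 b3 b4); repeat split; auto).
  assert (N' : (b3 - b1)%C <> RtoC 0).
  { intros E. apply N. transitivity (b3 - (b3 - b1))%C; [ring|]. rewrite E. ring. }
  set (w2 := ((2 * b2 - b1 - b3) / (b3 - b1))%C). set (w4 := ((2 * b4 - b1 - b3) / (b3 - b1))%C).
  assert (N2 : RtoC 2 <> RtoC 0) by (intros E; apply RtoC_inj in E; lra).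
  assert (E2 : b2 = ((b3 - b1) / 2 * w2 + (b1 + b3) / 2)%C) by (unfold w2; field; auto).
  assert (E4 : b4 = ((b3 - b1) / 2 * w4 + (b1 + b3) / 2)%C) by (unfold w4; field; auto).
  assert (Pe : 0 < Cmod (b3 - b1)) by (apply Cmod_gt_0, N').
  assert (M2 : 0 < Cmod 2) by (apply Cmod_gt_0; exact N2).
  assert (Q : forall z w, (2 * (z - b1) = (b3 - b1) * (w + 1))%C ->
            (2 * (z - b3) = (b3 - b1) * (w - 1))%C ->
            Cmod (b3 - b1) * (Cmod (w + 1) - Cmod (w - 1)) = Cmod 2 * (Cmod (z - b1) - Cmod (z - b3))).
  { intros z w Z1 Z3. rewrite !Rmult_minus_distr_l, <- !Cmod_mult, Z1, Z3. reflexivity. }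
  assert (Q2 := Q b2 w2 ltac:(unfold w2; field; auto) ltac:(unfold w2; field; auto)).
  assert (Q4 := Q b4 w4 ltac:(unfold w4; field; auto) ltac:(unfold w4; field; auto)).
  assert (Sw : forall a b : C, Cmod (a - b) = Cmod (b - a)).
  { intros a b. rewrite <- (Cmod_opp (a - b)). f_equal. ring. }
  assert (EQ : (Cmod (w2 + 1)%C - Cmod (w2 - 1)%C) / 2 = (Cmod (w4 + 1)%C - Cmod (w4 - 1)%C) / 2).
  { f_equal. apply (Rmult_eq_reg_l (Cmod (b3 - b1))); [|lra]. rewrite Q2, Q4. f_equal.
    rewrite (Sw b2 b1), (Sw b4 b3). lra. }
  assert (B : -1 < (Cmod (w2 + 1)%C - Cmod (w2 - 1)%C) / 2 < 1).
  (* On the line of the foci but outside the open segment, [b2] would force [b1] or [b3] onto a side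
     not adjacent to it, against simplicity. *)
  { apply Cmod_difference_strict. intros E.
    assert (Ew : w2 = RtoC (Re w2)) by (rewrite (surjective_pairing w2) at 1; unfold RtoC; f_equal; exact E).
    set (x := Re w2) in *. clearbody x. rewrite Ew in E2. split; apply Rnot_le_lt; intros Hx.
    - assert (S : segment b2 b3 b1).
      { apply segment_swap. exists (2 / (1 - x)). split.
        - split; [apply Rmult_le_pos; [lra|apply Rlt_le, Rinv_0_lt_compat; lra]|].
          apply (Rmult_le_reg_r (1 - x)); [lra|]. field_simplify; lra.
        - rewrite E2. replace (1 - 2 / (1 - x)) with ((- x - 1) / (1 - x)) by (field; lra).
          assert (RtoC (1 - x) <> RtoC 0) by (intros F; apply RtoC_inj in F; lra).
          rewrite !RtoC_div by lra. rewrite !RtoC_minus, RtoC_opp in *. field; auto. }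
      apply (H2 b1). split; [exact S|apply segment_right].
    - assert (S : segment b1 b2 b3).
      { exists (2 / (x + 1)). split.
        - split; [apply Rmult_le_pos; [lra|apply Rlt_le, Rinv_0_lt_compat; lra]|].
          apply (Rmult_le_reg_r (x + 1)); [lra|]. field_simplify; lra.
        - rewrite E2. replace (1 - 2 / (x + 1)) with ((x - 1) / (x + 1)) by (field; lra).
          assert (RtoC (x + 1) <> RtoC 0) by (intros F; apply RtoC_inj in F; lra).
          rewrite !RtoC_div by lra. rewrite !RtoC_minus, !RtoC_plus in *. field; auto. }
      apply (H1 b3). split; [exact S|apply segment_left]. }
  destruct (hyperbola_point_exists w2 B) as [t Ht].
  destruct (hyperbola_point_exists w4) as [s Hs]; [rewrite <- EQ; exact B|].
  rewrite <- EQ in Hs. set (m := asin _) in *.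
  assert (Hm : - (PI / 2) < m < PI / 2).
  { unfold m. apply asin_bound_lt, B. }
  exists m, s, t. split; [repeat split; try apply Hm; assumption|].
  assert (Hc : 0 < cos m) by (apply cos_gt_0; lra).
  (* The orientation enters here: the signed area is a positive multiple of [Im w4 - Im w2]. Since
     [sinh] is increasing this becomes [t < s], the positivity of [d] on which the choice of [p]
     depends. *)
  assert (Im w2 < Im w4).
  { assert (A : 4 * signed_area b1 b2 b3 b4 = Cmod (b3 - b1) ^ 2 * (Im w4 - Im w2)).
    { rewrite Cmod_sqr. unfold signed_area. rewrite E2, E4. clearbody w2 w4. clear.
      destruct b1 as [x1 y1], b3 as [x3 y3], w2 as [p2 q2], w4 as [p4 q4].
      unfold Cdiv, Cinv, Cconj, Cminus, Copp, Cplus, Cmult, Im, Re, RtoC; simpl. field. }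
    nra. }
  apply Rnot_le_lt. intros Hst. rewrite Ht, Hs in H. unfold hyperbola_point, Im in H. simpl in H.
  assert (sinh s <= sinh t).
  { destruct Hst as [Hst|Hst]; [apply Rlt_le, sinh_lt, Hst|rewrite Hst; lra]. }
  nra.
Qed.

(** * The domain bounded by a quadrilateral with a separating diagonal *)

Lemma on_sides_shift b1 b2 b3 b4 z : on_sides b2 b3 b4 b1 z <-> on_sides b1 b2 b3 b4 z.
Proof. unfold on_sides. tauto. Qed.

Lemma quad_domain_shift b1 b2 b3 b4 z :
  quad_domain b2 b3 b4 b1 z <-> quad_domain b1 b2 b3 b4 z.
Proof.
  unfold quad_domain. rewrite on_sides_shift.
  split; intros [H [M HM]]; (split; [exact H|]); exists M; intros g G1 G2 G3; apply HM; auto;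
    intros t Ht Hs; apply (G3 t Ht); revert Hs; apply on_sides_shift.
Qed.

Definition pos_part (x : R) : R := Rmax 0 x.

Lemma continuous_pos_part x : continuous pos_part x.
Proof.
  apply continuous_ext with (f := fun x => (x + Rabs x) / 2).
  - intros y. unfold pos_part, Rmax. destruct (Rle_dec 0 y);
      [rewrite Rabs_pos_eq by lra|rewrite Rabs_left by lra]; lra.
  - apply continuous_real_mult; [|apply continuous_const].
    apply continuous_real_plus; [apply continuous_id|apply continuous_Rabs].
Qed.

Section Chart.

Variables b1 b2 b3 b4 : C.
Hypothesis Hsep : separating_diagonal b1 b2 b3 b4.

(* The similarity [w |-> (w - b1) * conj (b1 - b3)] makes the diagonal horizontal. *)
Definition diag_u (z : C) : R := Re ((z - b1) * Cconj (b1 - b3))%C.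
Definition diag_v (z : C) : R := Im ((z - b1) * Cconj (b1 - b3))%C.

(** The sides meeting at [b3] and, in [right_boundary], those meeting at [b1], as broken lines over
    the height [v] with the break at the diagonal [v = 0]. Positive parts give one continuous
    formula for both halves. *)
Definition left_boundary (v : R) : R :=
  diag_u b3 + (diag_u b2 - diag_u b3) * (pos_part v / diag_v b2)
  + (diag_u b4 - diag_u b3) * (pos_part (- v) / - diag_v b4).

Definition right_boundary (v : R) : R :=
  diag_u b2 * (pos_part v / diag_v b2) + diag_u b4 * (pos_part (- v) / - diag_v b4).

Lemma diag_v_b2_pos : 0 < diag_v b2.
Proof.
  destruct Hsep as [H _]. revert H.
  unfold cross, diag_v, Cconj, Cminus, Copp, Cplus, Cmult, Im; simpl. lra.
Qed.

Lemma diag_v_b4_neg : diag_v b4 < 0.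
Proof.
  destruct Hsep as [_ H]. revert H.
  unfold cross, diag_v, Cconj, Cminus, Copp, Cplus, Cmult, Im; simpl. lra.
Qed.

Lemma diag_u_b1 : diag_u b1 = 0.
Proof. unfold diag_u. replace (b1 - b1)%C with (RtoC 0) by ring. rewrite Cmult_0_l. reflexivity. Qed.

Lemma diag_v_b1 : diag_v b1 = 0.
Proof. unfold diag_v. replace (b1 - b1)%C with (RtoC 0) by ring. rewrite Cmult_0_l. reflexivity. Qed.

Lemma diag_v_b3 : diag_v b3 = 0.
Proof. unfold diag_v, Cconj, Cminus, Copp, Cplus, Cmult, Im; simpl. ring. Qed.

Lemma diag_u_b3 : diag_u b3 = - Cmod (b1 - b3) ^ 2.
Proof.
  rewrite Cmod_sqr. unfold diag_u, Cconj, Cminus, Copp, Cplus, Cmult, Im, Re; simpl. ring.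
Qed.

Lemma diagonal_neq_0 : (b1 - b3)%C <> RtoC 0.
Proof.
  intros E. pose proof diag_v_b2_pos as P. unfold diag_v in P. rewrite E in P.
  unfold Cconj, RtoC, Cmult, Im in P; simpl in P. lra.
Qed.

Lemma diag_u_b3_neg : diag_u b3 < 0.
Proof.
  rewrite diag_u_b3. pose proof (proj1 (Cmod_gt_0 _) diagonal_neq_0). nra.
Qed.

Lemma diag_coordinates_inj z w : diag_u z = diag_u w -> diag_v z = diag_v w -> z = w.
Proof.
  intros Hu Hv.
  assert (E : ((z - b1) * Cconj (b1 - b3) = (w - b1) * Cconj (b1 - b3))%C).
  { rewrite (surjective_pairing ((z - b1) * _)%C), (surjective_pairing ((w - b1) * _)%C).
    f_equal; assumption. }
  assert (N : Cconj (b1 - b3) <> RtoC 0).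
  { intros F. apply diagonal_neq_0. rewrite <- (Cconj_conj (b1 - b3)), F.
    unfold Cconj, RtoC; simpl; f_equal; ring. }
  transitivity (b1 + ((z - b1) * Cconj (b1 - b3)) / Cconj (b1 - b3))%C; [field; exact N|].
  rewrite E. field. exact N.
Qed.

Lemma diag_u_affine s a t b : s + t = 1 -> diag_u (RtoC s * a + RtoC t * b) = s * diag_u a + t * diag_u b.
Proof.
  intros E. replace s with (1 - t) by lra.
  unfold diag_u, Cconj, Cminus, Copp, Cplus, Cmult, RtoC, Re, Im; simpl. ring.
Qed.

Lemma diag_v_affine s a t b : s + t = 1 -> diag_v (RtoC s * a + RtoC t * b) = s * diag_v a + t * diag_v b.
Proof.
  intros E. replace s with (1 - t) by lra.
  unfold diag_v, Cconj, Cminus, Copp, Cplus, Cmult, RtoC, Re, Im; simpl. ring.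
Qed.

Lemma segment_diag_coordinates a b z :
  segment a b z <-> exists t, 0 <= t <= 1 /\
    diag_u z = (1 - t) * diag_u a + t * diag_u b /\ diag_v z = (1 - t) * diag_v a + t * diag_v b.
Proof.
  split; intros [t [Ht E]]; exists t; (split; [exact Ht|]).
  - rewrite E, diag_u_affine, diag_v_affine by lra. auto.
  - apply diag_coordinates_inj; rewrite ?diag_u_affine, ?diag_v_affine by lra; apply E.
Qed.

Lemma boundary_upper v :
  0 <= v -> left_boundary v = diag_u b3 + (diag_u b2 - diag_u b3) * (v / diag_v b2) /\
            right_boundary v = diag_u b2 * (v / diag_v b2).
Proof.
  intros H. pose proof diag_v_b4_neg. unfold left_boundary, right_boundary, pos_part.
  rewrite (Rmax_right 0 v), (Rmax_left 0 (- v)) by lra.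
  unfold Rdiv. rewrite Rmult_0_l. split; ring.
Qed.

Lemma boundary_lower v :
  v <= 0 -> left_boundary v = diag_u b3 + (diag_u b4 - diag_u b3) * (v / diag_v b4) /\
            right_boundary v = diag_u b4 * (v / diag_v b4).
Proof.
  intros H. pose proof diag_v_b4_neg. unfold left_boundary, right_boundary, pos_part.
  rewrite (Rmax_left 0 v), (Rmax_right 0 (- v)) by lra.
  replace (- v / - diag_v b4) with (v / diag_v b4) by (field; lra).
  unfold Rdiv. rewrite Rmult_0_l. split; ring.
Qed.

Lemma left_le_right v : diag_v b4 <= v <= diag_v b2 -> left_boundary v <= right_boundary v.
Proof.
  intros Hv. pose proof diag_v_b2_pos. pose proof diag_v_b4_neg. pose proof diag_u_b3_neg.
  destruct (Rle_lt_dec 0 v) as [V0|V0].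
  - destruct (boundary_upper v V0) as [-> ->].
    assert (v / diag_v b2 <= 1) by (apply (Rmult_le_reg_r (diag_v b2)); [lra|field_simplify; lra]).
    nra.
  - destruct (boundary_lower v ltac:(lra)) as [-> ->].
    assert (v / diag_v b4 <= 1).
    { replace (v / diag_v b4) with (- v / - diag_v b4) by (field; lra).
      apply (Rmult_le_reg_r (- diag_v b4)); [lra|]. field_simplify; lra. }
    nra.
Qed.

(** The width at height [v] is [- diag_u b3] times [1 - v / diag_v b2] above the diagonal and
    [1 - v / diag_v b4] below it. Beyond the extreme vertices the extended lines have crossed, so a
    positive width already confines [v]. *)
Lemma left_lt_right v : left_boundary v < right_boundary v -> diag_v b4 < v < diag_v b2.
Proof.
  intros H. pose proof diag_v_b2_pos. pose proof diag_v_b4_neg. pose proof diag_u_b3_neg.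
  destruct (Rle_lt_dec 0 v) as [V0|V0].
  - destruct (boundary_upper v V0) as [E1 E2]. rewrite E1, E2 in H.
    assert (F : v / diag_v b2 < 1) by nra. split; [lra|].
    apply (Rmult_lt_reg_r (/ diag_v b2)); [apply Rinv_0_lt_compat; lra|].
    rewrite Rinv_r by lra. exact F.
  - destruct (boundary_lower v ltac:(lra)) as [E1 E2]. rewrite E1, E2 in H.
    assert (F : v / diag_v b4 < 1) by nra. split; [|lra].
    assert (G : v / diag_v b4 * diag_v b4 > 1 * diag_v b4) by nra.
    replace (v / diag_v b4 * diag_v b4) with v in G by (field; lra). lra.
Qed.

Lemma on_sides_diag z :
  on_sides b1 b2 b3 b4 z <->
  diag_v b4 <= diag_v z <= diag_v b2 /\
  (diag_u z = left_boundary (diag_v z) \/ diag_u z = right_boundary (diag_v z)).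
Proof.
  pose proof diag_v_b2_pos as P2. pose proof diag_v_b4_neg as P4. pose proof diag_u_b3_neg as P3.
  unfold on_sides. rewrite !segment_diag_coordinates, diag_u_b1, diag_v_b1, diag_v_b3.
  split.
  - intros [[t [Ht [Eu Ev]]]|[[t [Ht [Eu Ev]]]|[[t [Ht [Eu Ev]]]|[t [Ht [Eu Ev]]]]]].
    + assert (0 <= diag_v z) by nra. destruct (boundary_upper _ H) as [_ ->].
      split; [nra|right]. rewrite Ev, Eu. field. lra.
    + assert (0 <= diag_v z) by nra. destruct (boundary_upper _ H) as [-> _].
      split; [nra|left]. rewrite Ev, Eu. field. lra.
    + assert (diag_v z <= 0) by nra. destruct (boundary_lower _ H) as [-> _].
      split; [nra|left]. rewrite Ev, Eu. field. lra.
    + assert (diag_v z <= 0) by nra. destruct (boundary_lower _ H) as [_ ->].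
      split; [nra|right]. rewrite Ev, Eu. field. lra.
  - intros [Hv E]. destruct (Rle_lt_dec 0 (diag_v z)) as [V0|V0].
    + assert (T : 0 <= diag_v z / diag_v b2 <= 1).
      { split; [apply Rmult_le_pos; [lra|apply Rlt_le, Rinv_0_lt_compat; lra]|].
        apply (Rmult_le_reg_r (diag_v b2)); [lra|field_simplify; lra]. }
      destruct (boundary_upper _ V0) as [EL ER]. destruct E as [E|E].
      * right; left. exists (1 - diag_v z / diag_v b2). split; [lra|].
        rewrite E, EL. split; field; lra.
      * left. exists (diag_v z / diag_v b2). split; [lra|].
        rewrite E, ER. split; field; lra.
    + assert (T : 0 <= diag_v z / diag_v b4 <= 1).
      { replace (diag_v z / diag_v b4) with (- diag_v z / - diag_v b4) by (field; lra).
        split; [apply Rmult_le_pos; [lra|apply Rlt_le, Rinv_0_lt_compat; lra]|].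
        apply (Rmult_le_reg_r (- diag_v b4)); [lra|field_simplify; lra]. }
      destruct (boundary_lower _ (Rlt_le _ _ V0)) as [EL ER]. destruct E as [E|E].
      * right; right; left. exists (diag_v z / diag_v b4). split; [lra|].
        rewrite E, EL. split; field; lra.
      * right; right; right. exists (1 - diag_v z / diag_v b4). split; [lra|].
        rewrite E, ER. split; field; lra.
Qed.

(** A continuous function on the whole plane that can vanish only on the sides, so its sign is
    constant along any path avoiding them. *)
Definition diag_gap (z : C) : R :=
  Rmin (right_boundary (diag_v z) - diag_u z) (diag_u z - left_boundary (diag_v z)).

Lemma diag_gap_zero z : diag_gap z = 0 -> on_sides b1 b2 b3 b4 z.
Proof.
  unfold diag_gap. intros E. apply on_sides_diag.
  assert (L : left_boundary (diag_v z) <= right_boundary (diag_v z)).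
  { pose proof (Rmin_l (right_boundary (diag_v z) - diag_u z) (diag_u z - left_boundary (diag_v z))).
    pose proof (Rmin_r (right_boundary (diag_v z) - diag_u z) (diag_u z - left_boundary (diag_v z))).
    lra. }
  split.
  - destruct L as [L|L]; [pose proof (left_lt_right _ L); lra|].
    pose proof diag_v_b2_pos as P2. pose proof diag_v_b4_neg as P4. pose proof diag_u_b3_neg as P3.
    destruct (Rle_lt_dec 0 (diag_v z)) as [V0|V0].
    + destruct (boundary_upper _ V0) as [EL ER]. rewrite EL, ER in L.
      assert (F : diag_v z / diag_v b2 = 1) by nra.
      replace (diag_v z) with (diag_v z / diag_v b2 * diag_v b2) by (field; lra). rewrite F. lra.
    + destruct (boundary_lower _ (Rlt_le _ _ V0)) as [EL ER]. rewrite EL, ER in L.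
      assert (F : diag_v z / diag_v b4 = 1) by nra.
      replace (diag_v z) with (diag_v z / diag_v b4 * diag_v b4) by (field; lra). rewrite F. lra.
  - unfold Rmin in E. destruct Rle_dec; [right|left]; lra.
Qed.

Lemma diag_gap_pos z :
  0 < diag_gap z <-> left_boundary (diag_v z) < diag_u z < right_boundary (diag_v z).
Proof.
  unfold diag_gap. unfold Rmin. destruct Rle_dec; split; intros; lra.
Qed.

Lemma continuous_diag_u z : continuous diag_u z.
Proof.
  unfold diag_u. apply continuous_ext with
    (f := fun w : C => (Re w - Re b1) * Re (Cconj (b1 - b3)) + (Im w - Im b1) * - Im (Cconj (b1 - b3))).
  - intros w. unfold Cmult, Cminus, Cplus, Copp, Re, Im; simpl. ring.
  - apply (class_C_continuous 0 (fun _ => True)); [|exact I].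
    assert (O : open (fun _ : C => True)) by apply open_true.
    apply (class_C_plus _ O); apply (class_C_mult _ O);
      auto using class_C_const, class_C_Re_minus, class_C_Im_minus.
Qed.

Lemma continuous_diag_v z : continuous diag_v z.
Proof.
  unfold diag_v. apply continuous_ext with
    (f := fun w : C => (Re w - Re b1) * Im (Cconj (b1 - b3)) + (Im w - Im b1) * Re (Cconj (b1 - b3))).
  - intros w. unfold Cmult, Cminus, Cplus, Copp, Re, Im; simpl. ring.
  - apply (class_C_continuous 0 (fun _ => True)); [|exact I].
    assert (O : open (fun _ : C => True)) by apply open_true.
    apply (class_C_plus _ O); apply (class_C_mult _ O);
      auto using class_C_const, class_C_Re_minus, class_C_Im_minus.
Qed.

Lemma continuous_boundaries v : continuous left_boundary v /\ continuous right_boundary v.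
Proof.
  assert (P : continuous (fun v => pos_part v / diag_v b2) v).
  { apply continuous_real_mult; [apply continuous_pos_part|apply continuous_const]. }
  assert (N : continuous (fun v => pos_part (- v) / - diag_v b4) v).
  { apply continuous_real_mult; [|apply continuous_const].
    apply (continuous_real_comp _ Ropp pos_part); [|apply continuous_pos_part].
    apply (continuous_opp (V := R_NormedModule)), continuous_id. }
  split; repeat apply continuous_real_plus; try apply continuous_const;
    apply continuous_real_mult; (apply continuous_const || assumption).
Qed.

Lemma continuous_diag_gap z : continuous diag_gap z.
Proof.
  destruct (continuous_boundaries (diag_v z)) as [CL CR].
  assert (A : continuous (fun z => right_boundary (diag_v z) - diag_u z) z).
  { apply (continuous_minus (V := R_NormedModule) (fun z => right_boundary (diag_v z)));
      [|apply continuous_diag_u].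
    apply (continuous_real_comp _ diag_v right_boundary); [apply continuous_diag_v|exact CR]. }
  assert (B : continuous (fun z => diag_u z - left_boundary (diag_v z)) z).
  { apply (continuous_minus (V := R_NormedModule) diag_u); [apply continuous_diag_u|].
    apply (continuous_real_comp _ diag_v left_boundary); [apply continuous_diag_v|exact CL]. }
  set (p := fun z => right_boundary (diag_v z) - diag_u z) in *.
  set (q := fun z => diag_u z - left_boundary (diag_v z)) in *.
  apply continuous_ext with (f := fun z => p z - pos_part (p z - q z)).
  - intros w. unfold diag_gap, pos_part, Rmax, Rmin. fold (p w) (q w).
    change (right_boundary (diag_v w) - diag_u w) with (p w).
    change (diag_u w - left_boundary (diag_v w)) with (q w).
    destruct (Rle_dec 0 (p w - q w)), (Rle_dec (p w) (q w)); lra.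
  - apply (continuous_minus (V := R_NormedModule) p); [exact A|].
    apply (continuous_real_comp _ (fun z => p z - q z) pos_part); [|apply continuous_pos_part].
    apply (continuous_minus (V := R_NormedModule) p q); assumption.
Qed.

Lemma Cmod_le_diag z :
  Cmod z <= Cmod b1 + (Rabs (diag_u z) + Rabs (diag_v z)) / Cmod (b1 - b3).
Proof.
  pose proof (proj1 (Cmod_gt_0 _) diagonal_neq_0) as P.
  replace z with (b1 + (z - b1))%C at 1 by ring.
  eapply Rle_trans; [apply Cmod_triangle|]. apply Rplus_le_compat_l.
  apply (Rmult_le_reg_r (Cmod (b1 - b3))); [exact P|].
  replace ((Rabs (diag_u z) + Rabs (diag_v z)) / Cmod (b1 - b3) * Cmod (b1 - b3))
    with (Rabs (diag_u z) + Rabs (diag_v z)) by (field; lra).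
  rewrite <- (Cmod_conj (b1 - b3)), <- Cmod_mult.
  set (y := ((z - b1) * Cconj (b1 - b3))%C). change (diag_u z) with (Re y). change (diag_v z) with (Im y).
  replace y with (RtoC (Re y) + Ci * RtoC (Im y))%C at 1
    by (rewrite (surjective_pairing y) at 3; unfold Ci, RtoC, Cmult, Cplus, Re, Im; simpl; f_equal; ring).
  eapply Rle_trans; [apply Cmod_triangle|]. rewrite Cmod_mult, !Cmod_R.
  replace (Cmod Ci) with 1; [lra|]. unfold Cmod, Ci; simpl.
  replace (0 * (0 * 1) + 1 * (1 * 1)) with 1 by ring. symmetry. apply sqrt_1.
Qed.

Lemma diag_gap_pos_bounded : exists M, forall z, 0 < diag_gap z -> Cmod z <= M.
Proof.
  pose proof diag_v_b2_pos as P2. pose proof diag_v_b4_neg as P4. pose proof diag_u_b3_neg as P3.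
  pose proof (proj1 (Cmod_gt_0 _) diagonal_neq_0) as P.
  exists (Cmod b1 + (- diag_u b3 + 2 * Rabs (diag_u b2) + 2 * Rabs (diag_u b4) + - diag_u b3
                     + (diag_v b2 - diag_v b4)) / Cmod (b1 - b3)).
  intros z Hz. apply diag_gap_pos in Hz.
  destruct (left_lt_right (diag_v z)) as [B1 B2]; [lra|].
  eapply Rle_trans; [apply Cmod_le_diag|]. apply Rplus_le_compat_l.
  apply Rmult_le_compat_r; [apply Rlt_le, Rinv_0_lt_compat, P|].
  assert (Rabs (diag_v z) <= diag_v b2 - diag_v b4) by (apply Rabs_le; lra).
  assert (K : forall a t, 0 <= t <= 1 -> - Rabs a <= a * t <= Rabs a).
  { intros a t Ht. unfold Rabs. destruct Rcase_abs; nra. }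
  pose proof (Rabs_pos (diag_u b2)). pose proof (Rabs_pos (diag_u b4)).
  apply Rplus_le_compat; [|assumption].
  destruct (Rle_lt_dec 0 (diag_v z)) as [V0|V0].
  - assert (T : 0 <= diag_v z / diag_v b2 <= 1).
    { split; [apply Rmult_le_pos; [lra|apply Rlt_le, Rinv_0_lt_compat; lra]|].
      apply (Rmult_le_reg_r (diag_v b2)); [lra|field_simplify; lra]. }
    destruct (boundary_upper _ V0) as [EL ER]. rewrite EL, ER in Hz.
    pose proof (K (diag_u b2) _ T). apply Rabs_le. nra.
  - assert (T : 0 <= diag_v z / diag_v b4 <= 1).
    { replace (diag_v z / diag_v b4) with (- diag_v z / - diag_v b4) by (field; lra).
      split; [apply Rmult_le_pos; [lra|apply Rlt_le, Rinv_0_lt_compat; lra]|].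
      apply (Rmult_le_reg_r (- diag_v b4)); [lra|field_simplify; lra]. }
    destruct (boundary_lower _ (Rlt_le _ _ V0)) as [EL ER]. rewrite EL, ER in Hz.
    pose proof (K (diag_u b4) _ T). apply Rabs_le. nra.
Qed.

Lemma ray_off_sides_not_quad_domain z (d : C) :
  d <> RtoC 0 -> (forall x, 0 <= x -> ~ on_sides b1 b2 b3 b4 (z + RtoC x * d)%C) ->
  ~ quad_domain b1 b2 b3 b4 z.
Proof.
  intros Hd Hray [_ [M HM]].
  pose proof (proj1 (Cmod_gt_0 d) Hd) as P.
  (* Travelling this far along the ray gives a point of modulus at least [|M| + 1]. *)
  set (T := (Rabs M + Cmod z + 1) / Cmod d).
  assert (HT : 0 <= T).
  { apply Rmult_le_pos; [|apply Rlt_le, Rinv_0_lt_compat, P].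
    pose proof (Rabs_pos M). pose proof (Cmod_ge_0 z). lra. }
  specialize (HM (fun t => z + RtoC (t * T) * d)%C).
  assert (HM' : Cmod (z + RtoC (1 * T) * d)%C <= M).
  { apply HM.
    - intros t _.
      apply (continuous_plus (V := C_R_NormedModule) (fun _ => z)); [apply continuous_const|].
      destruct d as [d1 d2].
      apply (continuous_ext (fun t => (t * (T * d1), t * (T * d2)) : C)).
      + intros x. unfold Cmult, RtoC; simpl. f_equal; ring.
      + apply continuous_pair; apply continuous_real_mult;
          (apply continuous_id || apply continuous_const).
    - rewrite Rmult_0_l, Cmult_0_l, Cplus_0_r. reflexivity.
    - intros t Ht. apply Hray. apply Rmult_le_pos; lra. }
  assert (Q : Cmod (RtoC (1 * T) * d)%C <= Cmod (z + RtoC (1 * T) * d)%C + Cmod z).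
  { replace (RtoC (1 * T) * d)%C with ((z + RtoC (1 * T) * d) + - z)%C at 1 by ring.
    eapply Rle_trans; [apply Cmod_triangle|]. rewrite Cmod_opp. lra. }
  rewrite Cmod_mult, Cmod_R, Rabs_pos_eq in Q by lra.
  replace (1 * T * Cmod d) with (Rabs M + Cmod z + 1) in Q by (unfold T; field; lra).
  pose proof (Rle_abs M). lra.
Qed.

Theorem quad_domain_diag z :
  quad_domain b1 b2 b3 b4 z <-> 0 < diag_gap z.
Proof.
  split.
  - intros Hz. apply Rnot_le_lt. intros Hgap.
    assert (Hs : ~ on_sides b1 b2 b3 b4 z) by apply Hz.
    assert (N : Cconj (b1 - b3) <> RtoC 0).
    { intros F. apply diagonal_neq_0. rewrite <- (Cconj_conj (b1 - b3)), F.
      unfold Cconj, RtoC; simpl; f_equal; ring. }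
    assert (N' : (/ Cconj (b1 - b3))%C <> RtoC 0).
    { intros E. apply C1_neq_0. rewrite <- (Cinv_r _ N), E. ring. }
    (* [1 / conj (b1 - b3)] is the vector that the similarity sends to a unit step along the
       diagonal. *)
    assert (Du : forall x, diag_u (z + RtoC x * / Cconj (b1 - b3)) = diag_u z + x).
    { intros x. unfold diag_u.
      replace ((z + RtoC x * / Cconj (b1 - b3) - b1) * Cconj (b1 - b3))%C
        with ((z - b1) * Cconj (b1 - b3) + RtoC x)%C by (field; exact N). reflexivity. }
    assert (Dv : forall x, diag_v (z + RtoC x * / Cconj (b1 - b3)) = diag_v z).
    { intros x. unfold diag_v.
      replace ((z + RtoC x * / Cconj (b1 - b3) - b1) * Cconj (b1 - b3))%C
        with ((z - b1) * Cconj (b1 - b3) + RtoC x)%C by (field; exact N).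
      unfold Im at 1. simpl. apply Rplus_0_r. }
    (* The ray points away from the quadrilateral: to the right beyond the right boundary, otherwise
       to the left. At heights outside the range of the sides either direction is free. *)
    assert (Hcase : (forall x, 0 <= x -> ~ on_sides b1 b2 b3 b4 (z + RtoC x * / Cconj (b1 - b3))%C) \/
                    (forall x, 0 <= x -> ~ on_sides b1 b2 b3 b4 (z + RtoC (- x) * / Cconj (b1 - b3))%C)).
    { rewrite on_sides_diag in Hs.
      destruct (Rle_dec (diag_v b4) (diag_v z)) as [H4|H4];
        [destruct (Rle_dec (diag_v z) (diag_v b2)) as [H2|H2]|].
      - pose proof (left_le_right (diag_v z) ltac:(lra)) as HLR.
        destruct (Rle_lt_dec (right_boundary (diag_v z)) (diag_u z)) as [HR|HR].
        + left. intros x Hx. rewrite on_sides_diag, Du, Dv. intros [_ E].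
          apply Hs. split; [lra|]. right. lra.
        + right. intros x Hx. rewrite on_sides_diag, Du, Dv. intros [_ E].
          apply Hs. split; [lra|]. left.
          assert (~ (left_boundary (diag_v z) < diag_u z)); [|lra].
          intros HL. assert (0 < diag_gap z) by (apply diag_gap_pos; lra). lra.
      - left. intros x Hx. rewrite on_sides_diag, Dv. lra.
      - left. intros x Hx. rewrite on_sides_diag, Dv. lra. }
    destruct Hcase as [Hray|Hray].
    + exact (ray_off_sides_not_quad_domain z _ N' Hray Hz).
    + apply (ray_off_sides_not_quad_domain z (- / Cconj (b1 - b3))%C); [| |exact Hz].
      * intros E. apply N'. transitivity (- - / Cconj (b1 - b3))%C; [ring|]. rewrite E. ring.
      * intros x Hx. replace (z + RtoC x * - / Cconj (b1 - b3))%C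
          with (z + RtoC (- x) * / Cconj (b1 - b3))%C by (rewrite RtoC_opp; ring). auto.
  - intros Hz. split.
    + rewrite on_sides_diag. apply diag_gap_pos in Hz. lra.
    (* A path off the sides cannot make [diag_gap] zero, so by the intermediate value theorem it
       ends where the gap is positive, which is a bounded region. *)
    + destruct diag_gap_pos_bounded as [M HM]. exists M. intros g Cg G0 Gs. apply HM.
      apply Rnot_le_lt. intros H1.
      assert (Hcont : forall t, 0 <= t <= 1 -> continuity_pt (fun t => - diag_gap (g t)) t).
      { intros t Ht. apply continuity_pt_filterlim.
        apply (continuous_opp (V := R_NormedModule) (fun t => diag_gap (g t))).
        apply (continuous_comp g diag_gap); [apply Cg, Ht|apply continuous_diag_gap]. }
      assert (Hs : forall t, 0 <= t <= 1 -> diag_gap (g t) <> 0)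
        by (intros t Ht E; apply (Gs t Ht), diag_gap_zero, E).
      destruct (Rle_lt_or_eq_dec _ _ H1) as [H1'|H1']; [|apply (Hs 1 ltac:(lra)); exact H1'].
      destruct (IVT_interv (fun t => - diag_gap (g t)) 0 1 Hcont) as [t [Ht E]];
        [lra|rewrite G0; lra|lra|].
      apply (Hs t Ht). lra.
Qed.

Lemma open_quad_domain : open (quad_domain b1 b2 b3 b4).
Proof.
  apply open_ext with (D := fun z => 0 < diag_gap z).
  - intros z. symmetry. apply quad_domain_diag.
  - apply open_positive, continuous_diag_gap.
Qed.

End Chart.

(** * Equations solved by monotonicity *)

Lemma is_derive_strictly_increasing (f df : R -> R) :
  (forall x, is_derive f x (df x)) -> (forall x, 0 < df x) -> forall x y, x < y -> f x < f y.
Proof.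
  intros Hf Hd x y Hxy.
  destruct (MVT_gen f x y df) as [c [_ E]].
  - intros t _. apply Hf.
  - intros t _. apply derivable_continuous_pt. eexists. apply is_derive_Reals, Hf.
  - specialize (Hd c). assert (0 < df c * (y - x)) by (apply Rmult_lt_0_compat; lra). lra.
Qed.

Lemma locally_lt (Q : UniformSpace) (a b : Q -> R) (q : Q) :
  continuous a q -> continuous b q -> a q < b q -> locally q (fun p => a p < b p).
Proof.
  intros Ha Hb H.
  assert (Cb : continuous (fun p => b p - a p) q)
    by (apply (continuous_minus (V := R_NormedModule)); assumption).
  assert (L : locally (b q - a q) (fun x => 0 < x)) by (apply open_gt; lra).
  pose proof (Cb _ L) as L'. unfold filtermap in L'. revert L'. apply filter_imp. intros p Hp. lra.
Qed.

(** The strict inequalities at [S q0 - eps] and [S q0 + eps] persist for nearby parameters and trap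
    the solution between them. Continuity of [H] in the parameter alone, at fixed [x], is therefore
    enough. *)
Lemma monotone_solution_continuous (Q : UniformSpace) (H : R -> Q -> R) (S v : Q -> R) (q0 : Q) :
  locally q0 (fun q => H (S q) q = v q /\ forall x y, x < y -> H x q < H y q) ->
  (forall x, continuous (H x) q0) -> continuous v q0 -> continuous S q0.
Proof.
  intros Hloc Hc Hv. pose proof (locally_singleton _ _ Hloc) as [E0 M0].
  apply filterlim_locally. intros eps.
  assert (A : locally q0 (fun q => H (S q0 - eps) q < v q)).
  { apply locally_lt; auto. rewrite <- E0. apply M0. pose proof (cond_pos eps). lra. }
  assert (B : locally q0 (fun q => v q < H (S q0 + eps) q)).
  { apply locally_lt; auto. rewrite <- E0. apply M0. pose proof (cond_pos eps). lra. }
  generalize (filter_and _ _ (filter_and _ _ A B) Hloc). apply filter_imp.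
  intros q [[Aq Bq] [Eq Mq]].
  assert (M' : forall x y, H x q < H y q -> x < y).
  { intros x y Hxy. apply Rnot_le_lt. intros [L|L]; [specialize (Mq _ _ L); lra|subst; lra]. }
  rewrite <- Eq in Aq, Bq. apply M' in Aq. apply M' in Bq.
  change (Rabs (S q - S q0) < eps). apply Rabs_def1; lra.
Qed.

Lemma IVT_decreasing (f : R -> R) (y a b : R) :
  (forall x, continuous f x) -> f b < y < f a -> exists x, f x = y.
Proof.
  intros Hf Hy. destruct (IVT_gen f a b y) as [x [_ E]].
  - intros x. apply continuity_pt_filterlim, Hf.
  - split; [eapply Rle_trans; [apply Rmin_r|lra]|eapply Rle_trans; [|apply Rmax_l]; lra].
  - exists x. exact E.
Qed.

(** * The map in hyperboloid coordinates *)

(** The arc cotangent of [l] divided by [PI], the form in which [arc_measure_atan] presents a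
    harmonic measure. *)
Definition side_measure (l : R) : R := / 2 - / PI * atan l.

Lemma side_measure_bounds l : 0 < side_measure l < 1.
Proof.
  unfold side_measure. pose proof (atan_bound l). pose proof PI_RGT_0.
  assert (- / 2 < / PI * atan l < / 2); [|lra].
  split; apply (Rmult_lt_reg_l PI); try lra; rewrite <- Rmult_assoc, Rinv_r by lra; lra.
Qed.

Lemma side_measure_opp l : side_measure (- l) = 1 - side_measure l.
Proof. unfold side_measure. rewrite atan_opp. field. pose proof PI_RGT_0; lra. Qed.

Lemma atan_le_id x : 0 <= x -> atan x <= x.
Proof.
  intros [H|<-]; [|rewrite atan_0; lra].
  destruct (MVT_gen atan 0 x (fun t => / (1 + t²))) as [t [_ E]].
  - intros t _. apply is_derive_atan.
  - intros t _. apply derivable_continuous_pt, derivable_pt_atan.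
  - rewrite atan_0 in E.
    assert (/ (1 + t²) <= 1).
    { rewrite <- Rinv_1. apply Rinv_le_contravar; [lra|]. pose proof (Rle_0_sqr t). lra. }
    nra.
Qed.

Lemma side_measure_le_inv l : 0 < l -> side_measure l <= / l.
Proof.
  intros H. pose proof PI_RGT_0. pose proof PI_4. pose proof PI2_1. unfold side_measure.
  pose proof (atan_inv l H) as E. pose proof (Rinv_0_lt_compat l H) as P.
  pose proof (atan_le_id (/ l) ltac:(lra)).
  replace (/ 2 - / PI * atan l) with (/ PI * atan (/ l)) by (rewrite E; field; lra).
  assert (/ PI <= 1) by (rewrite <- Rinv_1; apply Rinv_le_contravar; lra).
  assert (0 < / PI) by (apply Rinv_0_lt_compat; lra).
  assert (0 < atan (/ l)) by (rewrite <- atan_0; apply atan_increasing; exact P).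
  nra.
Qed.

Lemma side_measure_le l n : 0 < n -> n <= l -> side_measure l <= / n.
Proof.
  intros Hn Hl. eapply Rle_trans; [apply side_measure_le_inv; lra|].
  apply Rinv_le_contravar; lra.
Qed.

(** The third coordinate in the hyperboloid model of the hyperbolic plane, [T^2 - |P|^2 = 1]. *)
Definition hyp_T (P : C) : R := sqrt (1 + Re P ^ 2 + Im P ^ 2).

Lemma hyp_T_sqr P : hyp_T P ^ 2 = 1 + Re P ^ 2 + Im P ^ 2.
Proof.
  unfold hyp_T. apply pow2_sqrt. pose proof (pow2_ge_0 (Re P)). pose proof (pow2_ge_0 (Im P)). lra.
Qed.

Lemma hyp_T_pos P : 0 < hyp_T P.
Proof.
  unfold hyp_T. apply sqrt_lt_R0. pose proof (pow2_ge_0 (Re P)). pose proof (pow2_ge_0 (Im P)). lra.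
Qed.

Lemma hyp_T_bounds P : Rabs (Re P) < hyp_T P /\ Rabs (Im P) < hyp_T P.
Proof.
  pose proof (hyp_T_sqr P). pose proof (hyp_T_pos P).
  pose proof (pow2_ge_0 (Re P)). pose proof (pow2_ge_0 (Im P)).
  split; apply Rabs_def1; nra.
Qed.

Lemma class_C_hyp_T n : class_C n (fun _ => True) hyp_T.
Proof.
  assert (O : open (fun _ : C => True)) by apply open_true.
  assert (C0 : forall P, continuous hyp_T P).
  { intros P. apply (continuous_real_comp _ (fun P : C => 1 + Re P ^ 2 + Im P ^ 2) sqrt).
    - apply (continuous_ext (fun P : C => 1 + (Re P ^ 2 + Im P ^ 2))); [intros w; simpl; ring|].
      apply continuous_real_plus; [apply continuous_const|apply continuous_norm_sqr].
    - apply continuous_sqrt. }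
  induction n as [|n IH]; [split; auto|].
  apply (class_C_S _ O n _ (fun P => Re P / hyp_T P) (fun P => Im P / hyp_T P)).
  - auto.
  - intros P _. unfold hyp_T. simpl. pose proof (hyp_T_pos P) as HT. unfold hyp_T in HT.
    auto_derive.
    + pose proof (pow2_ge_0 (Re P)). pose proof (pow2_ge_0 (Im P)). simpl in *. lra.
    + simpl in HT. field. lra.
  - intros P _. unfold hyp_T. simpl. pose proof (hyp_T_pos P) as HT. unfold hyp_T in HT.
    auto_derive.
    + pose proof (pow2_ge_0 (Re P)). pose proof (pow2_ge_0 (Im P)). simpl in *. lra.
    + simpl in HT. field. lra.
  - apply (class_C_div _ O); [intros; pose proof (hyp_T_pos z); lra|apply class_C_Re, O|exact IH].
  - apply (class_C_div _ O); [intros; pose proof (hyp_T_pos z); lra|apply class_C_Im, O|exact IH].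
Qed.

Lemma class_C_atan U u n : open U -> class_C n U u -> class_C n U (fun z => atan (u z)).
Proof.
  intros O. induction n as [|n IH]; intros Cu.
  - split; [|exact I]. intros z Uz. apply (continuous_real_comp _ u atan); [apply Cu, Uz|].
    apply ex_derive_continuous_real. eexists. apply is_derive_atan.
  - pose proof Cu as [H1 [H2 [H3 H4]]]. pose proof (class_C_le _ _ _ Cu) as Cn.
    assert (D : class_C n U (fun z => 1 + u z * u z)).
    { apply (class_C_plus _ O); [apply class_C_const, O|apply (class_C_mult _ O); assumption]. }
    assert (N : forall z, U z -> 1 + u z * u z <> 0)
      by (intros z _; pose proof (Rle_0_sqr (u z)); unfold Rsqr in *; lra).
    apply (class_C_S _ O n _ (fun z => dx u z / (1 + u z * u z)) (fun z => dy u z / (1 + u z * u z))).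
    + intros z Uz. apply (continuous_real_comp _ u atan); [apply Cu, Uz|].
      apply ex_derive_continuous_real. eexists. apply is_derive_atan.
    + intros [x y] Uz.
      apply (is_derive_comp (V := R_NormedModule) atan (fun t => u (t, y)));
        [apply is_derive_atan|apply (is_derive_dx u (x, y)); auto].
    + intros [x y] Uz.
      apply (is_derive_comp (V := R_NormedModule) atan (fun t => u (x, t)));
        [apply is_derive_atan|apply (is_derive_dy u (x, y)); auto].
    + apply (class_C_div _ O); assumption.
    + apply (class_C_div _ O); assumption.
Qed.

(* With [c = cos (p / 2)] and [s = sin (p / 2)], [mu1], ..., [mu4] are the
   harmonic measures of the arcs carrying [b1], ..., [b4], in the hyperboloid
   coordinates [P = 2 exp (- i p / 2) z / (1 - |z|^2)], for which
   [hyp_T P = (1 + |z|^2) / (1 - |z|^2)]. *)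
Definition mu1 (c s : R) (P : C) : R := side_measure ((s * hyp_T P - Im P) / c).
Definition mu2 (c s : R) (P : C) : R := side_measure ((c * hyp_T P + Re P) / s).
Definition mu3 (c s : R) (P : C) : R := side_measure ((s * hyp_T P + Im P) / c).
Definition mu4 (c s : R) (P : C) : R := side_measure ((c * hyp_T P - Re P) / s).

Lemma class_C_side_measure a b c d n :
  d <> 0 -> class_C n (fun _ => True)
    (fun P => side_measure ((a * hyp_T P + b * Re P + c * Im P) / d)).
Proof.
  intros Hd. assert (O : open (fun _ : C => True)) by apply open_true.
  apply (class_C_minus _ O); [apply class_C_const, O|].
  apply (class_C_mult _ O); [apply class_C_const, O|].
  apply (class_C_atan _ (fun P => (a * hyp_T P + b * Re P + c * Im P) / d) n O).
  apply (class_C_div _ O); [auto| |apply class_C_const, O].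
  repeat apply (class_C_plus _ O); apply (class_C_mult _ O);
    (apply class_C_const, O) || apply class_C_hyp_T || (apply class_C_Re, O) || (apply class_C_Im, O).
Qed.

Lemma class_C_mu c s n : 0 < c -> 0 < s ->
  class_C n (fun _ => True) (mu1 c s) /\ class_C n (fun _ => True) (mu2 c s) /\
  class_C n (fun _ => True) (mu3 c s) /\ class_C n (fun _ => True) (mu4 c s).
Proof.
  intros Hc Hs. assert (O : open (fun _ : C => True)) by apply open_true.
  assert (K : forall a b e d, d <> 0 -> forall u, (forall P, u P = (a * hyp_T P + b * Re P + e * Im P) / d) ->
    class_C n (fun _ => True) (fun P => side_measure (u P))).
  { intros a b e d Hd u Hu.
    apply (class_C_ext _ O n (fun P => side_measure ((a * hyp_T P + b * Re P + e * Im P) / d))).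
    - intros P _. rewrite Hu. reflexivity.
    - apply class_C_side_measure, Hd. }
  repeat split.
  - apply (K s 0 (-1) c); [lra|]. intros; f_equal; ring.
  - apply (K c 1 0 s); [lra|]. intros; f_equal; ring.
  - apply (K s 0 1 c); [lra|]. intros; f_equal; ring.
  - apply (K c (-1) 0 s); [lra|]. intros; f_equal; ring.
Qed.

Lemma is_derive_hyp_T x y : is_derive (fun t => hyp_T (t, y)) x (x / hyp_T (x, y)).
Proof.
  pose proof (hyp_T_pos (x, y)) as HT. unfold hyp_T in *; simpl in *.
  auto_derive; [pose proof (pow2_ge_0 x); pose proof (pow2_ge_0 y); simpl in *; lra|].
  field. lra.
Qed.

Lemma is_derive_mu2 c s x y : 0 < s ->
  is_derive (fun t => mu2 c s (t, y)) x
    (- (c * x / hyp_T (x, y) + 1) / (s * PI * (1 + ((c * hyp_T (x, y) + x) / s) ^ 2))).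
Proof.
  intros Hs. pose proof (hyp_T_pos (x, y)) as HT. pose proof (is_derive_hyp_T x y) as HD.
  pose proof PI_RGT_0.
  unfold mu2, side_measure. simpl. set (T := fun t => hyp_T (t, y)) in *.
  apply (is_derive_ext (fun t => / 2 - / PI * atan ((c * T t + t) / s))); [reflexivity|].
  pose proof (pow2_ge_0 ((c * T x + x) / s)).
  auto_derive; [eexists; exact HD|].
  rewrite (is_derive_unique (fun t : R => T t) _ _ HD). unfold Rsqr.
  change (hyp_T (x, y)) with (T x) in *. simpl in *.
  assert (0 < s * s + (c * T x + x) * (c * T x + x))
    by (pose proof (Rle_0_sqr (c * T x + x)) as Q; unfold Rsqr in Q; assert (0 < s * s) by nra; lra).
  field. repeat split; lra.
Qed.

Lemma is_derive_mu4 c s x y : 0 < s ->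
  is_derive (fun t => mu4 c s (t, y)) x
    (- (c * x / hyp_T (x, y) - 1) / (s * PI * (1 + ((c * hyp_T (x, y) - x) / s) ^ 2))).
Proof.
  intros Hs. pose proof (hyp_T_pos (x, y)) as HT. pose proof (is_derive_hyp_T x y) as HD.
  pose proof PI_RGT_0.
  unfold mu4, side_measure. simpl. set (T := fun t => hyp_T (t, y)) in *.
  apply (is_derive_ext (fun t => / 2 - / PI * atan ((c * T t - t) / s))); [reflexivity|].
  pose proof (pow2_ge_0 ((c * T x - x) / s)).
  auto_derive; [eexists; exact HD|].
  rewrite (is_derive_unique (fun t : R => T t) _ _ HD). unfold Rsqr.
  change (hyp_T (x, y)) with (T x) in *. simpl in *.
  assert (0 < s * s + (c * T x - x) * (c * T x - x))
    by (pose proof (Rle_0_sqr (c * T x - x)) as Q; unfold Rsqr in Q; assert (0 < s * s) by nra; lra).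
  field. repeat split; lra.
Qed.

(* Near an end of a level curve of [v2 x2 + v4 x4] one of the weights [x2], [x4]
   tends to [0], and the sign of the level decides which. *)
Lemma small_combination (a m a2 a4 v2 v4 x2 x4 eta : R) :
  v4 < 0 < v2 -> 0 < x2 -> 0 < x4 -> 0 < m <= eta -> (x2 <= eta \/ x4 <= eta) ->
  Rabs (a * m + a2 * x2 + a4 * x4 -
        (a2 * (pos_part (v2 * x2 + v4 * x4) / v2) + a4 * (pos_part (- (v2 * x2 + v4 * x4)) / - v4)))
  <= (Rabs a + Rabs (a4 - a2 * v4 / v2) + Rabs (a2 - a4 * v2 / v4)) * (1 + v2 / - v4 + - v4 / v2) * eta.
Proof.
  intros Hv H2 H4 Hm Hx.
  assert (Q1 : 0 < v2 / - v4) by (apply Rdiv_lt_0_compat; lra).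
  assert (Q2 : 0 < - v4 / v2) by (apply Rdiv_lt_0_compat; lra).
  assert (A1 : v2 / - v4 * - v4 = v2) by (field; lra).
  assert (A2 : - v4 / v2 * v2 = - v4) by (field; lra).
  set (q1 := v2 / - v4) in *. set (q2 := - v4 / v2) in *.
  pose proof (Rabs_pos a). pose proof (Rabs_pos (a4 - a2 * v4 / v2)).
  pose proof (Rabs_pos (a2 - a4 * v2 / v4)).
  unfold pos_part.
  assert (Bm : Rabs (a * m) <= Rabs a * ((1 + q1 + q2) * eta)).
  { rewrite Rabs_mult, (Rabs_pos_eq m) by lra. apply Rmult_le_compat_l; [lra|]. nra. }
  destruct (Rle_lt_dec 0 (v2 * x2 + v4 * x4)) as [V0|V0].
  - rewrite (Rmax_right 0 (_ + _)), (Rmax_left 0 (- _)) by lra.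
    replace (_ - _) with (a * m + (a4 - a2 * v4 / v2) * x4) by (field; lra).
    assert (x4 <= (1 + q1 + q2) * eta).
    { destruct Hx; [|nra]. assert (x4 <= q1 * x2); [|nra].
      apply (Rmult_le_reg_r (- v4)); [lra|]. replace (q1 * x2 * - v4) with (v2 * x2) by (rewrite <- A1; ring). lra. }
    eapply Rle_trans; [apply Rabs_triang|].
    rewrite (Rabs_mult _ x4), (Rabs_pos_eq x4) by lra.
    assert (Rabs (a4 - a2 * v4 / v2) * x4 <= Rabs (a4 - a2 * v4 / v2) * ((1 + q1 + q2) * eta))
      by (apply Rmult_le_compat_l; lra).
    assert (0 <= Rabs (a2 - a4 * v2 / v4) * ((1 + q1 + q2) * eta)) by (apply Rmult_le_pos; nra).
    lra.
  - rewrite (Rmax_left 0 (_ + _)), (Rmax_right 0 (- _)) by lra.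
    replace (_ - _) with (a * m + (a2 - a4 * v2 / v4) * x2) by (field; lra).
    assert (x2 <= (1 + q1 + q2) * eta).
    { destruct Hx; [nra|]. assert (x2 <= q2 * x4); [|nra].
      apply (Rmult_le_reg_r v2); [lra|]. replace (q2 * x4 * v2) with (- v4 * x4) by (rewrite <- A2; ring). lra. }
    eapply Rle_trans; [apply Rabs_triang|].
    rewrite (Rabs_mult _ x2), (Rabs_pos_eq x2) by lra.
    assert (Rabs (a2 - a4 * v2 / v4) * x2 <= Rabs (a2 - a4 * v2 / v4) * ((1 + q1 + q2) * eta))
      by (apply Rmult_le_compat_l; lra).
    assert (0 <= Rabs (a4 - a2 * v4 / v2) * ((1 + q1 + q2) * eta)) by (apply Rmult_le_pos; nra).
    lra.
Qed.

Definition hyp_map (b1 b2 b3 b4 : C) (c s : R) (P : C) : C :=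
  (RtoC (mu1 c s P) * b1 + RtoC (mu2 c s P) * b2 + RtoC (mu3 c s P) * b3 + RtoC (mu4 c s P) * b4)%C.

(** * Level curves and bijectivity onto the quadrilateral *)

Section Core.

Variables (b1 b2 b3 b4 : C) (c s : R).
Hypothesis Hsep : separating_diagonal b1 b2 b3 b4.
Hypothesis Hc : 0 < c < 1.
Hypothesis Hs : 0 < s < 1.
Hypothesis Hsum : forall P, mu1 c s P + mu2 c s P + mu3 c s P + mu4 c s P = 1.

Let u2 := diag_u b1 b3 b2.
Let u3 := diag_u b1 b3 b3.
Let u4 := diag_u b1 b3 b4.
Let v2 := diag_v b1 b3 b2.
Let v4 := diag_v b1 b3 b4.

(** The similarity sends [b1] to 0 and the diagonal to the real axis. Hence no term in [mu1] occurs
    here and none in [mu1] or [mu3] in [hyp_v]. *)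
Definition hyp_u (P : C) : R := diag_u b1 b3 b2 * mu2 c s P + diag_u b1 b3 b3 * mu3 c s P + diag_u b1 b3 b4 * mu4 c s P.
Definition hyp_v (P : C) : R := diag_v b1 b3 b2 * mu2 c s P + diag_v b1 b3 b4 * mu4 c s P.

Hypothesis HJ : forall P, 0 < dx hyp_u P * dy hyp_v P - dy hyp_u P * dx hyp_v P.

Let Hv2 : 0 < v2.
Proof. exact (diag_v_b2_pos b1 b2 b3 b4 Hsep). Qed.

Let Hv4 : v4 < 0.
Proof. exact (diag_v_b4_neg b1 b2 b3 b4 Hsep). Qed.

Lemma diag_hyp_map P :
  diag_u b1 b3 (hyp_map b1 b2 b3 b4 c s P) = hyp_u P /\
  diag_v b1 b3 (hyp_map b1 b2 b3 b4 c s P) = hyp_v P.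
Proof.
  unfold hyp_map, hyp_u, hyp_v. specialize (Hsum P).
  replace (mu1 c s P) with (1 - mu2 c s P - mu3 c s P - mu4 c s P) by lra.
  unfold diag_u, diag_v, Cconj, Cminus, Copp, Cplus, Cmult, RtoC, Re, Im; simpl.
  split; ring.
Qed.

Let O : open (fun _ : C => True).
Proof. apply open_true. Qed.

Lemma class_C_hyp n : class_C n (fun _ => True) hyp_u /\ class_C n (fun _ => True) hyp_v.
Proof.
  destruct (class_C_mu c s n) as [C1 [C2 [C3 C4]]]; [lra|lra|].
  unfold hyp_u, hyp_v.
  split; repeat apply (class_C_plus _ O); apply (class_C_mult _ O);
    (apply class_C_const, O) || assumption.
Qed.

Lemma continuous_hyp_u P : continuous hyp_u P.
Proof. apply (class_C_continuous 0 (fun _ => True)); [apply class_C_hyp|exact I]. Qed.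

Lemma continuous_hyp_v P : continuous hyp_v P.
Proof. apply (class_C_continuous 0 (fun _ => True)); [apply class_C_hyp|exact I]. Qed.

Lemma has_gradient_hyp_u P : has_gradient hyp_u P (dx hyp_u P) (dy hyp_u P).
Proof. apply (class_C_gradient _ O); [apply class_C_hyp|exact I]. Qed.

Lemma has_gradient_hyp_v P : has_gradient hyp_v P (dx hyp_v P) (dy hyp_v P).
Proof. apply (class_C_gradient _ O); [apply class_C_hyp|exact I]. Qed.

(** Since [|c * Re P| < T], moving to the right strictly decreases [mu2] and increases [mu4]. Their
    weights in [hyp_v] have opposite signs, so both contributions are negative. *)
Lemma dx_hyp_v_neg P : dx hyp_v P < 0.
Proof.
  destruct P as [x y]. pose proof (hyp_T_pos (x, y)) as HT.
  pose proof (hyp_T_bounds (x, y)) as [HB _]. simpl in HB. apply Rabs_def2 in HB. simpl in HB.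
  assert (E : is_derive (fun t => hyp_v (t, y)) x
    (v2 * (- (c * x / hyp_T (x, y) + 1) / (s * PI * (1 + ((c * hyp_T (x, y) + x) / s) ^ 2))) +
     v4 * (- (c * x / hyp_T (x, y) - 1) / (s * PI * (1 + ((c * hyp_T (x, y) - x) / s) ^ 2))))).
  { apply (is_derive_plus (V := R_NormedModule) (fun t => v2 * mu2 c s (t, y)) (fun t => v4 * mu4 c s (t, y)));
      apply is_derive_scal; [apply is_derive_mu2|apply is_derive_mu4]; lra. }
  match type of E with is_derive _ _ ?l => assert (E' : dx hyp_v (x, y) = l) end.
  { apply is_derive_unique. exact E. }
  rewrite E'. pose proof PI_RGT_0.
  set (T := hyp_T (x, y)) in *.
  assert (X : -1 < c * x / T < 1).
  { split; apply (Rmult_lt_reg_r T); try lra; field_simplify; try lra; nra. }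
  pose proof (pow2_ge_0 ((c * T + x) / s)). pose proof (pow2_ge_0 ((c * T - x) / s)).
  assert (D1 : 0 < (c * x / T + 1) / (s * PI * (1 + ((c * T + x) / s) ^ 2))).
  { apply Rdiv_lt_0_compat; [lra|]. apply Rmult_lt_0_compat; [|lra]. apply Rmult_lt_0_compat; lra. }
  assert (D2 : 0 < (1 - c * x / T) / (s * PI * (1 + ((c * T - x) / s) ^ 2))).
  { apply Rdiv_lt_0_compat; [lra|]. apply Rmult_lt_0_compat; [|lra]. apply Rmult_lt_0_compat; lra. }
  replace (- (c * x / T + 1) / (s * PI * (1 + ((c * T + x) / s) ^ 2))) with
    (- ((c * x / T + 1) / (s * PI * (1 + ((c * T + x) / s) ^ 2)))) by (unfold Rdiv; ring).
  replace (- (c * x / T - 1) / (s * PI * (1 + ((c * T - x) / s) ^ 2))) with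
    ((1 - c * x / T) / (s * PI * (1 + ((c * T - x) / s) ^ 2))) by (unfold Rdiv; ring).
  nra.
Qed.

Lemma hyp_v_decreasing y x x' : x < x' -> hyp_v (x', y) < hyp_v (x, y).
Proof.
  intros H. assert (- hyp_v (x, y) < - hyp_v (x', y)); [|lra].
  apply (is_derive_strictly_increasing (fun t => - hyp_v (t, y)) (fun t => - dx hyp_v (t, y))); [| |exact H].
  - intros t. apply (is_derive_opp (V := R_NormedModule)).
    apply (has_gradient_dx hyp_v (t, y) _ _ (has_gradient_hyp_v (t, y))).
  - intros t. pose proof (dx_hyp_v_neg (t, y)). lra.
Qed.

Lemma hyp_v_bounds P : v4 < hyp_v P < v2.
Proof.
  unfold hyp_v. fold v2 v4.
  pose proof (side_measure_bounds ((s * hyp_T P - Im P) / c)). fold (mu1 c s P) in H.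
  pose proof (side_measure_bounds ((c * hyp_T P + Re P) / s)). fold (mu2 c s P) in H0.
  pose proof (side_measure_bounds ((s * hyp_T P + Im P) / c)). fold (mu3 c s P) in H1.
  pose proof (side_measure_bounds ((c * hyp_T P - Re P) / s)). fold (mu4 c s P) in H2.
  split; nra.
Qed.

Lemma hyp_T_le P : hyp_T P <= 1 + Rabs (Re P) + Rabs (Im P).
Proof.
  pose proof (hyp_T_sqr P) as E. pose proof (hyp_T_pos P).
  pose proof (Rabs_pos (Re P)). pose proof (Rabs_pos (Im P)).
  assert (Re P ^ 2 = Rabs (Re P) ^ 2) by (rewrite <- !Rsqr_pow2; apply Rsqr_abs).
  assert (Im P ^ 2 = Rabs (Im P) ^ 2) by (rewrite <- !Rsqr_pow2; apply Rsqr_abs).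
  nra.
Qed.

(** The abscissa comes from [T <= 1 + x + |y|]: then [x - c * T] is at least
    [(1 - c) * x - c * (1 + |y|)], hence at least [n], and dividing by [s < 1] only enlarges it. *)
Lemma far_ratio (n y x : R) :
  0 < n -> (n + c * (1 + Rabs y)) / (1 - c) <= x ->
  n <= (c * hyp_T (x, y) + x) / s /\ (c * hyp_T (x, y) - x) / s <= - n /\
  n <= (c * hyp_T (- x, y) - - x) / s /\ (c * hyp_T (- x, y) + - x) / s <= - n.
Proof.
  intros Hn Hx. pose proof (Rabs_pos y).
  assert (Hx' : n + c * (1 + Rabs y) <= x * (1 - c)).
  { apply (Rmult_le_compat_r (1 - c)) in Hx; [|lra].
    replace ((n + c * (1 + Rabs y)) / (1 - c) * (1 - c)) with (n + c * (1 + Rabs y)) in Hx by (field; lra).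
    exact Hx. }
  assert (X0 : 0 < x) by nra.
  assert (ET : hyp_T (- x, y) = hyp_T (x, y)).
  { unfold hyp_T; simpl. f_equal. ring. }
  rewrite ET. pose proof (hyp_T_le (x, y)) as HT. simpl in HT. rewrite (Rabs_pos_eq x) in HT by lra.
  pose proof (hyp_T_pos (x, y)).
  assert (A : n <= (c * hyp_T (x, y) + x) / s).
  { apply (Rmult_le_reg_r s); [lra|]. replace ((c * hyp_T (x, y) + x) / s * s) with (c * hyp_T (x, y) + x) by (field; lra).
    nra. }
  assert (B : (c * hyp_T (x, y) - x) / s <= - n).
  { apply (Rmult_le_reg_r s); [lra|]. replace ((c * hyp_T (x, y) - x) / s * s) with (c * hyp_T (x, y) - x) by (field; lra).
    nra. }
  split; [exact A|]. split; [exact B|]. split.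
  - replace (c * hyp_T (x, y) - - x) with (c * hyp_T (x, y) + x) by ring. exact A.
  - exact B.
Qed.

Lemma hyp_v_onto y v : v4 < v < v2 -> exists x, hyp_v (x, y) = v.
Proof.
  intros Hv.
  (* At the far ends of the line [hyp_v] is within [(v2 - v4) / n] of [v4] or of [v2]; this [n]
     makes that less than the distance from [v] to either. *)
  set (n := (v2 - v4) / Rmin (v - v4) (v2 - v) + 1).
  assert (Hm : 0 < Rmin (v - v4) (v2 - v)) by (apply Rmin_glb_lt; lra).
  assert (Hn0 : 0 < (v2 - v4) / Rmin (v - v4) (v2 - v)) by (apply Rdiv_lt_0_compat; lra).
  assert (Hn : 0 < n) by (unfold n; lra).
  assert (Hin : / n * (v2 - v4) < Rmin (v - v4) (v2 - v)).
  { apply (Rmult_lt_reg_l n); [exact Hn|]. rewrite <- Rmult_assoc, Rinv_r by lra.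
    unfold n. set (m := Rmin (v - v4) (v2 - v)) in *.
    replace (((v2 - v4) / m + 1) * m) with (v2 - v4 + m) by (field; lra). lra. }
  pose proof (Rmin_l (v - v4) (v2 - v)). pose proof (Rmin_r (v - v4) (v2 - v)).
  pose proof (Rinv_0_lt_compat n Hn).
  destruct (far_ratio n y _ Hn (Rle_refl _)) as [F1 [F2 [F3 F4]]].
  set (x := (n + c * (1 + Rabs y)) / (1 - c)) in *.
  assert (S : forall l, l <= - n -> 1 - / n <= side_measure l).
  { intros l Hl. rewrite <- (Ropp_involutive l), side_measure_opp.
    pose proof (side_measure_le (- l) n Hn ltac:(lra)). lra. }
  apply (IVT_decreasing (fun x => hyp_v (x, y)) v (- x) x).
  - intros t. apply (continuous_comp (fun t => (t, y) : C) hyp_v); [|apply continuous_hyp_v].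
    apply continuous_pair; [apply continuous_id|apply continuous_const].
  - unfold hyp_v. fold v2 v4. split.
    + pose proof (side_measure_le _ _ Hn F1) as A. pose proof (S _ F2) as B.
      fold (mu2 c s (x, y)) in A. fold (mu4 c s (x, y)) in B.
      change (mu2 c s (x, y) <= / n) in A. change (1 - / n <= mu4 c s (x, y)) in B.
      nra.
    + pose proof (side_measure_le _ _ Hn F3) as A. pose proof (S _ F4) as B.
      change (mu4 c s (- x, y) <= / n) in A. change (1 - / n <= mu2 c s (- x, y)) in B.
      nra.
Qed.

(* [level (v, y)] is the abscissa of the point of the level curve [hyp_v = v]
   at height [y]. *)
Definition level (w : C) : R := epsilon (inhabits 0) (fun x => hyp_v (x, Im w) = Re w).

Lemma level_spec w : v4 < Re w < v2 -> hyp_v (level w, Im w) = Re w.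
Proof.
  intros H.
  exact (epsilon_spec (inhabits 0) (fun x => hyp_v (x, Im w) = Re w) (hyp_v_onto (Im w) (Re w) H)).
Qed.

Lemma level_unique x y : level (hyp_v (x, y), y) = x.
Proof.
  pose proof (level_spec (hyp_v (x, y), y) (hyp_v_bounds _)) as E. simpl in E.
  destruct (Rtotal_order (level (hyp_v (x, y), y)) x) as [L|[L|L]]; auto;
    apply (hyp_v_decreasing y) in L; lra.
Qed.

Lemma locally_strip (w : C) : v4 < Re w < v2 -> locally w (fun q : C => v4 < Re q < v2).
Proof.
  intros [H1 H2].
  generalize (filter_and _ _
    (locally_lt C_UniformSpace (fun _ => v4) Re w (continuous_const _ _) (continuous_Re _) H1)
    (locally_lt C_UniformSpace Re (fun _ => v2) w (continuous_Re _) (continuous_const _ _) H2)).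
  apply filter_imp. auto.
Qed.

Lemma continuous_level w : v4 < Re w < v2 -> continuous level w.
Proof.
  intros Hw.
  apply (monotone_solution_continuous C_UniformSpace (fun x q => - hyp_v (x, Im q)) level (fun q => - Re q)).
  - generalize (locally_strip w Hw). apply filter_imp. intros q Hq. split.
    + rewrite (level_spec q Hq). reflexivity.
    + intros x y Hxy. apply (hyp_v_decreasing (Im q)) in Hxy. lra.
  - intros x. apply (continuous_opp (V := R_NormedModule) (fun q : C => hyp_v (x, Im q))).
    apply (continuous_comp (fun q : C => (x, Im q) : C) hyp_v); [|apply continuous_hyp_v].
    apply continuous_pair; [apply continuous_const|apply continuous_Im].
  - apply (continuous_opp (V := R_NormedModule)), continuous_Re.
Qed.

Definition level_u (w : C) : R := hyp_u (level w, Im w).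

Lemma continuous_level_u w : v4 < Re w < v2 -> continuous level_u w.
Proof.
  intros Hw. apply (continuous_comp (fun q : C => (level q, Im q) : C) hyp_u); [|apply continuous_hyp_u].
  apply continuous_pair; [apply continuous_level, Hw|apply continuous_Im].
Qed.

(* The derivative along a level curve of [hyp_v] is the Jacobian divided by
   [- dx hyp_v]. *)
Lemma level_u_increasing v y y' : v4 < v < v2 -> y < y' -> level_u (v, y) < level_u (v, y').
Proof.
  intros Hv.
  apply (is_derive_strictly_increasing (fun t => level_u (v, t))
    (fun t => (dx hyp_u (level (v, t), t) * dy hyp_v (level (v, t), t) -
               dy hyp_u (level (v, t), t) * dx hyp_v (level (v, t), t)) / - dx hyp_v (level (v, t), t))).
  - intros t. set (P := (level (v, t), t) : C). pose proof (dx_hyp_v_neg P) as N.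
    assert (GI : forall w : C, has_gradient Im w 0 1).
    { intros w. replace 0 with (dx Im w); [replace 1 with (dy Im w)|].
      - apply (class_C_gradient _ O); [apply class_C_Im, O|exact I].
      - apply is_derive_unique, (is_derive_id (K := R_AbsRing)).
      - apply is_derive_unique, (is_derive_const (V := R_NormedModule) (Im w) (Re w)). }
    (* [(level, Im)] is a right inverse of [(hyp_v, Im)], whose determinant is [dx hyp_v P]: the
       implicit function theorem for the level curve. *)
    destruct (has_gradient_inverse hyp_v Im level Im (v, t) (dx hyp_v P) (dy hyp_v P) 0 1) as [G _].
    + apply has_gradient_hyp_v.
    + apply GI.
    + lra.
    + apply continuous_level, Hv.
    + apply continuous_Im.
    + generalize (locally_strip (v, t) Hv). apply filter_imp. intros q Hq. split; [|reflexivity].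
      apply level_spec, Hq.
    + pose proof (has_gradient_comp hyp_u level Im (v, t) _ _ _ _ _ _
        (has_gradient_hyp_u P) G (GI (v, t))) as G2.
      apply has_gradient_dy in G2.
      evar_last; [exact G2|].
      rewrite Rmult_1_r, Rmult_0_r, Rminus_0_r. change (level (v, t), t) with P. field. lra.
  - intros t. pose proof (dx_hyp_v_neg (level (v, t), t)).
    apply Rdiv_lt_0_compat; [apply HJ|lra].
Qed.

(** High up, the weight of [b3] is small, and the sign of [x] decides which of [mu2] and [mu4] is
    small as well. The bounds do not depend on [x], so they apply along a level curve whose abscissa
    is not known. *)
Lemma small_measure_right n y x :
  0 < n -> n <= y -> mu3 c s (x, y) <= / n /\ (mu2 c s (x, y) <= / (c * n) \/ mu4 c s (x, y) <= / (c * n)).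
Proof.
  intros Hn Hy. pose proof (hyp_T_bounds (x, y)) as [_ HB]. simpl in HB.
  rewrite Rabs_pos_eq in HB by lra. set (T := hyp_T (x, y)) in *.
  assert (D : forall d a b, 0 < d < 1 -> 0 <= b -> b <= a -> b <= a / d).
  { intros d a b Hd Hb Hab. apply (Rmult_le_reg_r d); [lra|].
    replace (a / d * d) with a by (field; lra). nra. }
  split.
  - apply side_measure_le; [exact Hn|]. simpl. apply D; [exact Hc|lra|]. fold T. nra.
  - assert (0 < c * n) by nra.
    destruct (Rle_lt_dec 0 x); [left|right]; (apply side_measure_le; [lra|]); simpl; fold T;
      (apply D; [exact Hs|lra|nra]).
Qed.

Lemma small_measure_left n y x :
  0 < n -> n <= - y -> mu1 c s (x, y) <= / n /\ (mu2 c s (x, y) <= / (c * n) \/ mu4 c s (x, y) <= / (c * n)).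
Proof.
  intros Hn Hy. pose proof (hyp_T_bounds (x, y)) as [_ HB]. simpl in HB.
  rewrite Rabs_left in HB by lra. set (T := hyp_T (x, y)) in *.
  assert (D : forall d a b, 0 < d < 1 -> 0 <= b -> b <= a -> b <= a / d).
  { intros d a b Hd Hb Hab. apply (Rmult_le_reg_r d); [lra|].
    replace (a / d * d) with a by (field; lra). nra. }
  split.
  - apply side_measure_le; [exact Hn|]. simpl. apply D; [exact Hc|lra|]. fold T. nra.
  - assert (0 < c * n) by nra.
    destruct (Rle_lt_dec 0 x); [left|right]; (apply side_measure_le; [lra|]); simpl; fold T;
      (apply D; [exact Hs|lra|nra]).
Qed.

Lemma mu_pos P : 0 < mu1 c s P /\ 0 < mu2 c s P /\ 0 < mu3 c s P /\ 0 < mu4 c s P.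
Proof. unfold mu1, mu2, mu3, mu4. repeat split; apply side_measure_bounds. Qed.

Lemma exists_small_inv (K eps : R) : 0 <= K -> 0 < eps -> exists n, 0 < n /\ K * / (c * n) < eps.
Proof.
  intros HK He. exists ((K + 1) / (c * eps)). assert (0 < c * eps) by (apply Rmult_lt_0_compat; lra).
  split; [apply Rdiv_lt_0_compat; lra|].
  replace (K * / (c * ((K + 1) / (c * eps)))) with (K / (K + 1) * eps) by (field; lra).
  assert (K / (K + 1) < 1); [|nra].
  apply (Rmult_lt_reg_r (K + 1)); [lra|]. field_simplify; lra.
Qed.

(** Only [b1] and one of [b2], [b4] keep weight in the limit, so the image approaches a side at
    [b1], at the height given by [hyp_v]. *)
Lemma hyp_u_right_limit eps :
  0 < eps -> exists n, 0 < n /\ forall x y, n <= y ->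
    Rabs (hyp_u (x, y) - right_boundary b1 b2 b3 b4 (hyp_v (x, y))) < eps.
Proof.
  intros He.
  set (K := (Rabs u3 + Rabs (u4 - u2 * v4 / v2) + Rabs (u2 - u4 * v2 / v4)) * (1 + v2 / - v4 + - v4 / v2)).
  destruct (exists_small_inv (Rabs K) eps (Rabs_pos _) He) as [n [Hn Hk]].
  exists n. split; [exact Hn|]. intros x y Hy.
  destruct (small_measure_right n y x Hn Hy) as [A B].
  pose proof (mu_pos (x, y)) as [P1 [P2 [P3 P4]]].
  assert (A' : mu3 c s (x, y) <= / (c * n)).
  { eapply Rle_trans; [exact A|]. apply Rinv_le_contravar; nra. }
  assert (Hv : v4 < 0 < v2) by (split; assumption).
  pose proof (small_combination u3 (mu3 c s (x, y)) u2 u4 v2 v4 _ _ _ Hv P2 P4 (conj P3 A') B) as E.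
  fold K in E. unfold right_boundary, hyp_u, hyp_v. fold u2 u3 u4 v2 v4.
  eapply Rle_lt_trans; [|exact Hk].
  eapply Rle_trans; [|apply Rmult_le_compat_r; [apply Rlt_le, Rinv_0_lt_compat; nra|apply Rle_abs]].
  eapply Rle_trans; [|exact E]. right. f_equal. ring.
Qed.

Lemma hyp_u_left_limit eps :
  0 < eps -> exists n, 0 < n /\ forall x y, n <= - y ->
    Rabs (hyp_u (x, y) - left_boundary b1 b2 b3 b4 (hyp_v (x, y))) < eps.
Proof.
  intros He.
  (* Abscissae are measured from [b3] instead of [b1]. Eliminating [mu3] by [Hsum] leaves [mu1] with
     coefficient [- u3]. *)
  set (a2 := u2 - u3). set (a4 := u4 - u3).
  set (K := (Rabs (- u3) + Rabs (a4 - a2 * v4 / v2) + Rabs (a2 - a4 * v2 / v4)) * (1 + v2 / - v4 + - v4 / v2)).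
  destruct (exists_small_inv (Rabs K) eps (Rabs_pos _) He) as [n [Hn Hk]].
  exists n. split; [exact Hn|]. intros x y Hy.
  destruct (small_measure_left n y x Hn Hy) as [A B].
  pose proof (mu_pos (x, y)) as [P1 [P2 [P3 P4]]].
  assert (A' : mu1 c s (x, y) <= / (c * n)).
  { eapply Rle_trans; [exact A|]. apply Rinv_le_contravar; nra. }
  assert (Hv : v4 < 0 < v2) by (split; assumption).
  pose proof (small_combination (- u3) (mu1 c s (x, y)) a2 a4 v2 v4 _ _ _ Hv P2 P4 (conj P1 A') B) as E.
  fold K in E. unfold left_boundary, hyp_u, hyp_v. fold u2 u3 u4 v2 v4.
  eapply Rle_lt_trans; [|exact Hk].
  eapply Rle_trans; [|apply Rmult_le_compat_r; [apply Rlt_le, Rinv_0_lt_compat; nra|apply Rle_abs]].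
  eapply Rle_trans; [|exact E]. right. f_equal.
  specialize (Hsum (x, y)).
  replace (mu3 c s (x, y)) with (1 - mu1 c s (x, y) - mu2 c s (x, y) - mu4 c s (x, y)) by lra.
  unfold a2, a4. ring.
Qed.

Lemma level_u_bounds v y :
  v4 < v < v2 -> left_boundary b1 b2 b3 b4 v < level_u (v, y) < right_boundary b1 b2 b3 b4 v.
Proof.
  intros Hv. unfold level_u. split.
  - apply Rnot_le_lt. intros H.
    (* A step of length one turns the weak inequality into a positive distance from the boundary,
       which monotonicity would preserve all the way to the limit. *)
    pose proof (level_u_increasing v (y - 1) y Hv ltac:(lra)) as I1. unfold level_u in I1. simpl in *.
    destruct (hyp_u_left_limit (left_boundary b1 b2 b3 b4 v - hyp_u (level (v, y - 1), y - 1)))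
      as [n [Hn L]]; [lra|].
    pose proof (L (level (v, Rmin (y - 2) (- n))) (Rmin (y - 2) (- n))
      ltac:(pose proof (Rmin_r (y - 2) (- n)); lra)) as L1.
    set (y' := Rmin (y - 2) (- n)) in *.
    pose proof (level_spec (v, y') Hv) as E. simpl in E. rewrite E in L1.
    pose proof (level_u_increasing v y' (y - 1) Hv) as I2. unfold level_u in I2. simpl in I2.
    assert (y' < y - 1) by (unfold y'; pose proof (Rmin_l (y - 2) (- n)); lra).
    specialize (I2 H0). apply Rabs_def2 in L1. lra.
  - apply Rnot_le_lt. intros H.
    pose proof (level_u_increasing v y (y + 1) Hv ltac:(lra)) as I1. unfold level_u in I1. simpl in *.
    destruct (hyp_u_right_limit (hyp_u (level (v, y + 1), y + 1) - right_boundary b1 b2 b3 b4 v))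
      as [n [Hn L]]; [lra|].
    pose proof (L (level (v, Rmax (y + 2) n)) (Rmax (y + 2) n) (Rmax_r _ _)) as L1.
    set (y' := Rmax (y + 2) n) in *.
    pose proof (level_spec (v, y') Hv) as E. simpl in E. rewrite E in L1.
    pose proof (level_u_increasing v (y + 1) y' Hv) as I2. unfold level_u in I2. simpl in I2.
    assert (y + 1 < y') by (unfold y'; pose proof (Rmax_l (y + 2) n); lra).
    specialize (I2 H0). apply Rabs_def2 in L1. lra.
Qed.

Lemma level_u_onto u v :
  v4 < v < v2 -> left_boundary b1 b2 b3 b4 v < u < right_boundary b1 b2 b3 b4 v ->
  exists y, level_u (v, y) = u.
Proof.
  intros Hv Hu.
  destruct (hyp_u_left_limit (u - left_boundary b1 b2 b3 b4 v)) as [n [Hn L]]; [lra|].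
  destruct (hyp_u_right_limit (right_boundary b1 b2 b3 b4 v - u)) as [n' [Hn' L']]; [lra|].
  specialize (L (level (v, - n)) (- n) ltac:(lra)).
  specialize (L' (level (v, n')) n' ltac:(lra)).
  pose proof (level_spec (v, - n) Hv) as E. pose proof (level_spec (v, n') Hv) as E'.
  simpl in E, E'. rewrite E in L. rewrite E' in L'.
  apply Rabs_def2 in L. apply Rabs_def2 in L'.
  (* [IVT_decreasing] imposes no order on its endpoints; with them exchanged it serves this
     increasing function. *)
  apply (IVT_decreasing (fun y => level_u (v, y)) u n' (- n)).
  - intros y. apply (continuous_comp (fun t => (v, t) : C) level_u).
    + apply continuous_pair; [apply continuous_const|apply continuous_id].
    + apply continuous_level_u, Hv.
  - unfold level_u. simpl. lra.
Qed.

Lemma hyp_map_in_quad_domain P : quad_domain b1 b2 b3 b4 (hyp_map b1 b2 b3 b4 c s P).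
Proof.
  apply (quad_domain_diag b1 b2 b3 b4 Hsep), diag_gap_pos.
  destruct (diag_hyp_map P) as [-> ->]. destruct P as [x y].
  pose proof (level_u_bounds (hyp_v (x, y)) y (hyp_v_bounds _)) as B.
  unfold level_u in B. rewrite level_unique in B. exact B.
Qed.

Lemma hyp_map_onto w : quad_domain b1 b2 b3 b4 w -> exists P, hyp_map b1 b2 b3 b4 c s P = w.
Proof.
  intros Hw. apply (quad_domain_diag b1 b2 b3 b4 Hsep), diag_gap_pos in Hw.
  pose proof (left_lt_right b1 b2 b3 b4 Hsep (diag_v b1 b3 w) ltac:(lra)) as Hv.
  destruct (level_u_onto (diag_u b1 b3 w) (diag_v b1 b3 w) Hv Hw) as [y Hy].
  exists (level (diag_v b1 b3 w, y), y).
  destruct (diag_hyp_map (level (diag_v b1 b3 w, y), y)) as [Eu Ev].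
  apply (diag_coordinates_inj b1 b2 b3 b4 Hsep).
  - rewrite Eu. exact Hy.
  - rewrite Ev. apply (level_spec (diag_v b1 b3 w, y) Hv).
Qed.

Lemma hyp_map_inj P Q : hyp_map b1 b2 b3 b4 c s P = hyp_map b1 b2 b3 b4 c s Q -> P = Q.
Proof.
  intros E. destruct (diag_hyp_map P) as [Pu Pv]. destruct (diag_hyp_map Q) as [Qu Qv].
  rewrite E in Pu, Pv. rewrite Qu in Pu. rewrite Qv in Pv.
  destruct P as [x y], Q as [x' y'].
  pose proof (level_unique x y) as Lx. pose proof (level_unique x' y') as Lx'.
  rewrite Pv in Lx'. 
  assert (y = y').
  { destruct (Rtotal_order y y') as [L|[L|L]]; auto;
      apply (level_u_increasing (hyp_v (x, y)) _ _ (hyp_v_bounds _)) in L;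
      unfold level_u in L; simpl in L; rewrite Lx, Lx' in L; lra. }
  subst y'. rewrite Lx in Lx'. subst x'. reflexivity.
Qed.

(** The equations are triangular: the ordinate of [K q] solves a monotone equation for [level_u],
    and the abscissa is then [level] at that ordinate. *)
Lemma hyp_map_inverse_continuous (K : C -> C) w :
  (forall w, quad_domain b1 b2 b3 b4 w -> hyp_map b1 b2 b3 b4 c s (K w) = w) ->
  quad_domain b1 b2 b3 b4 w -> continuous K w.
Proof.
  intros HK Hw.
  assert (Loc : locally w (quad_domain b1 b2 b3 b4)) by (apply (open_quad_domain b1 b2 b3 b4 Hsep), Hw).
  assert (S : forall q, quad_domain b1 b2 b3 b4 q -> v4 < diag_v b1 b3 q < v2).
  { intros q Hq. apply (quad_domain_diag b1 b2 b3 b4 Hsep), diag_gap_pos in Hq.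
    apply (left_lt_right b1 b2 b3 b4 Hsep). lra. }
  assert (ER : forall q, quad_domain b1 b2 b3 b4 q -> Re (K q) = level (diag_v b1 b3 q, Im (K q))).
  { intros q Hq. destruct (diag_hyp_map (K q)) as [_ Ev]. rewrite (HK q Hq) in Ev.
    rewrite Ev. symmetry. rewrite (surjective_pairing (K q)) at 1. apply level_unique. }
  assert (CI : continuous (fun q => Im (K q)) w).
  { apply (monotone_solution_continuous C_UniformSpace (fun y q => level_u (diag_v b1 b3 q, y))
             (fun q => Im (K q)) (diag_u b1 b3)).
    - revert Loc. apply filter_imp. intros q Hq. split.
      + unfold level_u. simpl. rewrite <- (ER q Hq).
        destruct (diag_hyp_map (K q)) as [Eu _]. rewrite (HK q Hq) in Eu. rewrite Eu.
        rewrite <- surjective_pairing. reflexivity.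
      + intros y y'. apply level_u_increasing, S, Hq.
    - intros y. apply (continuous_comp (fun q : C => (diag_v b1 b3 q, y) : C) level_u).
      + apply continuous_pair; [apply continuous_diag_v|apply continuous_const].
      + apply continuous_level_u. apply S, Hw.
    - apply continuous_diag_u. }
  apply continuous_ext with (f := fun q => (Re (K q), Im (K q)) : C).
  { intros q. symmetry. apply surjective_pairing. }
  apply continuous_pair; [|exact CI].
  apply continuous_ext_loc with (g := fun q => level (diag_v b1 b3 q, Im (K q))).
  - revert Loc. apply filter_imp. intros q Hq. symmetry. apply ER, Hq.
  - apply (continuous_comp (fun q : C => (diag_v b1 b3 q, Im (K q)) : C) level).
    + apply continuous_pair; [apply continuous_diag_v|exact CI].
    + apply continuous_level. apply S, Hw.
Qed.

End Core.

(** * The hyperboloid chart of the disk *)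

Definition defect (z : C) : R := 1 - (Re z ^ 2 + Im z ^ 2).

Lemma Re_pair (x y : R) : Re (x, y) = x.
Proof. reflexivity. Qed.

Lemma Im_pair (x y : R) : Im (x, y) = y.
Proof. reflexivity. Qed.

Definition chart_re (a : R) (z : C) : R := 2 * (Re z * cos a + Im z * sin a) / defect z.
Definition chart_im (a : R) (z : C) : R := 2 * (Im z * cos a - Re z * sin a) / defect z.

(** [exp (i a) P / (1 + T)]: the stereographic projection of the hyperboloid onto the disk, followed
    by the rotation that the chart undoes. *)
Definition chart_inv (a : R) (P : C) : C :=
  ((Re P * cos a - Im P * sin a) / (1 + hyp_T P), (Re P * sin a + Im P * cos a) / (1 + hyp_T P)).

Lemma defect_pos z : disk z -> 0 < defect z.
Proof. rewrite disk_iff. unfold defect. lra. Qed.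

Lemma hyp_T_chart a z : disk z -> hyp_T (chart_re a z, chart_im a z) = (1 + (Re z ^ 2 + Im z ^ 2)) / defect z.
Proof.
  intros Hz. pose proof (defect_pos z Hz) as HD. pose proof (pow2_ge_0 (Re z)). pose proof (pow2_ge_0 (Im z)).
  unfold hyp_T. apply sqrt_lem_1.
  - apply Rplus_le_le_0_compat; [apply Rplus_le_le_0_compat; [lra|]|]; apply pow2_ge_0.
  - apply Rlt_le, Rdiv_lt_0_compat; lra.
  - unfold chart_re, chart_im, Re, Im; simpl fst; simpl snd.
    pose proof (sin2_cos2_pow a) as E. assert (Es : sin a ^ 2 = 1 - cos a ^ 2) by lra.
    set (x := fst z) in *. set (y := snd z) in *.
    assert (HD' : defect z <> 0) by lra.
    apply (Rmult_eq_reg_r (defect z ^ 2)); [|apply pow_nonzero, HD'].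
    field_simplify; [|exact HD'|exact HD']. unfold defect, Re, Im. fold x y.
    ring_simplify. rewrite ?Es. ring.
Qed.

Lemma chart_inv_in_disk a P : disk (chart_inv a P).
Proof.
  apply disk_iff. unfold chart_inv, Re, Im; simpl fst; simpl snd.
  pose proof (hyp_T_pos P) as HT. pose proof (hyp_T_sqr P) as E. unfold Re, Im in E.
  pose proof (sin2_cos2_pow a) as Ea.
  replace (_ + _) with ((fst P ^ 2 + snd P ^ 2) * (sin a ^ 2 + cos a ^ 2) / (1 + hyp_T P) ^ 2) by (field; lra).
  rewrite Ea. replace (fst P ^ 2 + snd P ^ 2) with (hyp_T P ^ 2 - 1) by lra.
  apply (Rmult_lt_reg_r ((1 + hyp_T P) ^ 2)); [nra|]. field_simplify; nra.
Qed.

Lemma chart_inv_K a P : chart_re a (chart_inv a P) = Re P /\ chart_im a (chart_inv a P) = Im P.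
Proof.
  pose proof (hyp_T_pos P) as HT. pose proof (hyp_T_sqr P) as E.
  pose proof (sin2_cos2_pow a) as Ea.
  assert (ED : defect (chart_inv a P) = 2 / (1 + hyp_T P)).
  { unfold defect, chart_inv. rewrite Re_pair, Im_pair.
    replace (_ + _) with ((Re P ^ 2 + Im P ^ 2) * (sin a ^ 2 + cos a ^ 2) / (1 + hyp_T P) ^ 2) by (field; lra).
    rewrite Ea. replace (Re P ^ 2 + Im P ^ 2) with (hyp_T P ^ 2 - 1) by lra. field. lra. }
  unfold chart_re, chart_im. rewrite ED. unfold chart_inv. rewrite Re_pair, Im_pair.
  split.
  - transitivity (Re P * (sin a ^ 2 + cos a ^ 2)); [field; lra|rewrite Ea; ring].
  - transitivity (Im P * (sin a ^ 2 + cos a ^ 2)); [field; lra|rewrite Ea; ring].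
Qed.

Lemma chart_K a z : disk z -> chart_inv a (chart_re a z, chart_im a z) = z.
Proof.
  intros Hz. pose proof (defect_pos z Hz) as HD. unfold chart_inv. rewrite hyp_T_chart by exact Hz.
  assert (E1 : 1 + (1 + (Re z ^ 2 + Im z ^ 2)) / defect z = 2 / defect z)
    by (unfold defect in *; field; lra).
  rewrite E1, Re_pair, Im_pair. unfold chart_re, chart_im.
  pose proof (sin2_cos2_pow a) as Ea.
  apply injective_projections; simpl fst; simpl snd.
  - transitivity (Re z * (sin a ^ 2 + cos a ^ 2)); [field; lra|rewrite Ea; unfold Re; ring].
  - transitivity (Im z * (sin a ^ 2 + cos a ^ 2)); [field; lra|rewrite Ea; unfold Im; ring].
Qed.

Lemma continuous_chart_inv a P : continuous (chart_inv a) P.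
Proof.
  assert (O : open (fun _ : C => True)) by apply open_true.
  assert (N : forall P, True -> 1 + hyp_T P <> 0) by (intros Q _; pose proof (hyp_T_pos Q); lra).
  assert (CD : class_C 0 (fun _ => True) (fun P => 1 + hyp_T P)).
  { apply (class_C_plus _ O); [apply class_C_const, O|apply class_C_hyp_T]. }
  apply continuous_pair; apply (class_C_continuous 0 (fun _ => True)); try exact I.
  - apply (class_C_div _ O); [exact N| |exact CD].
    apply (class_C_minus _ O); apply (class_C_mult _ O);
      (apply class_C_Re, O) || (apply class_C_Im, O) || apply class_C_const, O.
  - apply (class_C_div _ O); [exact N| |exact CD].
    apply (class_C_plus _ O); apply (class_C_mult _ O);
      (apply class_C_Re, O) || (apply class_C_Im, O) || apply class_C_const, O.
Qed.

Lemma class_C_chart a n : class_C n disk (chart_re a) /\ class_C n disk (chart_im a).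
Proof.
  pose proof open_disk as HD.
  assert (N : forall z, disk z -> defect z <> 0) by (intros z Hz; pose proof (defect_pos z Hz); lra).
  assert (CD : class_C n disk defect).
  { apply (class_C_ext disk HD n (fun z => 1 - (Re z * Re z + Im z * Im z))); [intros; unfold defect; ring|].
    apply (class_C_minus disk HD); [apply class_C_const, HD|].
    apply (class_C_plus disk HD); apply (class_C_mult disk HD);
      (apply class_C_Re, HD) || (apply class_C_Im, HD). }
  split; (apply (class_C_div disk HD); [exact N| |exact CD]);
    (apply (class_C_mult disk HD); [apply class_C_const, HD|]).
  - apply (class_C_plus disk HD); apply (class_C_mult disk HD);
      (apply class_C_Re, HD) || (apply class_C_Im, HD) || apply class_C_const, HD.
  - apply (class_C_minus disk HD); apply (class_C_mult disk HD);
      (apply class_C_Re, HD) || (apply class_C_Im, HD) || apply class_C_const, HD.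
Qed.

Lemma chart_jacobian a z :
  disk z ->
  dx (chart_re a) z * dy (chart_im a) z - dy (chart_re a) z * dx (chart_im a) z =
  4 * (1 + (Re z ^ 2 + Im z ^ 2)) / defect z ^ 3.
Proof.
  intros Hz. pose proof (defect_pos z Hz) as HD.
  set (x := Re z). set (y := Im z). set (D := defect z) in *.
  assert (ED : D = 1 - (x ^ 2 + y ^ 2)) by reflexivity.
  assert (E1 : dx (chart_re a) z = (2 * cos a * D + 4 * x * (x * cos a + y * sin a)) / D ^ 2).
  { apply is_derive_unique. unfold chart_re, defect; simpl. fold x y. rewrite ED in *. simpl in *.
    auto_derive; [lra|field; lra]. }
  assert (E2 : dy (chart_re a) z = (2 * sin a * D + 4 * y * (x * cos a + y * sin a)) / D ^ 2).
  { apply is_derive_unique. unfold chart_re, defect; simpl. fold x y. rewrite ED in *. simpl in *.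
    auto_derive; [lra|field; lra]. }
  assert (E3 : dx (chart_im a) z = (- 2 * sin a * D + 4 * x * (y * cos a - x * sin a)) / D ^ 2).
  { apply is_derive_unique. unfold chart_im, defect; simpl. fold x y. rewrite ED in *. simpl in *.
    auto_derive; [lra|field; lra]. }
  assert (E4 : dy (chart_im a) z = (2 * cos a * D + 4 * y * (y * cos a - x * sin a)) / D ^ 2).
  { apply is_derive_unique. unfold chart_im, defect; simpl. fold x y. rewrite ED in *. simpl in *.
    auto_derive; [lra|field; lra]. }
  rewrite E1, E2, E3, E4.
  transitivity (4 * (D + 2 * (x ^ 2 + y ^ 2)) * (sin a ^ 2 + cos a ^ 2) / D ^ 3); [field; lra|].
  rewrite sin2_cos2_pow. replace (D + 2 * (x ^ 2 + y ^ 2)) with (1 + (x ^ 2 + y ^ 2)) by lra.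
  field. lra.
Qed.

Lemma has_gradient_affine (p q r : R) (z : C) : has_gradient (fun w => p * Re w + q * Im w + r) z p q.
Proof.
  assert (O : open (fun _ : C => True)) by apply open_true.
  assert (Ex : dx (fun w => p * Re w + q * Im w + r) z = p)
    by (apply is_derive_unique; simpl; auto_derive; [trivial|ring]).
  assert (Ey : dy (fun w => p * Re w + q * Im w + r) z = q)
    by (apply is_derive_unique; simpl; auto_derive; [trivial|ring]).
  assert (G : has_gradient (fun w => p * Re w + q * Im w + r) z
    (dx (fun w => p * Re w + q * Im w + r) z) (dy (fun w => p * Re w + q * Im w + r) z)).
  { apply (class_C_gradient _ O (fun w => p * Re w + q * Im w + r) z); [|exact I].
    apply (class_C_plus _ O); [|apply class_C_const, O].
    apply (class_C_plus _ O); apply (class_C_mult _ O);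
      (apply class_C_Re, O) || (apply class_C_Im, O) || apply class_C_const, O. }
  rewrite Ex, Ey in G. exact G.
Qed.

(** * Transfer of bijectivity and smoothness to the disk *)

Section Diffeomorphism.

Variables (b1 b2 b3 b4 : C) (c s a : R) (f : C -> C).
Hypothesis Hsep : separating_diagonal b1 b2 b3 b4.
Hypothesis Hc : 0 < c < 1.
Hypothesis Hs : 0 < s < 1.
Hypothesis Hsum : forall P, mu1 c s P + mu2 c s P + mu3 c s P + mu4 c s P = 1.
Hypothesis Hf : forall z, disk z -> f z = hyp_map b1 b2 b3 b4 c s (chart_re a z, chart_im a z).
Hypothesis Hsmooth : smooth_on disk f.
Hypothesis Hjac : sense_preserving_on disk f.

Let gradient_f z : disk z ->
  has_gradient (re_part f) z (dx (re_part f) z) (dy (re_part f) z) /\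
  has_gradient (im_part f) z (dx (im_part f) z) (dy (im_part f) z).
Proof.
  intros Hz. split; apply (class_C_gradient disk open_disk); try exact Hz; apply (Hsmooth 1%nat).
Qed.

(** The diagonal similarity after [f] has Jacobian [|b1 - b3|^2] times that of [f]. By the chain
    rule the same number is the Jacobian of [(hyp_u, hyp_v)] times the positive one of the chart. *)
Lemma hyp_jacobian_pos P :
  0 < dx (hyp_u b1 b2 b3 b4 c s) P * dy (hyp_v b1 b2 b3 b4 c s) P -
      dy (hyp_u b1 b2 b3 b4 c s) P * dx (hyp_v b1 b2 b3 b4 c s) P.
Proof.
  set (z := chart_inv a P). assert (Hz : disk z) by apply chart_inv_in_disk.
  destruct (chart_inv_K a P) as [K1 K2]. fold z in K1, K2.
  assert (EP : (chart_re a z, chart_im a z) = P) by (rewrite K1, K2; symmetry; apply surjective_pairing).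
  destruct (gradient_f z Hz) as [Gr Gi].
  set (e := Cconj (b1 - b3)).
  assert (Gu : has_gradient (fun w => diag_u b1 b3 (f w)) z
    (Re e * dx (re_part f) z + - Im e * dx (im_part f) z)
    (Re e * dy (re_part f) z + - Im e * dy (im_part f) z)).
  { apply (has_gradient_ext (fun w => Re e * re_part f w + - Im e * im_part f w - Re (b1 * e)%C)).
    - apply filter_forall. intros w. unfold diag_u, re_part, im_part. fold e.
      unfold Cmult, Cminus, Copp, Cplus, Re, Im; simpl. ring.
    - apply (has_gradient_comp (fun w => Re e * Re w + - Im e * Im w + - Re (b1 * e)%C) (re_part f) (im_part f));
        [apply has_gradient_affine|exact Gr|exact Gi]. }
  assert (Gv : has_gradient (fun w => diag_v b1 b3 (f w)) z
    (Im e * dx (re_part f) z + Re e * dx (im_part f) z)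
    (Im e * dy (re_part f) z + Re e * dy (im_part f) z)).
  { apply (has_gradient_ext (fun w => Im e * re_part f w + Re e * im_part f w - Im (b1 * e)%C)).
    - apply filter_forall. intros w. unfold diag_v, re_part, im_part. fold e.
      unfold Cmult, Cminus, Copp, Cplus, Re, Im; simpl. ring.
    - apply (has_gradient_comp (fun w => Im e * Re w + Re e * Im w + - Im (b1 * e)%C) (re_part f) (im_part f));
        [apply has_gradient_affine|exact Gr|exact Gi]. }
  assert (Gx : has_gradient (chart_re a) z (dx (chart_re a) z) (dy (chart_re a) z)).
  { apply (class_C_gradient disk open_disk); [apply class_C_chart|exact Hz]. }
  assert (Gy : has_gradient (chart_im a) z (dx (chart_im a) z) (dy (chart_im a) z)).
  { apply (class_C_gradient disk open_disk); [apply class_C_chart|exact Hz]. }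
  pose proof (has_gradient_hyp_u b1 b2 b3 b4 c s Hc Hs P) as Hu.
  pose proof (has_gradient_hyp_v b1 b2 b3 b4 c s Hc Hs P) as Hv.
  rewrite <- EP in Hu at 1. rewrite <- EP in Hv at 1.
  pose proof (has_gradient_comp _ _ _ _ _ _ _ _ _ _ Hu Gx Gy) as Cu.
  pose proof (has_gradient_comp _ _ _ _ _ _ _ _ _ _ Hv Gx Gy) as Cv.
  assert (Lu : locally z (fun w => diag_u b1 b3 (f w) = hyp_u b1 b2 b3 b4 c s (chart_re a w, chart_im a w))).
  { generalize (open_disk z Hz). apply filter_imp. intros w Hw. rewrite (Hf w Hw).
    apply (diag_hyp_map b1 b2 b3 b4 c s Hsum). }
  assert (Lv : locally z (fun w => diag_v b1 b3 (f w) = hyp_v b1 b2 b3 b4 c s (chart_re a w, chart_im a w))).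
  { generalize (open_disk z Hz). apply filter_imp. intros w Hw. rewrite (Hf w Hw).
    apply (diag_hyp_map b1 b2 b3 b4 c s Hsum). }
  destruct (has_gradient_unique _ _ _ _ _ _ (has_gradient_ext _ _ _ _ _ Lu Gu) Cu) as [U1 U2].
  destruct (has_gradient_unique _ _ _ _ _ _ (has_gradient_ext _ _ _ _ _ Lv Gv) Cv) as [V1 V2].
  pose proof (Hjac z Hz) as J. unfold jacobian in J.
  pose proof (chart_jacobian a z Hz) as JC.
  assert (JC' : 0 < dx (chart_re a) z * dy (chart_im a) z - dy (chart_re a) z * dx (chart_im a) z).
  { rewrite JC. pose proof (defect_pos z Hz). pose proof (pow2_ge_0 (Re z)). pose proof (pow2_ge_0 (Im z)).
    apply Rdiv_lt_0_compat; [lra|apply pow_lt; lra]. }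
  assert (Ne : 0 < Re e ^ 2 + Im e ^ 2).
  { rewrite <- Cmod_sqr. unfold e. rewrite Cmod_conj. apply pow_lt, Cmod_gt_0.
    apply (diagonal_neq_0 b1 b2 b3 b4 Hsep). }
  set (ux := dx (hyp_u b1 b2 b3 b4 c s) P) in *. set (uy := dy (hyp_u b1 b2 b3 b4 c s) P) in *.
  set (vx := dx (hyp_v b1 b2 b3 b4 c s) P) in *. set (vy := dy (hyp_v b1 b2 b3 b4 c s) P) in *.
  apply (Rmult_lt_reg_r (dx (chart_re a) z * dy (chart_im a) z - dy (chart_re a) z * dx (chart_im a) z));
    [exact JC'|]. rewrite Rmult_0_l.
  replace ((ux * vy - uy * vx) * _) with
    ((ux * dx (chart_re a) z + uy * dx (chart_im a) z) * (vx * dy (chart_re a) z + vy * dy (chart_im a) z) -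
     (ux * dy (chart_re a) z + uy * dy (chart_im a) z) * (vx * dx (chart_re a) z + vy * dx (chart_im a) z)) by ring.
  rewrite <- U1, <- U2, <- V1, <- V2.
  replace (_ - _) with ((dx (re_part f) z * dy (im_part f) z - dy (re_part f) z * dx (im_part f) z) *
    (Re e ^ 2 + Im e ^ 2)) by ring.
  apply Rmult_lt_0_compat; assumption.
Qed.

Lemma disk_to_quad_diffeomorphism : diffeomorphism disk (quad_domain b1 b2 b3 b4) f.
Proof.
  pose proof hyp_jacobian_pos as HJ.
  set (K := fun w => epsilon (inhabits (RtoC 0)) (fun P => hyp_map b1 b2 b3 b4 c s P = w)).
  assert (HK : forall w, quad_domain b1 b2 b3 b4 w -> hyp_map b1 b2 b3 b4 c s (K w) = w).
  { intros w Hw. apply (epsilon_spec (inhabits (RtoC 0)) (fun P => hyp_map b1 b2 b3 b4 c s P = w)).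
    apply hyp_map_onto; assumption. }
  set (k := fun w => chart_inv a (K w)).
  assert (Ck : forall w, quad_domain b1 b2 b3 b4 w -> continuous k w).
  { intros w Hw. apply (continuous_comp K (chart_inv a)); [|apply continuous_chart_inv].
    apply (hyp_map_inverse_continuous b1 b2 b3 b4 c s); assumption. }
  assert (Dk : forall w, disk (k w)) by (intros w; apply chart_inv_in_disk).
  assert (fk : forall w, quad_domain b1 b2 b3 b4 w -> f (k w) = w).
  { intros w Hw. rewrite (Hf (k w) (Dk w)). unfold k.
    destruct (chart_inv_K a (K w)) as [-> ->]. rewrite <- (surjective_pairing (K w) : K w = (Re (K w), Im (K w))).
    apply HK, Hw. }
  assert (fQ : forall z, disk z -> quad_domain b1 b2 b3 b4 (f z)).
  { intros z Hz. rewrite (Hf z Hz). apply hyp_map_in_quad_domain; assumption. }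
  assert (kf : forall z, disk z -> k (f z) = z).
  { intros z Hz. pose proof (HK _ (fQ z Hz)) as E. rewrite (Hf z Hz) in E at 2.
    apply hyp_map_inj in E; try assumption.
    unfold k. rewrite E. apply chart_K, Hz. }
  split; [exact Hsmooth|]. split; [exact fQ|].
  exists k. split; [|split; [intros w _; apply Dk|split; assumption]].
  intros n.
  assert (EK : forall w, (re_part k w, im_part k w) = k w) by (intros w; symmetry; apply surjective_pairing).
  apply (class_C_inverse disk (quad_domain b1 b2 b3 b4) (re_part f) (im_part f) (re_part k) (im_part k)).
  - apply open_disk.
  - apply (open_quad_domain b1 b2 b3 b4 Hsep).
  - intros i. apply Hsmooth.
  - intros i. apply Hsmooth.
  - intros z Hz. pose proof (Hjac z Hz) as J. unfold jacobian in J. lra.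
  - intros w _. rewrite EK. apply Dk.
  - intros w Hw. rewrite EK. unfold re_part, im_part. rewrite fk by exact Hw. auto.
  - intros w Hw. apply (continuous_comp k Re); [apply Ck, Hw|apply continuous_Re].
  - intros w Hw. apply (continuous_comp k Im); [apply Ck, Hw|apply continuous_Im].
Qed.

End Diffeomorphism.

(** * The Poisson extension in the chart *)

Lemma side_measure_ext l l' : l = l' -> side_measure l = side_measure l'.
Proof. intros ->. reflexivity. Qed.

Section PoissonChart.

Variable p : R.
Hypothesis Hp : 0 < p < PI.

Let c := cos (p / 2).
Let s := sin (p / 2).

Lemma cos_half_bounds : 0 < c < 1.
Proof.
  pose proof PI_RGT_0. split; [apply cos_gt_0; lra|].
  rewrite <- cos_0. apply cos_decreasing_1; lra.
Qed.

Lemma sin_half_bounds : 0 < s < 1.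
Proof.
  pose proof PI_RGT_0. split; [apply sin_gt_0; lra|].
  rewrite <- sin_PI2. apply sin_increasing_1; lra.
Qed.

(** The arcs of [b4] and [b2] have half-length [p / 2] and are centred on the real axis of the
    chart. Those of [b1] and [b3] have half-length [PI / 2 - p / 2] and are centred a quarter turn
    away, which exchanges [c] with [s] and [Re P] with [Im P]. *)
Lemma arc_measure_mu z :
  disk z ->
  let P := (chart_re (p / 2) z, chart_im (p / 2) z) : C in
  arc_measure 0 p z = mu4 c s P /\ arc_measure p PI z = mu1 c s P /\
  arc_measure PI (PI + p) z = mu2 c s P /\ arc_measure (PI + p) (2 * PI) z = mu3 c s P.
Proof.
  intros Hz P. pose proof (defect_pos z Hz) as HD. pose proof cos_half_bounds. pose proof sin_half_bounds.
  assert (T : hyp_T P = (1 + (Re z ^ 2 + Im z ^ 2)) / defect z) by (apply hyp_T_chart, Hz).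
  unfold mu1, mu2, mu3, mu4. rewrite T. unfold P. rewrite Re_pair, Im_pair.
  unfold chart_re, chart_im. fold c s.
  repeat split; (rewrite arc_measure_atan by (try exact Hz; lra)); apply side_measure_ext; fold (defect z).
  - replace ((p - 0) / 2) with (p / 2) by field. replace ((0 + p) / 2) with (p / 2) by field.
    fold c s. field. lra.
  - replace ((PI - p) / 2) with (PI / 2 - p / 2) by field.
    replace ((p + PI) / 2) with (PI / 2 + p / 2) by field.
    rewrite cos_shift, sin_shift, cos_plus, sin_plus, cos_PI2, sin_PI2. fold c s.
    field. lra.
  - replace ((PI + p - PI) / 2) with (p / 2) by field.
    replace ((PI + (PI + p)) / 2) with (p / 2 + PI) by field.
    rewrite neg_cos, neg_sin. fold c s. field. lra.
  - replace ((2 * PI - (PI + p)) / 2) with (PI / 2 - p / 2) by field.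
    replace ((PI + p + 2 * PI) / 2) with (PI / 2 + p / 2 + PI) by field.
    rewrite neg_cos, neg_sin, cos_shift, sin_shift, cos_plus, sin_plus, cos_PI2, sin_PI2. fold c s.
    field. lra.
Qed.

(** Every [P] comes from a point of the disk, and there the measures of the four arcs telescope
    around the circle. *)
Lemma mu_sum P : mu1 c s P + mu2 c s P + mu3 c s P + mu4 c s P = 1.
Proof.
  destruct (arc_measure_mu (chart_inv (p / 2) P) (chart_inv_in_disk _ _)) as [E4 [E1 [E2 E3]]].
  destruct (chart_inv_K (p / 2) P) as [K1 K2]. rewrite K1, K2 in *.
  rewrite <- (surjective_pairing P : P = (Re P, Im P)) in *.
  rewrite <- E1, <- E2, <- E3, <- E4. unfold arc_measure. rewrite pole_arg_2PI.
  pose proof PI_RGT_0. field. lra.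
Qed.

Lemma poisson_hyp_map b1 b2 b3 b4 z :
  disk z ->
  poisson (step_function b1 b2 b3 b4 p) z =
  hyp_map b1 b2 b3 b4 c s (chart_re (p / 2) z, chart_im (p / 2) z).
Proof.
  intros Hz. rewrite poisson_step_function by assumption.
  destruct (arc_measure_mu z Hz) as [-> [-> [-> ->]]]. unfold hyp_map. ring.
Qed.

Lemma hyp_T_shift P : hyp_T (Im P, - Re P) = hyp_T P.
Proof. unfold hyp_T. rewrite Re_pair, Im_pair. f_equal. ring. Qed.

Lemma mu_shift P :
  mu1 s c (Im P, - Re P) = mu2 c s P /\ mu2 s c (Im P, - Re P) = mu3 c s P /\
  mu3 s c (Im P, - Re P) = mu4 c s P /\ mu4 s c (Im P, - Re P) = mu1 c s P.
Proof.
  unfold mu1, mu2, mu3, mu4. rewrite hyp_T_shift, Re_pair, Im_pair.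
  repeat split; apply side_measure_ext; f_equal; ring.
Qed.

(* A cyclic shift of the vertices exchanges [c] and [s] and turns the plane by
   a quarter, so the other diagonal needs no separate argument. *)
Lemma hyp_map_shift b1 b2 b3 b4 P :
  hyp_map b1 b2 b3 b4 c s P = hyp_map b2 b3 b4 b1 s c (Im P, - Re P).
Proof.
  destruct (mu_shift P) as [E1 [E2 [E3 E4]]]. unfold hyp_map. rewrite E1, E2, E3, E4. ring.
Qed.

Lemma chart_quarter_turn a z :
  chart_re (a + PI / 2) z = chart_im a z /\ chart_im (a + PI / 2) z = - chart_re a z.
Proof.
  unfold chart_re, chart_im. rewrite cos_plus, sin_plus, cos_PI2, sin_PI2. unfold Rdiv. split; ring.
Qed.

Lemma mu_sum_shift P : mu1 s c P + mu2 s c P + mu3 s c P + mu4 s c P = 1.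
Proof.
  destruct (mu_shift (- Im P, Re P)) as [E1 [E2 [E3 E4]]].
  rewrite Re_pair, Im_pair, Ropp_involutive in *.
  rewrite <- (surjective_pairing P : P = (Re P, Im P)) in *.
  rewrite E1, E2, E3, E4, <- (mu_sum (- Im P, Re P)). ring.
Qed.

Lemma poisson_smooth b1 b2 b3 b4 : smooth_on disk (poisson (step_function b1 b2 b3 b4 p)).
Proof.
  pose proof open_disk as HD. intros n. split.
  - eapply (class_C_ext disk HD n); [|apply class_C_jump_sum].
    intros z Hz. symmetry. apply re_part_poisson; assumption.
  - eapply (class_C_ext disk HD n); [|apply class_C_jump_sum].
    intros z Hz. symmetry. apply im_part_poisson; assumption.
Qed.

Lemma poisson_harmonic b1 b2 b3 b4 : harmonic_on disk (poisson (step_function b1 b2 b3 b4 p)).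
Proof.
  split.
  - eapply real_harmonic_jump_sum. intros z Hz. apply re_part_poisson; assumption.
  - eapply real_harmonic_jump_sum. intros z Hz. apply im_part_poisson; assumption.
Qed.

Lemma poisson_diffeomorphism b1 b2 b3 b4 :
  quadrilateral b1 b2 b3 b4 ->
  sense_preserving_on disk (poisson (step_function b1 b2 b3 b4 p)) ->
  diffeomorphism disk (quad_domain b1 b2 b3 b4) (poisson (step_function b1 b2 b3 b4 p)).
Proof.
  intros HQ Hjac. pose proof cos_half_bounds as Bc. pose proof sin_half_bounds as Bs.
  destruct (quadrilateral_separating_diagonal b1 b2 b3 b4 HQ) as [Hsep|Hsep].
  - apply (disk_to_quad_diffeomorphism b1 b2 b3 b4 c s (p / 2)); try assumption.
    + apply mu_sum.
    + intros z Hz. apply poisson_hyp_map, Hz.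
    + apply poisson_smooth.
  - assert (D : diffeomorphism disk (quad_domain b2 b3 b4 b1) (poisson (step_function b1 b2 b3 b4 p))).
    { apply (disk_to_quad_diffeomorphism b2 b3 b4 b1 s c (p / 2 + PI / 2)); try assumption.
      + apply mu_sum_shift.
      + intros z Hz. rewrite poisson_hyp_map by exact Hz. rewrite hyp_map_shift.
        destruct (chart_quarter_turn (p / 2) z) as [-> ->]. rewrite Re_pair, Im_pair. reflexivity.
      + apply poisson_smooth. }
    destruct D as [D1 [D2 [k [K1 [K2 [K3 K4]]]]]].
    split; [exact D1|]. split; [intros z Hz; apply (quad_domain_shift b1 b2 b3 b4), D2, Hz|].
    exists k. split; [|split; [|split; [exact K3|]]].
    + intros n. destruct (K1 n) as [A B].
      assert (Hsub : forall n u, class_C n (quad_domain b2 b3 b4 b1) u -> class_C n (quad_domain b1 b2 b3 b4) u).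
      { clear. intros n. induction n as [|n IH]; intros u H.
        - destruct H as [H _]. split; [|exact I]. intros z Hz. apply H, (quad_domain_shift b1 b2 b3 b4), Hz.
        - destruct H as [H1 [H2 [H3 H4]]]. split; [|split; [|split; apply IH; assumption]];
            intros z Hz; [apply H1|apply H2]; apply (quad_domain_shift b1 b2 b3 b4), Hz. }
      split; apply Hsub; assumption.
    + intros w Hw. apply K2, (quad_domain_shift b1 b2 b3 b4), Hw.
    + intros w Hw. apply K4, (quad_domain_shift b1 b2 b3 b4), Hw.
Qed.

End PoissonChart.

(** * The dilatation bound and the assembled statement *)

Lemma mobius_in_disk X z0 z : Cmod X = 1 -> Cmod z0 < 1 -> disk z -> Cmod (mobius X z0 z) < 1.
Proof.
  intros HX H0 Hz.
  assert (P0 : Cmod z0 ^ 2 < 1) by (pose proof (Cmod_ge_0 z0); nra).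
  apply disk_iff in Hz. rewrite Cmod_sqr in P0.
  assert (K : Cmod (z - z0) ^ 2 < Cmod (1 - z * Cconj z0) ^ 2).
  { rewrite !Cmod_sqr.
    assert (E : Re (1 - z * Cconj z0)%C ^ 2 + Im (1 - z * Cconj z0)%C ^ 2 -
      (Re (z - z0)%C ^ 2 + Im (z - z0)%C ^ 2) =
      (1 - (Re z ^ 2 + Im z ^ 2)) * (1 - (Re z0 ^ 2 + Im z0 ^ 2))).
    { unfold Cconj, Cminus, Copp, Cplus, Cmult, RtoC, Re, Im; simpl. ring. }
    assert (0 < (1 - (Re z ^ 2 + Im z ^ 2)) * (1 - (Re z0 ^ 2 + Im z0 ^ 2)))
      by (apply Rmult_lt_0_compat; lra). lra. }
  pose proof (Cmod_ge_0 (z - z0)). pose proof (Cmod_ge_0 (1 - z * Cconj z0)).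
  assert (L : Cmod (z - z0) < Cmod (1 - z * Cconj z0)) by nra.
  unfold mobius. rewrite Cmod_mult, HX, Rmult_1_l.
  rewrite Cmod_div by (apply Cmod_gt_0; lra).
  apply (Rmult_lt_reg_r (Cmod (1 - z * Cconj z0))); [lra|]. field_simplify; lra.
Qed.

Theorem theorem1p1 (b1 b2 b3 b4 : C) :
  pitot_quadrilateral b1 b2 b3 b4 ->
  exists p : R,
    0 < p < PI /\
    let f := poisson (step_function b1 b2 b3 b4 p) in
    harmonic_on disk f /\
    sense_preserving_on disk f /\
    (exists h g : C -> C,
       analytic_on disk h /\
       analytic_on disk g /\
       g (RtoC 0) = RtoC 0 /\
       (forall z, disk z -> f z = (h z + Cconj (g z))%C) /\
       exists m s t : R,
         hyperbolic_coordinates b1 b2 b3 b4 m s t /\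
         let X := dilatation_factor b1 b3 m s t in
         let z0 := dilatation_zero m s t in
         Cmod X = 1 /\
         Cmod z0 < 1 /\
         forall z, disk z ->
           C_derive h z <> RtoC 0 /\
           (C_derive g z / C_derive h z)%C = (mobius X z0 z ^ 2)%C) /\
    diffeomorphism disk (quad_domain b1 b2 b3 b4) f.
Proof.
  intros HQ. pose proof HQ as [Hquad _].
  destruct (pitot_hyperbolic_coordinates b1 b2 b3 b4 HQ) as [m [s [t [Hcoord Hst]]]].
  pose proof Hcoord as [Hm [Ht Hs]].
  set (d := (s - t) / 2). set (sigma := (s + t) / 2).
  assert (Hd : 0 < d) by (unfold d; lra).
  set (e := (b3 - b1)%C).
  assert (He : e <> RtoC 0).
  { intros E. apply (simple_quadrilateral_diagonal b1 b2 b3 b4 (proj1 Hquad)).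
    transitivity (b3 - (b3 - b1))%C; [ring|fold e; rewrite E; ring]. }
  assert (N2 : RtoC 2 <> RtoC 0) by (intros E; apply RtoC_inj in E; lra).
  set (p := step_parameter d).
  pose proof (step_parameter_bounds d Hd) as Hp. fold p in Hp.
  replace t with (sigma - d) in Ht by (unfold sigma, d; field).
  replace s with (sigma + d) in Hs by (unfold sigma, d; field).
  rewrite hyperbola_point_minus in Ht. rewrite hyperbola_point_plus in Hs.
  match type of Hs with _ = (?E0 + ?H0)%C => set (E := E0) in *; set (H := H0) in * end.
  (* [e / 2] is the scale of the similarity carrying -1 and 1 to [b1] and [b3]; it multiplies the
     normalized jumps. *)
  assert (Efold : (e / 2 <> RtoC 0)%C).
  { intros F. apply He. transitivity (e / 2 * 2)%C; [field; exact N2|rewrite F; ring]. }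
  assert (Hdil : forall z, disk z ->
    pole_sum (b3 - b4) (b4 - b1) (b1 - b2) (b2 - b3) p z <> RtoC 0 /\
    (pole_sum (Cconj (b3 - b4)) (Cconj (b4 - b1)) (Cconj (b1 - b2)) (Cconj (b2 - b3)) p z /
     pole_sum (b3 - b4) (b4 - b1) (b1 - b2) (b2 - b3) p z =
     mobius (dilatation_factor b1 b3 m s t) (dilatation_zero m s t) z ^ 2)%C).
  { intros z Hz. apply (dilatation_of_jumps m sigma d Hm Hd e He (e / 2)); auto.
    - rewrite Cdiv_conj by exact N2.
      assert (C2 : Cconj 2 = RtoC 2) by (unfold Cconj, RtoC; simpl; f_equal; ring). rewrite C2.
      field. auto.
    - fold E H. replace (1 - E - H)%C with (1 - (E + H))%C by ring. rewrite <- Hs. unfold e. field; auto.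
    - fold E H. replace (1 + E + H)%C with (1 + (E + H))%C by ring. rewrite <- Hs. unfold e. field; auto.
    - fold E H. replace (- (1) - E + H)%C with (- (1) - (E - H))%C by ring. rewrite <- Ht. unfold e. field; auto.
    - fold E H. replace (- (1) + E - H)%C with (- (1) + (E - H))%C by ring. rewrite <- Ht. unfold e. field; auto. }
  assert (HX : Cmod (dilatation_factor b1 b3 m s t) = 1)
    by (apply (dilatation_factor_unimodular m sigma d); assumption).
  assert (Hz0 : Cmod (dilatation_zero m s t) < 1)
    by (apply (dilatation_zero_in_disk m sigma d); assumption).
  assert (Ninv : inv_2iPI <> RtoC 0).
  { unfold inv_2iPI. intros F. injection F. intros F1. pose proof PI_RGT_0.
    pose proof (Rinv_0_lt_compat (2 * PI) ltac:(lra)). lra. }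
  exists p. split; [exact Hp|]. intros f.
  assert (Hjac : sense_preserving_on disk f).
  { intros z Hz. unfold f. rewrite jacobian_poisson by assumption.
    destruct (Hdil z Hz) as [Nh Eq].
    pose proof (mobius_in_disk _ _ z HX Hz0 Hz) as Hmob.
    rewrite !Cmod_mult.
    set (gp := pole_sum (Cconj (b3 - b4)) (Cconj (b4 - b1)) (Cconj (b1 - b2)) (Cconj (b2 - b3)) p z) in *.
    set (hp := pole_sum (b3 - b4) (b4 - b1) (b1 - b2) (b2 - b3) p z) in *.
    assert (Eg : gp = (mobius (dilatation_factor b1 b3 m s t) (dilatation_zero m s t) z ^ 2 * hp)%C).
    { rewrite <- Eq. field. exact Nh. }
    set (mo := mobius _ _ z) in *.
    assert (Lg : Cmod gp = Cmod mo ^ 2 * Cmod hp).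
    { rewrite Eg, Cmod_mult. f_equal. simpl. rewrite !Cmod_mult, Cmod_1. ring. }
    rewrite Lg. pose proof (proj1 (Cmod_gt_0 hp) Nh). pose proof (proj1 (Cmod_gt_0 inv_2iPI) Ninv).
    pose proof (Cmod_ge_0 mo).
    (* From [|g'| = |phi|^2 |h'|] the Jacobian is [|h'|^2 (1 - |phi|^4)]. *)
    replace (_ - _) with ((Cmod inv_2iPI * Cmod hp) ^ 2 * (1 - Cmod mo ^ 4)) by ring.
    apply Rmult_lt_0_compat.
    - apply pow_lt, Rmult_lt_0_compat; assumption.
    - assert (Cmod mo ^ 2 < 1) by nra. nra. }
  split; [apply poisson_harmonic, Hp|]. split; [exact Hjac|]. split.
  - exists (holomorphic_part b1 b2 b3 b4 p), (antiholomorphic_part b1 b2 b3 b4 p).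
    split; [intros z Hz; eexists; apply is_C_derive_holomorphic_part, Hz|].
    split; [intros z Hz; eexists; apply is_C_derive_antiholomorphic_part, Hz|].
    split; [unfold antiholomorphic_part; rewrite log_sum_0; ring|].
    split; [intros z Hz; apply poisson_decomposition; assumption|].
    exists m, s, t. split; [exact Hcoord|]. split; [exact HX|]. split; [exact Hz0|].
    intros z Hz. destruct (Hdil z Hz) as [Nh Eq].
    rewrite (is_C_derive_unique _ _ _ (is_C_derive_holomorphic_part b1 b2 b3 b4 p z Hz)).
    rewrite (is_C_derive_unique _ _ _ (is_C_derive_antiholomorphic_part b1 b2 b3 b4 p z Hz)).
    split; [apply Cmult_neq_0; assumption|].
    rewrite <- Eq. field. auto.
  - apply poisson_diffeomorphism; assumption.
Qed.
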